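(* Let $L\subset(1,\infty)$ and $M,N\subset[1,\infty)$ be finite sets, not all empty, let \[ X=\Bigl(\bigoplus_{p\in L}B_p\Bigr)\oplus\Bigl(\bigoplus_{q\in M}\ell_q\Bigr)\oplus\Bigl(\bigoplus_{r\in N}S_r\Bigr),\] and set $Y=X\oplus c_0$. (1) If $N\neq\emptyset$, then $Y$ is isomorphic to $X$; consequently, with $k=|L|+|L\cup M|+|N|$, every composition of $k+1$ strictly singular operators on $Y$ is compact, there are $k$ strictly singular operators on $Y$ whose composition is not compact, and hence $\mathscr{S}(Y)/\mathscr{K}(Y)$ is nilpotent of index $k+1$. (2) If $N=\emptyset$, so that $Y=\bigl(\bigoplus_{p\in L}B_p\bigr)\oplus\bigl(\bigoplus_{q\in M}\ell_q\bigr)\oplus c_0$, then every composition of $|L|+|L\cup M|+1$ strictly singular operators on $Y$ is compact, but there are $|L|+|L\cup M|$ strictly singular operators on $Y$ whose composition is not compact.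
   Context: All vector spaces are over a fixed scalar field $\mathbb{K}\in\{\mathbb{R},\mathbb{C}\}$, and $\mathbb{N}=\{1,2,3,\ldots\}$. For $x\in\mathbb{K}^{\mathbb{N}}$, $x(n)$ denotes its $n$th coordinate; $c_{00}$ is the space of finitely supported elements of $\mathbb{K}^{\mathbb{N}}$. A Schreier set is a finite set $F\subset\mathbb{N}$ with $F=\emptyset$ or $|F|\le\min F$; $\mathcal{S}_1$ is the family of all Schreier sets. For $1\le p<\infty$ and $x\in\mathbb{K}^{\mathbb{N}}$, put $\|x\|_{S_p}=\sup_{F\in\mathcal{S}_1}\bigl(\sum_{n\in F}|x(n)|^p\bigr)^{1/p}\in[0,\infty]$. The set $Z_p=\{x\in\mathbb{K}^{\mathbb{N}}:\|x\|_{S_p}<\infty\}$ is a Banach space in this norm, and the $p$-convexified Schreier space $S_p$ is the closure of $c_{00}$ in $Z_p$. A Schreier chain is a non-empty finite collection $\mathcal{C}=\{F_1,\ldots,F_m\}$ of non-empty Schreier sets with $\max F_j<\min F_{j+1}$ for $1\le j<m$. For $1<p<\infty$ and $x\in\mathbb{K}^{\mathbb{N}}$, put $\|x\|_{B_p}=\sup_{\mathcal{C}}\bigl(\sum_{F\in\mathcal{C}}(\sum_{n\in F}|x(n)|)^p\bigr)^{1/p}\in[0,\infty]$, the supremum being over all Schreier chains $\mathcal{C}$. The $p$th Baernstein space is the Banach space $B_p=\{x\in\mathbb{K}^{\mathbb{N}}:\|x\|_{B_p}<\infty\}$ with this norm. $\ell_p=\ell_p(\mathbb{N})$ and $c_0=c_0(\mathbb{N})$.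 Finite direct sums carry, say, the maximum norm (any equivalent norm gives the same conclusions). An operator is a bounded linear map between Banach spaces; it is strictly singular if no restriction of it to an infinite-dimensional subspace of its domain is an isomorphic embedding. $\mathscr{S}(Y)$ and $\mathscr{K}(Y)$ denote the sets (ideals) of strictly singular, respectively compact, operators from $Y$ to $Y$. A ring $\mathscr{A}$ is nilpotent if, for some $k\in\mathbb{N}$, $a_1a_2\cdots a_k=0$ for all $a_1,\ldots,a_k\in\mathscr{A}$; the smallest such $k$ is its index of nilpotency. *)

(* Defs.v *)
From HB Require Import structures.
From mathcomp Require Import all_boot all_order all_algebra.
From mathcomp Require Import finmap.
From mathcomp Require Import complex.
From mathcomp Require Import ring.
From mathcomp Require Import all_classical all_reals all_analysis.

Set Implicit Arguments.
Unset Strict Implicit.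
Unset Printing Implicit Defensive.

Import Order.TTheory GRing.Theory Num.Theory.
Import numFieldNormedType.Exports.
Local Open Scope classical_set_scope.
Local Open Scope ring_scope.

Variant scalar_kind := RealScalars | ComplexScalars.

Definition scalars (R : realType) (k : scalar_kind) : numFieldType :=
  match k with RealScalars => R | ComplexScalars => R[i] end.

(* The norm of [scalars R k] takes its values in [scalars R k]; [modulus] is
   the same absolute value with values in R, where suprema are available, and
   [of_real] goes back (see [norm_modulus]). *)
Definition modulus (R : realType) (k : scalar_kind) : scalars R k -> R :=
  match k with
  | RealScalars => fun x : R => `|x|
  | ComplexScalars => fun z : R[i] => complex.Re `|z|
  end.

Definition of_real (R : realType) (k : scalar_kind) : R -> scalars R k :=
  match k with
  | RealScalars => id
  | ComplexScalars => fun x : R => (x%:C)%C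
  end.

Section scalars_theory.
Context {R : realType} {k : scalar_kind}.
Implicit Types x y : scalars R k.

Lemma of_real_le (a b : R) : (of_real k a <= of_real k b) = (a <= b).
Proof. by case: k => //=; rewrite lecR. Qed.

Lemma of_realD (a b : R) : of_real k (a + b) = of_real k a + of_real k b.
Proof. by case: k => //=; rewrite rmorphD. Qed.

Lemma of_realM (a b : R) : of_real k (a * b) = of_real k a * of_real k b.
Proof. by case: k => //=; rewrite rmorphM. Qed.

Lemma of_real0 : of_real k (0 : R) = 0.
Proof. by case: k => //=; rewrite rmorph0. Qed.

Lemma of_real_inj : injective (of_real k : R -> scalars R k).
Proof. by case: k => [a b|a b []]. Qed.

Lemma norm_modulus x : `|x| = of_real k (modulus x).
Proof. by move: x; case: k => //= z; rewrite RRe_real// normr_real. Qed.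

Lemma modulus_ge0 x : 0 <= modulus x.
Proof. by rewrite -(of_real_le _ _) of_real0 -norm_modulus. Qed.

Lemma modulusD x y : modulus (x + y) <= modulus x + modulus y.
Proof. by rewrite -of_real_le of_realD -!norm_modulus ler_normD. Qed.

Lemma modulusM x y : modulus (x * y) = modulus x * modulus y.
Proof. by apply: of_real_inj; rewrite of_realM -!norm_modulus normrM. Qed.

Lemma modulus0 : modulus (0 : scalars R k) = 0.
Proof. by apply: of_real_inj; rewrite of_real0 -norm_modulus normr0. Qed.

Lemma modulus0_eq0 x : modulus x = 0 -> x = 0.
Proof. by move=> x0; apply/normr0_eq0; rewrite norm_modulus x0 of_real0. Qed.

Lemma modulusV x : modulus x^-1 = (modulus x)^-1.
Proof.
have [->|x0] := eqVneq x 0; first by rewrite invr0 modulus0 invr0.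
have mx0 : modulus x != 0 by apply: contra_neq x0; exact: modulus0_eq0.
apply: (mulIf mx0); rewrite mulVf// -modulusM mulVf//.
by apply: of_real_inj; rewrite -norm_modulus normr1; case: k.
Qed.

End scalars_theory.

(* [x n] is the coordinate of index n + 1: the coordinates are indexed by
   {1, 2, 3, ...} in the definition of Schreier sets. *)
Notation scalar_seq R k := (nat -> scalars R k).

(* A normed space of scalar sequences: the subspace [seq_carrier] of K^N with
   the restriction of the [0, +oo]-valued norm [seq_norm]. *)
Record seq_space (R : realType) (k : scalar_kind) := SeqSpace {
  seq_carrier : set (scalar_seq R k) ;
  seq_norm : scalar_seq R k -> \bar R ;
  seq_carrier0 : seq_carrier 0 ;
  seq_carrierP :
    forall a x y, seq_carrier x -> seq_carrier y -> seq_carrier (a *: x + y) ;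
  seq_norm_lty : forall x, seq_carrier x -> (seq_norm x < +oo)%E ;
  seq_norm_ge0 : forall x, (0 <= seq_norm x)%E ;
  seq_normD : forall x y, (seq_norm (x + y)%R <= seq_norm x + seq_norm y)%E ;
  seq_normZ : forall a x, (seq_norm (a *: x)%R = (modulus a)%:E * seq_norm x)%E ;
  seq_norm_eq0 : forall x, seq_norm x = 0%E -> x = 0 }.

Definition seq_pred (R : realType) (k : scalar_kind) (E : seq_space R k) :
  {pred scalar_seq R k} := [pred x | x \in seq_carrier E].

Record seq_elt (R : realType) (k : scalar_kind) (E : seq_space R k) := SeqElt {
  seq_val : scalar_seq R k ;
  seq_valP : seq_val \in seq_pred E }.

Section seq_elt_normed.
Context {R : realType} {k : scalar_kind} (E : seq_space R k).

Lemma seq_pred_submod : submod_closed (seq_pred E).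
Proof.
split=> [|a x y /set_mem Ex /set_mem Ey]; apply/mem_set.
  exact: seq_carrier0.
exact: seq_carrierP.
Qed.

HB.instance Definition _ := [isSub for @seq_val R k E].
HB.instance Definition _ := [Choice of seq_elt E by <:].
HB.instance Definition _ := GRing.isSubmodClosed.Build (scalars R k) _
  (seq_pred E) (GRing.submod_closed_semi seq_pred_submod).
HB.instance Definition _ := [SubChoice_isSubLmodule of seq_elt E by <:].

Definition seq_elt_norm (x : seq_elt E) : scalars R k :=
  of_real k (fine (seq_norm E (val x))).

Lemma seq_norm_fin (x : seq_elt E) : seq_norm E (val x) \is a fin_num.
Proof.
by rewrite ge0_fin_numE ?seq_norm_ge0// seq_norm_lty//; exact/set_mem/(valP x).
Qed.

Lemma seq_elt_normD x y :
  seq_elt_norm (x + y) <= seq_elt_norm x + seq_elt_norm y.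
Proof.
rewrite -of_realD of_real_le -fineD ?seq_norm_fin// fine_le ?seq_norm_fin//.
  by rewrite fin_numD !seq_norm_fin.
exact: seq_normD.
Qed.

Lemma seq_elt_normZ a x : seq_elt_norm (a *: x) = `|a| * seq_elt_norm x.
Proof.
rewrite norm_modulus -of_realM; congr of_real.
by rewrite (linearZ_LR (val : seq_elt E -> _)) seq_normZ fineM// seq_norm_fin.
Qed.

Lemma seq_elt_norm_eq0 x : seq_elt_norm x = 0 -> x = 0.
Proof.
rewrite -(@of_real0 R k) => /of_real_inj x0; apply/val_inj/(@seq_norm_eq0 _ _ E).
by rewrite -[LHS]fineK ?seq_norm_fin// x0.
Qed.

HB.instance Definition _ := Lmodule_isNormed.Build (scalars R k) (seq_elt E)
  seq_elt_normD seq_elt_normZ seq_elt_norm_eq0.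

End seq_elt_normed.

Section minkowski_sum.
Context {R : realType} {I : Type}.

Lemma powR_powRV (p x : R) : 1 <= p -> 0 <= x -> (x `^ p) `^ p^-1 = x.
Proof.
by move=> p1 x0; rewrite -powRrM mulfV ?powRr1// gt_eqF// (lt_le_trans ltr01).
Qed.

Lemma powRV_powR (p x : R) : 1 <= p -> 0 <= x -> (x `^ p^-1) `^ p = x.
Proof.
by move=> p1 x0; rewrite -powRrM mulVf ?powRr1// gt_eqF// (lt_le_trans ltr01).
Qed.

Lemma convex_powR_le (p a b A B : R) :
  1 <= p -> 0 <= a -> 0 <= b -> 0 < A -> 0 < B ->
  ((a + b) / (A + B)) `^ p <=
  A / (A + B) * (a / A) `^ p + B / (A + B) * (b / B) `^ p.
Proof.
move=> p1 a0 b0 A0 B0.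
have AB0 : 0 < A + B by rewrite addr_gt0.
have t0 : 0 <= A / (A + B) by rewrite divr_ge0 ?ltW.
have t1 : A / (A + B) <= 1 by rewrite ler_pdivrMr// mul1r lerDl ltW.
have := @convex_powR R p p1 (Itv01 t0 t1) (a / A) (b / B).
have aA : 0 <= a / A by rewrite divr_ge0// ltW.
have bB : 0 <= b / B by rewrite divr_ge0// ltW.
rewrite !inE/= !in_itv/= !andbT => /(_ aA bB).
rewrite convRE/=.
have onemE : unstable.onem (A / (A + B)) = B / (A + B).
  rewrite /unstable.onem -[X in X - _](@divff _ (A + B)) ?gt_eqF// -mulrBl.
  by rewrite addrAC subrr add0r.
rewrite onemE.
congr (_ `^ _ <= _); etransitivity; first exact: convRE.
rewrite /= onemE; field.
by rewrite !gt_eqF.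
Qed.

Lemma minkowski_sum (s : seq I) (p : R) (a b : I -> R) : 1 <= p ->
  (forall i, 0 <= a i) -> (forall i, 0 <= b i) ->
  (\sum_(i <- s) (a i + b i) `^ p) `^ p^-1 <=
  (\sum_(i <- s) a i `^ p) `^ p^-1 + (\sum_(i <- s) b i `^ p) `^ p^-1.
Proof.
move=> p1 a0 b0; have p0 : 0 <= p by exact: le_trans p1.
set A := (X in _ <= X + _); set B := (X in _ <= _ + X).
have A0 : 0 <= A by exact: powR_ge0.
have B0 : 0 <= B by exact: powR_ge0.
have leA : (\sum_(i <- s) a i `^ p) `^ p^-1 <= A by exact: lexx.
have leB : (\sum_(i <- s) b i `^ p) `^ p^-1 <= B by exact: lexx.
clearbody A B; apply/ler_addgt0Pr => e e0.
have e20 : 0 < e / 2 by rewrite divr_gt0.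
have norm1 (c : I -> R) (C : R) : (forall i, 0 <= c i) ->
    (\sum_(i <- s) c i `^ p) `^ p^-1 <= C -> 0 < C ->
    \sum_(i <- s) (c i / C) `^ p <= 1.
  move=> c0 cC C0; have Cp0 : 0 < C `^ p by rewrite powR_gt0.
  rewrite -(ler_pM2l Cp0) mulr1 mulr_sumr.
  rewrite (eq_bigr (fun i => c i `^ p)); last first.
    move=> i _; rewrite -powRM; [|exact: ltW|by rewrite divr_ge0// ltW].
    by rewrite mulrCA mulfV ?mulr1// gt_eqF.
  have S0 : 0 <= \sum_(i <- s) c i `^ p.
    by apply: sumr_ge0 => j _; rewrite powR_ge0.
  rewrite -[leLHS](@powRV_powR p _ p1 S0).
  apply: (ge0_ler_powR p0 _ _ cC); rewrite nnegrE; [exact: powR_ge0|exact: ltW].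
have A'0 : 0 < A + e / 2 by rewrite ltr_wpDl.
have B'0 : 0 < B + e / 2 by rewrite ltr_wpDl.
have e2w : 0 <= e / 2 by exact: ltW.
have a1 := norm1 a (A + e / 2) a0 (ler_wpDr e2w leA) A'0.
have b1 := norm1 b (B + e / 2) b0 (ler_wpDr e2w leB) B'0.
set A' := A + e / 2 in a1 A'0; set B' := B + e / 2 in b1 B'0.
have -> : A + B + e = A' + B' by rewrite addrACA -splitr.
have AB'0 : 0 < A' + B' by rewrite addr_gt0.
have ABp0 : 0 < (A' + B') `^ p by rewrite powR_gt0.
rewrite -[leRHS](@powR_powRV p)//; last exact: ltW.
apply: ge0_ler_powR.
- by rewrite invr_ge0.
- by rewrite nnegrE; apply: sumr_ge0 => i _; exact: powR_ge0.
- by rewrite nnegrE ltW.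
apply: (@le_trans _ _
  (\sum_(i <- s) ((A' + B') `^ p * (((a i + b i) / (A' + B')) `^ p)))).
  apply: ler_sum => i _.
  rewrite -powRM; [|exact: ltW|by rewrite divr_ge0 ?addr_ge0// ltW].
  by rewrite mulrCA mulfV ?mulr1// gt_eqF.
rewrite -mulr_sumr -[leRHS]mulr1 ler_pM2l//.
apply: (@le_trans _ _ (\sum_(i <- s) (A' / (A' + B') * (a i / A') `^ p
    + B' / (A' + B') * (b i / B') `^ p))).
  by apply: ler_sum => i _; exact: convex_powR_le.
rewrite big_split/= -!mulr_sumr.
have -> : 1 = A' / (A' + B') * 1 + B' / (A' + B') * 1 :> R.
  by rewrite !mulr1 -mulrDl divff// gt_eqF.
by rewrite lerD// ler_wpM2l// divr_ge0// ltW.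
Qed.

End minkowski_sum.

Section finite_lp.
Context {R : realType} {I : Type}.
Implicit Types (s : seq I) (p : R) (u v : I -> R).

Definition finite_lp p s u : R := (\sum_(i <- s) u i `^ p) `^ p^-1.

Lemma finite_lp_ge0 p s u : 0 <= finite_lp p s u.
Proof. exact: powR_ge0. Qed.

Lemma finite_lp_le p s u v : 1 <= p -> (forall i, 0 <= u i) ->
  (forall i, u i <= v i) -> finite_lp p s u <= finite_lp p s v.
Proof.
move=> p1 u0 uv; have p0 : 0 <= p by exact: le_trans p1.
have v0 i : 0 <= v i by exact: le_trans (uv i).
apply: ge0_ler_powR.
- by rewrite invr_ge0.
- by rewrite nnegrE; apply: sumr_ge0 => i _; exact: powR_ge0.
- by rewrite nnegrE; apply: sumr_ge0 => i _; exact: powR_ge0.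
by apply: ler_sum => i _; apply: ge0_ler_powR; rewrite ?nnegrE.
Qed.

Lemma finite_lpD p s u v : 1 <= p ->
  (forall i, 0 <= u i) -> (forall i, 0 <= v i) ->
  finite_lp p s (fun i => u i + v i) <= finite_lp p s u + finite_lp p s v.
Proof. exact: minkowski_sum. Qed.

Lemma finite_lpZ p s c u : 1 <= p -> 0 <= c -> (forall i, 0 <= u i) ->
  finite_lp p s (fun i => c * u i) = c * finite_lp p s u.
Proof.
move=> p1 c0 u0; rewrite /finite_lp.
under eq_bigr do rewrite powRM//.
rewrite -mulr_sumr powRM ?powR_ge0//; first by rewrite powR_powRV.
by apply: sumr_ge0 => i _; exact: powR_ge0.
Qed.

Lemma finite_lp1 p i u : 1 <= p -> 0 <= u i -> finite_lp p [:: i] u = u i.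
Proof. by move=> p1 u0; rewrite /finite_lp big_seq1 powR_powRV. Qed.

End finite_lp.

Section sup_seminorm.
Context {R : realType} {k : scalar_kind} {T : Type}.
Variables (P : set T) (phi : T -> scalar_seq R k -> R).
Hypothesis phi_ge0 : forall t x, 0 <= phi t x.
Hypothesis phiD : forall t x y, phi t (x + y) <= phi t x + phi t y.
Hypothesis phiZ : forall t a x, phi t (a *: x) = modulus a * phi t x.
Hypothesis phi_coord :
  forall n, exists2 t, P t & forall x, phi t x = modulus (x n).

Let N x := ereal_sup [set (phi t x)%:E | t in P].

Lemma sup_seminorm_ge0 x : (0 <= N x)%E.
Proof.
have [t Pt _] := phi_coord 0%N; apply: (@le_trans _ _ (phi t x)%:E).
  by rewrite lee_fin.
by apply: ereal_sup_ubound; exists t.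
Qed.

Lemma sup_seminormD x y : (N (x + y)%R <= N x + N y)%E.
Proof.
apply: ge_ereal_sup => _ [t Pt <-].
apply: (@le_trans _ _ ((phi t x)%:E + (phi t y)%:E)%E).
  by rewrite -EFinD lee_fin.
by apply: leeD; apply: ereal_sup_ubound; exists t.
Qed.

Lemma sup_seminormZ a x : (N (a *: x)%R = (modulus a)%:E * N x)%E.
Proof.
rewrite /N -ereal_supZl ?modulus_ge0//; last first.
  by have [t Pt _] := phi_coord 0%N; apply/set0P; exists (phi t x)%:E, t.
rewrite image_comp; congr (ereal_sup _); apply: eq_imagel => t _ /=.
by rewrite phiZ EFinM.
Qed.

Lemma modulus_le_sup_seminorm x n : ((modulus (x n))%:E <= N x)%E.
Proof.
have [t Pt tE] := phi_coord n.
by rewrite -tE; apply: ereal_sup_ubound; exists t.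
Qed.

Lemma sup_seminorm_eq0 x : N x = 0%E -> x = 0.
Proof.
move=> x0; apply/funext => n; apply: modulus0_eq0; apply/eqP.
rewrite eq_le modulus_ge0 andbT -lee_fin.
by apply: le_trans (modulus_le_sup_seminorm x n) _; rewrite x0.
Qed.

End sup_seminorm.

Lemma scale_add_lt (R : realType) (a e : R) (u v : \bar R) :
  0 <= a -> 0 < e -> (0 <= u)%E -> (u < (e / 2 / (a + 1))%:E)%E ->
  (v < (e / 2)%:E)%E -> (a%:E * u + v < e%:E)%E.
Proof.
move=> a0 e0 u0 ue ve; rewrite [in ltRHS](splitr e) EFinD.
have uf : u \is a fin_num by rewrite ge0_fin_numE// (lt_trans ue)// ltry.
apply: lee_ltD => //; first by rewrite fin_numM.
have a10 : 0 < a + 1 by rewrite ltr_wpDl.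
apply: (@le_trans _ _ (a%:E * (e / 2 / (a + 1))%:E)%E).
  by rewrite lee_wpmul2l ?lee_fin// ltW.
rewrite -EFinM lee_fin mulrCA ler_piMr//; first by rewrite divr_ge0// ltW.
by rewrite ler_pdivrMr ?mul1r ?lerDl.
Qed.

Lemma lty_submod (R : realType) (k : scalar_kind)
    (N : scalar_seq R k -> \bar R) a x y :
  (forall x, 0 <= N x)%E -> (forall x y, N (x + y)%R <= N x + N y)%E ->
  (forall a x, N (a *: x)%R = (modulus a)%:E * N x)%E ->
  (N x < +oo)%E -> (N y < +oo)%E -> (N (a *: x + y)%R < +oo)%E.
Proof.
move=> N0 ND NZ Nx Ny; apply: le_lt_trans (ND _ _) _.
rewrite NZ lte_add_pinfty// -ge0_fin_numE ?mule_ge0 ?lee_fin ?modulus_ge0//.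
by rewrite fin_numM// ge0_fin_numE.
Qed.

Lemma seq_norm0 (R : realType) (k : scalar_kind)
    (N : scalar_seq R k -> \bar R) :
  (forall a x, N (a *: x)%R = (modulus a)%:E * N x)%E -> N 0 = 0%E.
Proof.
by move=> NZ; rewrite -[X in N X](scale0r (0 : scalar_seq R k)) NZ modulus0 mul0e.
Qed.

(* Baernstein spaces are also defined for p = 1; statements about them assume
   1 < p separately. *)
Definition exponent (R : realType) := {p : R | 1 <= p}.

(* F is identified with the set {n + 1 | n in F} of coordinates, so the
   condition reads: F is empty or #|F| is at most the minimum of that set. *)
Definition schreier (F : {fset nat}) : Prop :=
  forall n, n \in F -> (#|` F| <= n.+1)%N.

(* A chain is listed in increasing order. *)
Definition schreier_chain (C : seq {fset nat}) : Prop :=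
  [/\ C != [::],
      forall F, F \in C -> F != fset0 /\ schreier F
    & sorted (fun F G : {fset nat} => all (fun m => all (ltn m) G) F) C].

Section spaces.
Context {R : realType} (k : scalar_kind) (p : exponent R).
Implicit Types x y : scalar_seq R k.

Let p1 : 1 <= val p. Proof. exact: valP. Qed.

Definition schreier_norm x : \bar R :=
  ereal_sup [set ((\sum_(n <- F) modulus (x n) `^ val p) `^ (val p)^-1)%:E
            | F in schreier].

Definition baernstein_norm x : \bar R :=
  ereal_sup
    [set ((\sum_(F <- C) (\sum_(n <- (F : {fset nat})) modulus (x n)) `^ val p)
            `^ (val p)^-1)%:E
    | C in schreier_chain].

Definition ellp_norm x : \bar R :=
  Lnorm counting (val p)%:E (fun n => (modulus (x n))%:E).

Definition sup_norm x : \bar R :=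
  ereal_sup [set (modulus (x n))%:E | n in setT].

Definition finitely_supported : set (scalar_seq R k) :=
  [set x | finite_set [set n | x n != 0]].

(* The closure of the finitely supported sequences in the space of all
   sequences of finite Schreier norm. *)
Definition schreier_carrier : set (scalar_seq R k) :=
  [set x | (schreier_norm x < +oo)%E /\ forall e : R, 0 < e ->
    exists2 y, finitely_supported y & (schreier_norm (x - y)%R < e%:E)%E].

Definition c0_carrier : set (scalar_seq R k) :=
  [set x | modulus (x n) @[n --> \oo] --> 0].

Let lp_mod (F : {fset nat}) x := finite_lp (val p) F (fun n => modulus (x n)).

Let lp_modD F x y : lp_mod F (x + y) <= lp_mod F x + lp_mod F y.
Proof.
apply: le_trans (finite_lpD _ p1 _ _); try by move=> n; exact: modulus_ge0.
by apply: finite_lp_le => // n; [exact: modulus_ge0|exact: modulusD].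
Qed.

Let lp_modZ F a x : lp_mod F (a *: x) = modulus a * lp_mod F x.
Proof.
rewrite /lp_mod -(finite_lpZ _ p1 (modulus_ge0 a)); last first.
  by move=> n; exact: modulus_ge0.
by congr finite_lp; apply/funext => n; rewrite -modulusM.
Qed.

Lemma schreier1 n : schreier [fset n]%fset.
Proof. by move=> m _; rewrite cardfs1. Qed.

Let lp_mod_coord n :
  exists2 F, schreier F & forall x, lp_mod F x = modulus (x n).
Proof.
exists [fset n]%fset; first exact: schreier1.
move=> x; rewrite /lp_mod /finite_lp big_seq_fset1 powR_powRV//.
exact: modulus_ge0.
Qed.

Lemma schreier_norm_ge0 x : (0 <= schreier_norm x)%E.
Proof. by apply: sup_seminorm_ge0 lp_mod_coord _ => *; exact: powR_ge0. Qed.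

Lemma schreier_normD x y :
  (schreier_norm (x + y)%R <= schreier_norm x + schreier_norm y)%E.
Proof. exact: sup_seminormD lp_modD _ _. Qed.

Lemma schreier_normZ a x :
  (schreier_norm (a *: x)%R = (modulus a)%:E * schreier_norm x)%E.
Proof. exact: sup_seminormZ lp_modZ lp_mod_coord _ _. Qed.

Lemma schreier_norm_eq0 x : schreier_norm x = 0%E -> x = 0.
Proof. exact: sup_seminorm_eq0 lp_mod_coord _. Qed.

Lemma schreier_carrier0 : schreier_carrier 0.
Proof.
have N0 := seq_norm0 schreier_normZ.
split => [|e e0]; first by rewrite N0 ltry.
exists 0; last by rewrite subr0 N0 lte_fin.
rewrite /finitely_supported/= (_ : [set _ | _] = set0)//.
by apply/seteqP; split => // n /=; rewrite eqxx.
Qed.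

Lemma schreier_carrierP a x y :
  schreier_carrier x -> schreier_carrier y -> schreier_carrier (a *: x + y).
Proof.
move=> [xoo xc] [yoo yc]; split => [|e e0].
  exact: lty_submod schreier_norm_ge0 schreier_normD schreier_normZ xoo yoo.
have m0 := modulus_ge0 a.
have d0 : 0 < e / 2 / (modulus a + 1).
  by rewrite !divr_gt0// ltr_wpDl.
have [x' fx' xx'] := xc _ d0.
have [y' fy' yy'] := yc (e / 2) ltac:(by rewrite divr_gt0).
exists (a *: x' + y').
  apply: (@sub_finite_set _ _
    ([set n | x' n != 0] `|` [set n | y' n != 0])); last by rewrite finite_setU.
  move=> n /=; apply: contraPP => /not_orP[/negP/negPn/eqP x0 /negP/negPn/eqP y0].
  have -> : (a *: x' + y') n = a * x' n + y' n by [].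
  by rewrite x0 y0 mulr0 addr0 eqxx.
rewrite (_ : _ - _ = a *: (x - x') + (y - y')); last first.
  by rewrite scalerBr opprD addrACA.
apply: le_lt_trans (schreier_normD _ _) _.
by rewrite schreier_normZ scale_add_lt// schreier_norm_ge0.
Qed.

Let chain_mod (C : seq {fset nat}) x :=
  finite_lp (val p) C (fun F => \sum_(n <- F) modulus (x n)).

Let sum_mod_ge0 (F : {fset nat}) x : 0 <= \sum_(n <- F) modulus (x n).
Proof. by apply: sumr_ge0 => n _; exact: modulus_ge0. Qed.

Let chain_modD C x y : chain_mod C (x + y) <= chain_mod C x + chain_mod C y.
Proof.
apply: le_trans (finite_lpD C p1 (sum_mod_ge0^~ x) (sum_mod_ge0^~ y)).
apply: finite_lp_le => // F.
by rewrite -big_split/=; apply: ler_sum => n _; exact: modulusD.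
Qed.

Let chain_modZ C a x : chain_mod C (a *: x) = modulus a * chain_mod C x.
Proof.
rewrite /chain_mod -(finite_lpZ _ p1 (modulus_ge0 a)); last first.
  exact: (sum_mod_ge0^~ x).
congr finite_lp; apply/funext => F; rewrite mulr_sumr.
by apply: eq_bigr => n _; rewrite -modulusM.
Qed.

Let chain_mod_coord n :
  exists2 C, schreier_chain C & forall x, chain_mod C x = modulus (x n).
Proof.
exists [:: [fset n]%fset].
  split => // F; rewrite inE => /eqP ->; split; last exact: schreier1.
  by apply/fset0Pn; exists n; rewrite inE.
move=> x; rewrite /chain_mod finite_lp1//.
by rewrite big_seq_fset1.
Qed.

Lemma baernstein_norm_ge0 x : (0 <= baernstein_norm x)%E.
Proof. by apply: sup_seminorm_ge0 chain_mod_coord _ => *; exact: powR_ge0. Qed.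

Lemma baernstein_normD x y :
  (baernstein_norm (x + y)%R <= baernstein_norm x + baernstein_norm y)%E.
Proof. exact: sup_seminormD chain_modD _ _. Qed.

Lemma baernstein_normZ a x :
  (baernstein_norm (a *: x)%R = (modulus a)%:E * baernstein_norm x)%E.
Proof. exact: sup_seminormZ chain_modZ chain_mod_coord _ _. Qed.

Lemma baernstein_lty0 : (baernstein_norm 0%R < +oo)%E.
Proof. by rewrite (seq_norm0 baernstein_normZ) ltry. Qed.

Lemma baernstein_ltyP a x y : (baernstein_norm x < +oo)%E ->
  (baernstein_norm y < +oo)%E -> (baernstein_norm (a *: x + y)%R < +oo)%E.
Proof. exact: lty_submod baernstein_norm_ge0 baernstein_normD baernstein_normZ. Qed.

Lemma baernstein_norm_eq0 x : baernstein_norm x = 0%E -> x = 0.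
Proof. exact: sup_seminorm_eq0 chain_mod_coord _. Qed.

Let p0 : 0 < val p. Proof. exact: lt_le_trans p1. Qed.

Lemma ellp_normE x : ellp_norm x =
  ((\sum_(0 <= n <oo) (modulus (x n) `^ val p)%:E) `^ (val p)^-1)%E.
Proof.
rewrite /ellp_norm Lnorm_counting//; congr (_ `^ _)%E.
by apply: eq_eseriesr => n _; rewrite /= ger0_norm// modulus_ge0.
Qed.

Lemma ellp_norm_ge0 x : (0 <= ellp_norm x)%E.
Proof. by rewrite ellp_normE poweR_ge0. Qed.

Lemma ellp_normD x y : (ellp_norm (x + y)%R <= ellp_norm x + ellp_norm y)%E.
Proof.
pose f (z : scalar_seq R k) n := modulus (z n).
have mf z : measurable_fun setT (f z) by [].
apply: le_trans (eminkowski counting (mf x) (mf y) _); last by rewrite lee_fin.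
rewrite ellp_normE Lnorm_counting//; apply: gt0_ler_poweR.
- by rewrite invr_ge0 ltW.
- by rewrite in_itv/= leey andbT nneseries_ge0// => n _ _; rewrite lee_fin powR_ge0.
- by rewrite in_itv/= leey andbT nneseries_ge0// => n _ _; rewrite poweR_ge0.
apply: lee_nneseries => [n _ _|n _]; first by rewrite lee_fin powR_ge0.
have fge0 : 0 <= f x n + f y n by rewrite addr_ge0 ?modulus_ge0.
rewrite /= ger0_norm// lee_fin.
apply: ge0_ler_powR; rewrite ?nnegrE ?modulus_ge0// ?modulusD//; exact: ltW.
Qed.

Lemma ellp_normZ a x : (ellp_norm (a *: x)%R = (modulus a)%:E * ellp_norm x)%E.
Proof.
rewrite !ellp_normE.
under eq_eseriesr do rewrite [(a *: x) _]/(a *: x _) modulusM powRM ?modulus_ge0// EFinM.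
rewrite nneseriesZl; last by move=> n _; rewrite lee_fin powR_ge0.
rewrite poweRM ?lee_fin ?powR_ge0//; last first.
  by apply: nneseries_ge0 => n _ _; rewrite lee_fin powR_ge0.
by rewrite poweR_EFin powR_powRV// modulus_ge0.
Qed.

Lemma ellp_lty0 : (ellp_norm 0%R < +oo)%E.
Proof. by rewrite (seq_norm0 ellp_normZ) ltry. Qed.

Lemma ellp_ltyP a x y : (ellp_norm x < +oo)%E ->
  (ellp_norm y < +oo)%E -> (ellp_norm (a *: x + y)%R < +oo)%E.
Proof. exact: lty_submod ellp_norm_ge0 ellp_normD ellp_normZ. Qed.

Lemma ellp_norm_eq0 x : ellp_norm x = 0%E -> x = 0.
Proof.
rewrite ellp_normE => /poweR_eq0_eq0 -/(_ _)/[dup].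
have t0 n : (0 <= n)%N -> true -> (0 <= (modulus (x n) `^ val p)%:E)%E.
  by move=> _ _; rewrite lee_fin powR_ge0.
move=> _ /(_ (nneseries_ge0 t0)) S0; apply/funext => n.
have : (modulus (x n) `^ val p)%:E = 0%E.
  apply/eqP; rewrite eq_le t0// andbT -[leRHS]S0.
  have := @nneseries_lim_ge R _ xpredT 0%N n.+1 t0; apply: le_trans.
  rewrite big_nat_recr//= leeDr// sume_ge0// => i _.
  by rewrite lee_fin powR_ge0.
by move=> [/eqP]; rewrite powR_eq0 => /andP[/eqP /modulus0_eq0].
Qed.

Let coord_mod (n : nat) x := modulus (x n).

Let coord_mod_coord n :
  exists2 m, setT m & forall x, coord_mod m x = modulus (x n).
Proof. by exists n. Qed.

Let coord_mod_ge0 n x : 0 <= coord_mod n x.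
Proof. exact: modulus_ge0. Qed.

Let coord_modD n x y : coord_mod n (x + y) <= coord_mod n x + coord_mod n y.
Proof. exact: modulusD. Qed.

Let coord_modZ n a x : coord_mod n (a *: x) = modulus a * coord_mod n x.
Proof. exact: modulusM. Qed.

Lemma sup_norm_ge0 x : (0 <= sup_norm x)%E.
Proof. exact: sup_seminorm_ge0 coord_mod_ge0 coord_mod_coord _. Qed.

Lemma sup_normD x y : (sup_norm (x + y)%R <= sup_norm x + sup_norm y)%E.
Proof. exact: sup_seminormD coord_modD _ _. Qed.

Lemma sup_normZ a x : (sup_norm (a *: x)%R = (modulus a)%:E * sup_norm x)%E.
Proof. exact: sup_seminormZ coord_modZ coord_mod_coord _ _. Qed.

Lemma sup_norm_eq0 x : sup_norm x = 0%E -> x = 0.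
Proof. exact: sup_seminorm_eq0 coord_mod_coord _. Qed.

Lemma c0_norm_lty x : c0_carrier x -> (sup_norm x < +oo)%E.
Proof.
move=> x0.
have [M [_ Mx]] := cvg_seq_bounded (cvgP _ x0).
apply: (@le_lt_trans _ _ (M + 1)%:E); last exact: ltry.
apply: ge_ereal_sup => _ [n _ <-]; rewrite lee_fin.
by have := Mx (M + 1) ltac:(by rewrite ltrDl) n I; rewrite /= ger0_norm ?modulus_ge0.
Qed.

Lemma c0_carrier0 : c0_carrier 0.
Proof.
rewrite /c0_carrier /= (_ : (fun n => _) = cst 0); first exact: cvg_cst.
by apply/funext => n; rewrite modulus0.
Qed.

Lemma c0_carrierP a x y :
  c0_carrier x -> c0_carrier y -> c0_carrier (a *: x + y).
Proof.
move=> x0 y0; apply: (@squeeze_cvgr _ _ _ _ (cst 0) (fun n => modulus a * modulus (x n) + modulus (y n))).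
- apply: nearW => n; rewrite modulus_ge0/=.
  by apply: le_trans (modulusD _ _) _; rewrite modulusM.
- exact: cvg_cst.
- rewrite -[X in _ --> X](addr0 0) -[X in _ --> X + _](mulr0 (modulus a)).
  by apply: cvgD => //; apply: cvgM => //; exact: cvg_cst.
Qed.

End spaces.

Definition baernstein_space (R : realType) (k : scalar_kind) (p : exponent R) :
  seq_space R k :=
  @SeqSpace R k [set x | (baernstein_norm p x < +oo)%E] (baernstein_norm p)
    (baernstein_lty0 k p) (@baernstein_ltyP _ _ p) (fun x => id)
    (baernstein_norm_ge0 p) (baernstein_normD p) (baernstein_normZ p)
    (@baernstein_norm_eq0 _ _ p).

Definition ellp_space (R : realType) (k : scalar_kind) (p : exponent R) :
  seq_space R k :=
  @SeqSpace R k [set x | (ellp_norm p x < +oo)%E] (ellp_norm p)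
    (ellp_lty0 k p) (@ellp_ltyP _ _ p) (fun x => id)
    (ellp_norm_ge0 p) (ellp_normD p) (ellp_normZ p)
    (@ellp_norm_eq0 _ _ p).

Definition schreier_space (R : realType) (k : scalar_kind) (p : exponent R) :
  seq_space R k :=
  @SeqSpace R k (schreier_carrier p) (schreier_norm p)
    (schreier_carrier0 k p) (@schreier_carrierP _ _ p) (fun x => @proj1 _ _)
    (schreier_norm_ge0 p) (schreier_normD p) (schreier_normZ p)
    (@schreier_norm_eq0 _ _ p).

Definition c0_space (R : realType) (k : scalar_kind) : seq_space R k :=
  @SeqSpace R k (@c0_carrier R k) (@sup_norm R k)
    (@c0_carrier0 R k) (@c0_carrierP R k) (@c0_norm_lty R k)
    (@sup_norm_ge0 R k) (@sup_normD R k) (@sup_normZ R k) (@sup_norm_eq0 R k).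

Definition baernstein (R : realType) k (p : exponent R) :
  normedModType (scalars R k) := seq_elt (baernstein_space k p).

Definition ellp (R : realType) k (p : exponent R) :
  normedModType (scalars R k) := seq_elt (ellp_space k p).

Definition convexified_schreier (R : realType) k (p : exponent R) :
  normedModType (scalars R k) := seq_elt (schreier_space k p).

Definition c0 (R : realType) k : normedModType (scalars R k) :=
  seq_elt (c0_space R k).

(* The direct sum of a finite family, with the maximum norm. *)
Record dsum (K : numFieldType) (I : finType) (E : I -> normedModType K) :=
  Dsum { component : forall i, E i }.

Section dsum_normed.
Context {K : numFieldType} {I : finType} (E : I -> normedModType K).
Implicit Types x y z : dsum E.

HB.instance Definition _ := [isNew for @component K I E].
HB.instance Definition _ := [Choice of dsum E by <:].

Lemma dsumP x y : (forall i, component x i = component y i) -> x = y.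
Proof.
by move=> xy; apply: val_inj => /=; apply: functional_extensionality_dep.
Qed.

Definition dsum0 : dsum E := Dsum (fun i => 0).
Definition dsum_opp x : dsum E := Dsum (fun i => - component x i).
Definition dsum_add x y : dsum E := Dsum (fun i => component x i + component y i).
Definition dsum_scale (a : K) x : dsum E := Dsum (fun i => a *: component x i).

Lemma dsum_addA : associative dsum_add.
Proof. by move=> x y z; apply: dsumP => i /=; rewrite addrA. Qed.
Lemma dsum_addC : commutative dsum_add.
Proof. by move=> x y; apply: dsumP => i /=; rewrite addrC. Qed.
Lemma dsum_add0 : left_id dsum0 dsum_add.
Proof. by move=> x; apply: dsumP => i /=; rewrite add0r. Qed.
Lemma dsum_addN : left_inverse dsum0 dsum_opp dsum_add.
Proof. by move=> x; apply: dsumP => i /=; rewrite addNr. Qed.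

HB.instance Definition _ := GRing.isZmodule.Build (dsum E)
  dsum_addA dsum_addC dsum_add0 dsum_addN.

Lemma dsum_scaleA a b x :
  dsum_scale a (dsum_scale b x) = dsum_scale (a * b) x.
Proof. by apply: dsumP => i /=; rewrite scalerA. Qed.
Lemma dsum_scale1 : left_id 1 dsum_scale.
Proof. by move=> x; apply: dsumP => i /=; rewrite scale1r. Qed.
Lemma dsum_scaleDr : right_distributive dsum_scale +%R.
Proof. by move=> a x y; apply: dsumP => i /=; rewrite scalerDr. Qed.
Lemma dsum_scaleDl x : {morph dsum_scale^~ x : a b / a + b >-> a + b}.
Proof. by move=> a b; apply: dsumP => i /=; rewrite scalerDl. Qed.

HB.instance Definition _ := GRing.Zmodule_isLmodule.Build K (dsum E)
  dsum_scaleA dsum_scale1 dsum_scaleDr dsum_scaleDl.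

Definition dsum_norm x : K :=
  (\big[Num.max/0%:nng]_i `|component x i|%:nng)%:num.

Lemma le_dsum_norm x i : `|component x i| <= dsum_norm x.
Proof. by rewrite /dsum_norm -[leLHS]nngE num_le; exact: (le_bigmax _ _ i). Qed.

Lemma dsum_norm_le x (c : K) : 0 <= c ->
  (forall i, `|component x i| <= c) -> dsum_norm x <= c.
Proof.
move=> c0 xc; rewrite /dsum_norm -[leRHS]/((NngNum c0)%:num) [_ <= _%:num]num_le.
apply/bigmax_leP; split=> [|i _].
  by [].
by rewrite -num_le/=; exact: xc.
Qed.

Lemma dsum_norm_ge0 x : 0 <= dsum_norm x.
Proof. by rewrite /dsum_norm. Qed.

Lemma dsum_normD x y : dsum_norm (x + y) <= dsum_norm x + dsum_norm y.
Proof.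
apply: dsum_norm_le => [|i]; first by rewrite addr_ge0// dsum_norm_ge0.
by apply: le_trans (ler_normD _ _) _; rewrite lerD ?le_dsum_norm.
Qed.

Lemma dsum_norm_leZ a x : dsum_norm (a *: x) <= `|a| * dsum_norm x.
Proof.
apply: dsum_norm_le => [|i]; first by rewrite mulr_ge0// dsum_norm_ge0.
by rewrite /= normrZ ler_wpM2l ?le_dsum_norm.
Qed.

Lemma dsum_normZ a x : dsum_norm (a *: x) = `|a| * dsum_norm x.
Proof.
apply/le_anti; rewrite dsum_norm_leZ/=; have [->|a0] := eqVneq a 0.
  by rewrite normr0 mul0r dsum_norm_ge0.
rewrite -ler_pdivlMl ?normr_gt0// -normfV.
by apply: le_trans (dsum_norm_leZ _ _); rewrite scalerA mulVf// scale1r.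
Qed.

Lemma dsum_norm_eq0 x : dsum_norm x = 0 -> x = 0.
Proof.
move=> x0; apply: dsumP => i; apply/normr0_eq0/le_anti.
by rewrite normr_ge0 andbT -x0 le_dsum_norm.
Qed.

HB.instance Definition _ := Lmodule_isNormed.Build K (dsum E)
  dsum_normD dsum_normZ dsum_norm_eq0.

End dsum_normed.

Section operators.
Context {K : numFieldType}.
Implicit Types E F : normedModType K.

Definition bounded_op E F (T : {linear E -> F}) : Prop :=
  exists M : K, forall x, `|T x| <= M * `|x|.

Definition isomorphic E F : Prop :=
  exists (T : {linear E -> F}) (S : {linear F -> E}),
    [/\ bounded_op T, bounded_op S, cancel T S & cancel S T].

Definition infinite_dimensional E (W : {pred E}) : Prop :=
  ~ exists (n : nat) (v : 'I_n -> E), forall x, x \in W ->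
      exists a : 'I_n -> K, x = \sum_(i < n) a i *: v i.

(* For complex scalars, [0 < c] says that c is real and positive. *)
Definition isomorphic_embedding_on E F (W : {pred E}) (T : {linear E -> F}) :
    Prop :=
  exists c C : K, 0 < c /\
    forall x, x \in W -> c * `|x| <= `|T x| /\ `|T x| <= C * `|x|.

Definition strictly_singular E F (T : {linear E -> F}) : Prop :=
  bounded_op T /\
  ~ exists W : {pred E}, [/\ submod_closed W, infinite_dimensional W
                           & isomorphic_embedding_on W T].

Definition compact_op E F (T : {linear E -> F}) : Prop :=
  bounded_op T /\ precompact (T @` [set x | `|x| <= 1]).

Definition compose E (Ts : seq {linear E -> E}) : {linear E -> E} :=
  foldr (fun T S : {linear E -> E} => T \o S : {linear E -> E}) idfun Ts.

End operators.

Section nilpotency.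
Context {A : Type} (C : set A) (zero : A) (mul : A -> A -> A).

(* The product of the n + 1 factors a 0, ..., a n. *)
Fixpoint product (a : nat -> A) (n : nat) : A :=
  if n is m.+1 then mul (product a m) (a n) else a 0%N.

Definition products_vanish (k : nat) : Prop :=
  (0 < k)%N /\
  forall a : nat -> A, (forall i, C (a i)) -> product a k.-1 = zero.

(* The (possibly non-unital) ring with carrier C is nilpotent of index k. *)
Definition nilpotent_of_index (k : nat) : Prop :=
  products_vanish k /\ forall j, products_vanish j -> (k <= j)%N.

End nilpotency.

(* The quotient ring of the ideal of strictly singular operators on Y by the
   ideal of compact ones; its elements are cosets, as sets of operators. *)
Section quotient_ring.
Context {K : numFieldType} (Y : normedModType K).
Implicit Types T U V W : {linear Y -> Y}.

Definition compact_coset T : set {linear Y -> Y} :=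
  [set U : {linear Y -> Y} | compact_op (U \- T)].

Definition SK_carrier : set (set {linear Y -> Y}) :=
  [set compact_coset T
  | T in [set T : {linear Y -> Y} | strictly_singular T]].

Definition SK_zero : set {linear Y -> Y} := compact_coset \0.

(* The coset of U \o V, for U in A and V in B. *)
Definition SK_mul (A B : set {linear Y -> Y}) : set {linear Y -> Y} :=
  [set W : {linear Y -> Y} | exists U V,
     [/\ A U, B V & compact_op (W \- (U \o V))]].

Definition SK_nilpotent_of_index : nat -> Prop :=
  nilpotent_of_index SK_carrier SK_zero SK_mul.

End quotient_ring.

(* Main.v *)
Require Import Defs.
From HB Require Import structures.
From mathcomp Require Import all_boot all_order all_algebra.
From mathcomp Require Import finmap.
From mathcomp Require Import complex.
From mathcomp Require Import ring lra zify.
From mathcomp Require Import all_classical all_reals all_analysis.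

Set Implicit Arguments.
Unset Strict Implicit.
Unset Printing Implicit Defensive.

Import Order.TTheory GRing.Theory Num.Theory.
Import numFieldNormedType.Exports.
Local Open Scope classical_set_scope.
Local Open Scope ring_scope.

(* Each of the spaces c_0, l_q, S_r, B_p is normed by a supremum of l_p-sums of
   l_r-sums over chains of Schreier sets (singletons for c_0 and l_q). Restricting the sets F of a chain by
   #F <= h (min F) instead of #F <= min F, for an increasing h, gives a scale of
   norms for each type of space, and the types are totally preordered by
   domination.

   A bounded coordinatewise null sequence without null subsequence has a
   subsequence that is a small perturbation of blocks. If the sup norms of the
   blocks do not tend to 0, sums of the blocks are equivalent to the norm of the
   same type with h = S o m, where m lists the starting points of the blocks;
   otherwise they are equivalent to such a norm of another type: l_p for B_p and
   l_p, c_0 for S_r and c_0. Suppose that a composition of strictly singular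
   operators is not compact. All the intermediate images of a suitable bounded
   sequence have such subsequences, with a common m. A strictly singular operator
   cannot map a sequence to one whose norm dominates its own, so the types
   decrease strictly along the composition, and there are at most as many of
   them as elements of the set Theta of types B_p (p in L), l_q (q in L u M),
   S_r (r in N), c_0.

   Conversely, all the spaces of Theta are complemented in Y, because B_p contains
   complemented copies of l_p and S_r of c_0, spanned by averages on disjoint
   Schreier sets. The formal inclusions between them are strictly singular in one
   direction for each pair, since an infinite-dimensional subspace contains a
   sequence whose coordinates tend to 0, and composing them along Theta gives a
   map that is not compact on the unit vectors. Finally a space E that contains c_0
   complemented is isomorphic to E + c_0, because c_0 is isomorphic to its square. *)

(** * Mixed norms *)

(** The scale in [h] is forced by the passage to blocks. A set of blocks is admissible when its size
    is allowed by the starting point of its first block, not by the index of that block, so peaked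
    blocks in S_r or B_p reproduce the norm of the space with [S \o m] in place of [S]; already for
    S_1 these two norms are inequivalent when [m] grows fast. Hence types are compared for a common
    [h], with a constant independent of it, and all stages of a composition, in all summands, have
    to be cut at the same points [m]. A free ultrafilter makes this possible: it decides once, for
    each of finitely many sequences, whether its norms and its sup norms tend to 0, and the finitely
    many conditions on the next index hold together on one of its sets. The comparison rests on
    [n < h n]: half of every finite set is then admissible, which places S_r between l_r and every
    l_q with q > r and makes the preorder total. Norms enter through the predicate [nle], a bound
    for all test chains, so that no supremum has to be finite or attained. *)

Section power_sums.
Context {R : realType}.

Lemma ler_powR_nneg (p x y : R) : 0 < p -> 0 <= x -> 0 <= y ->
  (x `^ p <= y `^ p) = (x <= y).
Proof.
move=> p0 x0 y0; apply/idP/idP; last first.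
  by move=> xy; apply: ge0_ler_powR; rewrite ?nnegrE// ltW.
apply: contraTT; rewrite -!ltNge => yx; rewrite lt_neqAle.
have -> : y `^ p <= x `^ p by apply: ge0_ler_powR; rewrite ?nnegrE// ltW.
rewrite andbT; apply/eqP => /(powR_injective p0).
by rewrite !nnegrE => /(_ y0 x0) E; rewrite E ltxx in yx.
Qed.

Lemma finite_lp_pow {I : Type} (p : R) (s : seq I) (u : I -> R) : 1 <= p ->
  finite_lp p s u `^ p = \sum_(i <- s) u i `^ p.
Proof.
move=> p1; rewrite /finite_lp powRV_powR//.
by apply: sumr_ge0 => i _; exact: powR_ge0.
Qed.

Lemma finite_lp_leP {I : Type} (p : R) (s : seq I) (u : I -> R) (c : R) :
  1 <= p -> 0 <= c -> (finite_lp p s u <= c) = (\sum_(i <- s) u i `^ p <= c `^ p).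
Proof.
move=> p1 c0; have p0 : 0 < p by exact: lt_le_trans p1.
by rewrite -finite_lp_pow// ler_powR_nneg// finite_lp_ge0.
Qed.

Lemma finite_lp_le_in {I : eqType} (p : R) (s : seq I) (u v : I -> R) : 1 <= p ->
  {in s, forall i, 0 <= u i <= v i} -> finite_lp p s u <= finite_lp p s v.
Proof.
move=> p1 uv; have p0 : 0 < p by exact: lt_le_trans p1.
rewrite finite_lp_leP ?finite_lp_ge0// finite_lp_pow//.
rewrite big_seq [leRHS]big_seq; apply: ler_sum => i /uv /andP[u0 uvi].
by rewrite ler_powR_nneg// (le_trans u0).
Qed.

Lemma eq_finite_lp {I : eqType} (p : R) (s : seq I) (u v : I -> R) :
  {in s, u =1 v} -> finite_lp p s u = finite_lp p s v.
Proof. by move=> uv; congr (_ `^ _); apply: eq_big_seq => i /uv ->. Qed.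

Lemma finite_lp_map {I J : Type} (p : R) (f : J -> I) (s : seq J) (u : I -> R) :
  finite_lp p (map f s) u = finite_lp p s (u \o f).
Proof. by rewrite /finite_lp big_map. Qed.

Lemma ler_sum_sub {I : eqType} (s s' : seq I) (f : I -> R) : uniq s ->
  {subset s <= s'} -> (forall i, 0 <= f i) ->
  \sum_(i <- s) f i <= \sum_(i <- s') f i.
Proof.
elim: s s' => [|x s IH] s' /=; first by rewrite big_nil => *; exact: sumr_ge0.
move=> /andP[xs us] ss' f0; have xs' : x \in s' by rewrite ss' ?mem_head.
rewrite big_cons (perm_big _ (perm_to_rem xs'))/= big_cons lerD2l IH// => i si.
have : i \in s' by rewrite ss'// inE si orbT.
rewrite (perm_mem (perm_to_rem xs')) inE => /orP[/eqP ix|//].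
by rewrite -ix si in xs.
Qed.

Lemma finite_lp_sub {I : eqType} (p : R) (s s' : seq I) (u : I -> R) : 1 <= p ->
  uniq s -> {subset s <= s'} -> finite_lp p s u <= finite_lp p s' u.
Proof.
move=> p1 us ss'; rewrite finite_lp_leP ?finite_lp_ge0// finite_lp_pow//.
by apply: ler_sum_sub => // i; exact: powR_ge0.
Qed.

Lemma le_finite_lp {I : eqType} (p : R) (s : seq I) (u : I -> R) i : 1 <= p ->
  i \in s -> 0 <= u i -> u i <= finite_lp p s u.
Proof.
move=> p1 si u0; rewrite -[leLHS](finite_lp1 p1 u0); apply: finite_lp_sub => //.
by move=> j; rewrite inE => /eqP ->.
Qed.

(** Each [u i] is at most the l_p norm [c], so [u i ^ q <= u i ^ p * c ^ (q - p)], and the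
    right-hand sides add up to [c ^ q]. *)
Lemma finite_lp_exponent {I : eqType} (p q : R) (s : seq I) (u : I -> R) :
  1 <= p -> p <= q -> (forall i, 0 <= u i) -> finite_lp q s u <= finite_lp p s u.
Proof.
move=> p1 pq u0; set c := finite_lp p s u.
have c0 : 0 <= c by exact: finite_lp_ge0.
have p0 : 0 < p by exact: lt_le_trans p1.
have q1 : 1 <= q by exact: le_trans pq.
rewrite finite_lp_leP//.
have [cE|cN0] := eqVneq c 0.
  rewrite big_seq big1 ?powR_ge0// => i si.
  have : u i <= 0 by rewrite -cE le_finite_lp.
  move=> ui0; have -> : u i = 0 by apply/le_anti; rewrite ui0 u0.
  by rewrite powR0// gt_eqF// (lt_le_trans p0).
have cgt0 : 0 < c by rewrite lt_neqAle eq_sym cN0.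
have qE (x : R) : 0 <= x -> x `^ q = x `^ p * x `^ (q - p).
  move=> x0; have [->|xN0] := eqVneq x 0.
    by rewrite (powR0 (x := q)) 1?(powR0 (x := p)) ?mul0r// gt_eqF// (lt_le_trans p0).
  by rewrite -powRD ?xN0 ?implybT// addrC subrK.
rewrite qE//; apply: (@le_trans _ _ (\sum_(i <- s) u i `^ p * c `^ (q - p))).
  rewrite big_seq [leRHS]big_seq; apply: ler_sum => i si; rewrite qE//.
  apply: ler_wpM2l; first exact: powR_ge0.
  by apply: ge0_ler_powR; rewrite ?nnegrE ?subr_ge0// le_finite_lp.
by rewrite -mulr_suml -finite_lp_pow.
Qed.

Lemma finite_lp_one {I : Type} (s : seq I) (u : I -> R) :
  (forall i, 0 <= u i) -> finite_lp 1 s u = \sum_(i <- s) u i.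
Proof.
move=> u0; rewrite /finite_lp invr1 powRr1; last first.
  by apply: sumr_ge0 => i _; exact: powR_ge0.
by apply: eq_bigr => i _; rewrite powRr1.
Qed.

Lemma finite_lp_le_sum {I : eqType} (p : R) (s : seq I) (u : I -> R) :
  1 <= p -> (forall i, 0 <= u i) -> finite_lp p s u <= \sum_(i <- s) u i.
Proof.
by move=> p1 u0; rewrite -finite_lp_one//; exact: finite_lp_exponent.
Qed.

Lemma sum_fibers {I : eqType} (s : seq I) (b : I -> nat) (ns : seq nat)
    (f : I -> R) : uniq ns -> {in s, forall i, b i \notin ns -> f i = 0} ->
  \sum_(i <- s) f i = \sum_(n <- ns) \sum_(i <- s | b i == n) f i.
Proof.
move=> uns f0.
under [RHS]eq_bigr do rewrite big_mkcond/=.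
rewrite exchange_big/=; apply: eq_big_seq => i si.
have [bi|bi] := boolP (b i \in ns); last first.
  by rewrite f0//; rewrite big1// => n _; rewrite if_same.
rewrite -big_mkcond/= (eq_bigl (pred1 (b i))); last by move=> n; rewrite /= eq_sym.
by rewrite -big_filter filter_pred1_uniq// big_seq1.
Qed.

End power_sums.

(* The norms of the four families of spaces are all of the form
   sup_C (sum_(F in C) (sum_(n in F) |x n|^r)^(p/r))^(1/p), where C ranges over
   the chains of sets F with at most [h (min F)] elements: [h n = n.+1] for
   Schreier sets, [h n = 1] for singleton_chain. [single] restricts C to one set. *)
Record mixed (R : realType) := Mixed {
  outer : R ; inner : R ; single : bool ;
  inner_ge1 : 1 <= inner ; inner_le_outer : inner <= outer }.

Definition flt (F G : {fset nat}) := all (fun m => all (ltn m) G) F.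

Definition sch (h : nat -> nat) (F : {fset nat}) : Prop :=
  forall n, n \in F -> (#|` F| <= h n)%N.

Definition test (h : nat -> nat) (s : bool) (C : seq {fset nat}) : Prop :=
  [/\ s -> (size C <= 1)%N, forall F, F \in C -> sch h F & pairwise flt C].

Section mixed_norm.
Context {R : realType} (e : mixed R).
Local Notation p := (outer e).
Local Notation r := (inner e).
Implicit Types (h g : nat -> nat) (u v w a : nat -> R) (C : seq {fset nat}).

Definition gauge C v : R := finite_lp p C (fun F : {fset nat} => finite_lp r F v).

Definition nle h v (c : R) : Prop := forall C, test h (single e) C -> gauge C v <= c.

Lemma outer_ge1 : 1 <= p.
Proof. exact: le_trans (inner_ge1 e) (inner_le_outer e). Qed.

Local Notation p1 := outer_ge1.
Local Notation r1 := (inner_ge1 e).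

Lemma fltP (F G : {fset nat}) :
  reflect (forall i j, i \in F -> j \in G -> (i < j)%N) (flt F G).
Proof.
apply: (iffP allP) => [FG i j iF jG|FG i iF].
  by have /allP := FG i iF; apply.
by apply/allP => j jG /=; exact: FG.
Qed.

Lemma gauge_ge0 C v : 0 <= gauge C v.
Proof. exact: finite_lp_ge0. Qed.

Lemma test_nil h s : test h s [::].
Proof. by split. Qed.

Lemma nle_ge0 h v c : nle h v c -> 0 <= c.
Proof. by move=> /(_ _ (test_nil _ _)); apply: le_trans; exact: gauge_ge0. Qed.

Lemma gauge_le_in C u v :
  (forall F i, F \in C -> i \in F -> 0 <= u i <= v i) -> gauge C u <= gauge C v.
Proof.
move=> uv; apply: (finite_lp_le_in p1) => F FC; rewrite finite_lp_ge0/=.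
by apply: (finite_lp_le_in r1) => i iF; exact: uv FC iF.
Qed.

Lemma eq_gauge C u v :
  (forall F i, F \in C -> i \in F -> u i = v i) -> gauge C u = gauge C v.
Proof.
move=> uv; apply: eq_finite_lp => F FC; apply: eq_finite_lp => i iF.
exact: uv FC iF.
Qed.

Lemma nle_le h u v c : (forall i, 0 <= u i <= v i) -> nle h v c -> nle h u c.
Proof.
move=> uv vc C hC; apply: le_trans (vc C hC).
by apply: gauge_le_in => F i _ _; exact: uv.
Qed.

Lemma nle_weaken h v c d : c <= d -> nle h v c -> nle h v d.
Proof. by move=> cd vc C hC; apply: le_trans (vc C hC) cd. Qed.

Lemma nle_capacity h g v c : (forall n, (h n <= g n)%N) ->
  nle g v c -> nle h v c.
Proof.
move=> hg vc C [sC hC pC]; apply: vc; split=> // F FC n nF.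
exact: leq_trans (hC F FC n nF) (hg n).
Qed.

Lemma gaugeD C u v : (forall i, 0 <= u i) -> (forall i, 0 <= v i) ->
  gauge C (fun i => u i + v i) <= gauge C u + gauge C v.
Proof.
move=> u0 v0; apply: (@le_trans _ _ (finite_lp p C (fun F : {fset nat} =>
    finite_lp r F u + finite_lp r F v))).
  apply: (finite_lp_le_in p1) => F _; rewrite finite_lp_ge0/=.
  exact: finite_lpD r1 _ _.
by apply: finite_lpD p1 _ _ => F; exact: finite_lp_ge0.
Qed.

Lemma nleD h u v c d : (forall i, 0 <= u i) -> (forall i, 0 <= v i) ->
  nle h u c -> nle h v d -> nle h (fun i => u i + v i) (c + d).
Proof.
move=> u0 v0 uc vd C hC; apply: (le_trans (gaugeD C u0 v0)).
apply: lerD; [exact: uc|exact: vd].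
Qed.

Lemma gaugeZ C v c : 0 <= c -> (forall i, 0 <= v i) ->
  gauge C (fun i => c * v i) = c * gauge C v.
Proof.
move=> c0 v0; rewrite /gauge.
transitivity (finite_lp p C (fun F : {fset nat} => c * finite_lp r F v)).
  by apply: eq_finite_lp => F _; exact: (finite_lpZ _ r1 c0 v0).
by apply: (finite_lpZ _ p1 c0) => F; exact: finite_lp_ge0.
Qed.

Lemma nleZ h v c d : 0 <= c -> (forall i, 0 <= v i) ->
  nle h v d -> nle h (fun i => c * v i) (c * d).
Proof. by move=> c0 v0 vd C hC; rewrite gaugeZ//; apply: ler_wpM2l => //; exact: vd. Qed.

Lemma gauge1 F v : gauge [:: F] v = finite_lp r F v.
Proof. by rewrite /gauge finite_lp1 ?p1// finite_lp_ge0. Qed.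

Lemma test1 h s F : sch h F -> test h s [:: F].
Proof. by move=> hF; split=> // G; rewrite inE => /eqP ->. Qed.

Lemma nle_lp h v c F : nle h v c -> sch h F -> finite_lp r F v <= c.
Proof. by move=> vc hF; rewrite -gauge1; apply: vc; exact: test1. Qed.

Lemma sch1 h n : (0 < h n)%N -> sch h [fset n]%fset.
Proof. by move=> h0 m; rewrite inE => /eqP ->; rewrite cardfs1. Qed.

Lemma finite_lp_fset1 (q : R) n v : 1 <= q -> 0 <= v n ->
  finite_lp q [fset n]%fset v = v n.
Proof. by move=> q1 v0; rewrite /finite_lp big_seq_fset1 powR_powRV. Qed.

Lemma nle_coord h v c n : (0 < h n)%N -> 0 <= v n -> nle h v c -> v n <= c.
Proof.
move=> h0 v0 vc; rewrite -(finite_lp_fset1 r1 v0).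
by apply: nle_lp vc _; exact: sch1.
Qed.

Definition singleton_chain (ns : seq nat) : seq {fset nat} := [seq [fset n]%fset | n <- ns].

Lemma gauge_singleton_chain ns v : (forall n, 0 <= v n) ->
  gauge (singleton_chain ns) v = finite_lp p ns v.
Proof.
move=> v0; rewrite /gauge finite_lp_map; apply: eq_finite_lp => n _ /=.
by rewrite finite_lp_fset1// r1.
Qed.

Lemma test_singleton_chain (s : bool) ns : sorted ltn ns -> (s -> (size ns <= 1)%N) ->
  test (fun=> 1%N) s (singleton_chain ns).
Proof.
move=> ss sns; split; first by rewrite size_map.
  by move=> _ /mapP[n _ ->]; exact: sch1.
move: ss; rewrite sorted_pairwise; last exact: ltn_trans.
rewrite pairwise_map; apply: sub_pairwise => i j /= ij.
by apply/fltP => i' j'; rewrite !inE => /eqP -> /eqP ->.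
Qed.

Lemma chain_uniq C : pairwise flt C ->
  uniq (flatten [seq enum_fset F | F : {fset nat} <- C]).
Proof.
elim: C => //= F C IH /andP[/allP FC /IH uC].
rewrite cat_uniq fset_uniq uC andbT; apply/hasPn => i.
move=> /flattenP[_ /mapP[G GC ->] iG]; apply/negP => iF.
by have /fltP/(_ i i iF iG) := FC G GC; rewrite ltnn.
Qed.

Lemma chain_sum_le C v K : pairwise flt C -> (forall i, 0 <= v i) ->
  (forall F i, F \in C -> i \in F -> (i < K)%N) ->
  \sum_(F <- C) \sum_(i <- (F : {fset nat})) v i <= \sum_(0 <= i < K) v i.
Proof.
move=> pC v0 CK.
have -> : \sum_(F <- C) \sum_(i <- (F : {fset nat})) v i =
    \sum_(i <- flatten [seq enum_fset F | F : {fset nat} <- C]) v i.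
  by rewrite big_flatten big_map.
apply: ler_sum_sub => //; first exact: chain_uniq.
move=> i /flattenP[_ /mapP[F FC ->] iF]; rewrite mem_index_iota/=; exact: CK FC iF.
Qed.

Lemma chain_bound C : exists K, forall F i, F \in C -> i \in F -> (i < K)%N.
Proof.
exists (\max_(F <- C) \max_(i <- (F : {fset nat})) i.+1)%N => F i FC iF.
have h : (i.+1 <= \max_(i <- (F : {fset nat})) i.+1)%N.
  exact: (@leq_bigmax_seq _ _ xpredT (fun i => i.+1)).
apply: leq_trans h _.
exact: (@leq_bigmax_seq _ _ xpredT
  (fun F : {fset nat} => \max_(i <- (F : {fset nat})) i.+1)%N).
Qed.

(** The l_1 norm is the strongest of all mixed norms, since both exponents are at least 1 and the
    sets of a chain are disjoint. Summable errors are therefore under control in every type at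
    once. *)
Lemma gauge_le_l1 C v K : pairwise flt C -> (forall i, 0 <= v i) ->
  (forall F i, F \in C -> i \in F -> (i < K)%N) ->
  gauge C v <= \sum_(0 <= i < K) v i.
Proof.
move=> pC v0 CK; apply: le_trans (chain_sum_le pC v0 CK).
apply: le_trans (finite_lp_le_sum _ p1 _) _ => [F|]; first exact: finite_lp_ge0.
by apply: ler_sum => F _; apply: finite_lp_le_sum r1 v0.
Qed.

End mixed_norm.

(** * Estimates of block sums *)

(** The blocks are the intervals from [m n] to [m n.+1], and [b i] is the number of the block that
    contains [i]. The two maps are adjoint ([block_index_lt]), which is how they are used. *)
Definition block_index (m b : nat -> nat) : Prop :=
  (forall n, m n < m n.+1)%N /\ (forall i, m (b i) <= i < m (b i).+1)%N.

Section block_index_theory.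
Context {m b : nat -> nat} (bm : block_index m b).

Lemma block_start_lt i j : (i < j)%N -> (m i < m j)%N.
Proof. exact: (homo_ltn ltn_trans bm.1). Qed.

Lemma block_start_le i j : (i <= j)%N -> (m i <= m j)%N.
Proof.
rewrite leq_eqVlt => /orP[/eqP->//|/block_start_lt/ltnW//].
Qed.

Lemma block_index_lt i n : (b i < n)%N = (i < m n)%N.
Proof.
have /andP[bi ib] := bm.2 i; apply/idP/idP => h.
  exact: leq_trans ib (block_start_le h).
rewrite ltnNge; apply/negP => nb.
by have := leq_ltn_trans (leq_trans (block_start_le nb) bi) h; rewrite ltnn.
Qed.

Lemma block_index_le i j : (i <= j)%N -> (b i <= b j)%N.
Proof.
move=> ij; rewrite -ltnS block_index_lt; apply: leq_ltn_trans ij _.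
by have /andP[] := bm.2 j.
Qed.

Lemma block_index_ltW i j : (b i < b j)%N -> (i < j)%N.
Proof. by rewrite !ltnNge; apply: contra; exact: block_index_le. Qed.

Lemma block_start_ge n : (n <= m n)%N.
Proof. by elim: n => // n IH; exact: leq_ltn_trans IH (bm.1 n). Qed.

End block_index_theory.

Lemma block_index_exists (m : nat -> nat) : m 0%N = 0%N ->
  (forall n, m n < m n.+1)%N -> exists b, block_index m b.
Proof.
move=> m0 mS.
have bex i : exists n, (i < m n.+1)%N.
  exists i; elim: i => [|i IH]; first by rewrite -[X in (X < _)%N]m0.
  exact: leq_ltn_trans IH (mS _).
exists (fun i => ex_minn (bex i)); split=> // i.
case: ex_minnP => -[|n] -> nmin; first by rewrite m0.
rewrite andbT leqNgt; apply/negP => h.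
by have := nmin n h; rewrite ltnn.
Qed.

Definition min_seq (K : nat) (s : seq nat) := foldr minn K s.

Lemma min_seq_le K s i : i \in s -> (min_seq K s <= i)%N.
Proof.
elim: s => //= j s IH; rewrite inE geq_min => /orP[/eqP->|/IH ->].
  by rewrite leqnn.
by rewrite orbT.
Qed.

Lemma min_seq_mem K s : min_seq K s \in K :: s.
Proof.
elim: s => /= [|j s IH]; first by rewrite mem_head.
rewrite !inE; have [_|_] := leqP j (min_seq K s); first by rewrite eqxx orbT.
by move: IH; rewrite inE => /orP[->//|->]; rewrite !orbT.
Qed.

Lemma finite_lp_mask {R : realType} (q : R) (F : {fset nat}) (P : pred nat) u :
  1 <= q ->
  finite_lp q F (fun i => if P i then u i else 0) = finite_lp q [fset i in F | P i]%fset u.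
Proof.
move=> q1; congr (_ `^ _); transitivity (\sum_(i <- F | P i) u i `^ q).
  rewrite [RHS]big_mkcond; apply: eq_bigr => i _; case: ifP => // _.
  by rewrite powR0// gt_eqF// (lt_le_trans ltr01 q1).
rewrite -big_filter; apply: perm_big; apply: uniq_perm; rewrite ?filter_uniq ?fset_uniq//.
by move=> i; rewrite mem_filter !inE andbC.
Qed.

Section block_estimates.
Context {R : realType} (e : mixed R).
Context {m b : nat -> nat} (bm : block_index m b) {g : nat -> nat}.
Hypothesis g_mono : forall i j, (i <= j)%N -> (g i <= g j)%N.
Hypothesis g_gt0 : forall i, (0 < g i)%N.
Local Notation p := (outer e).
Local Notation r := (inner e).
Local Notation p1 := (outer_ge1 e).
Local Notation r1 := (inner_ge1 e).

Definition on_block n (w : nat -> R) i := if b i == n then w i else 0.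

Lemma card_imfset_le (j : nat -> nat) (F : {fset nat}) (P : pred nat) :
  (#|` [fset j n | n in F & P n]%fset| <= #|` F|)%N.
Proof.
apply: leq_trans (leq_imfset_card _ _ _) _ => /=.
by rewrite -[leqRHS]/(size (enum_fset F)) size_filter count_size.
Qed.

Definition blocks_of (n : nat) (F : {fset nat}) : {fset nat} :=
  [fset b i | i in F & (n < b i)%N]%fset.

Lemma blocks_ofP n F j :
  reflect (exists2 i, i \in F & (n < b i)%N /\ j = b i) (j \in blocks_of n F).
Proof.
apply: (iffP idP) => [/imfsetP[/= i]|[i iF [ni ->]]].
  by rewrite inE => /andP[iF ni] ->; exists i.
by apply/imfsetP; exists i => //=; rewrite inE iF.
Qed.

Section lower_index.
Context (C : seq {fset nat}) (K : nat).
Hypothesis CK : forall F i, F \in C -> i \in F -> (b i < K)%N.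
Hypothesis pC : pairwise flt C.

(** The first block that meets F. The default [K] exceeds all block indices of the chain and is the
    value at the empty set. *)
Let lo (F : {fset nat}) := min_seq K [seq b i | i <- F].

Let lo_le F i : i \in F -> (lo F <= b i)%N.
Proof. by move=> iF; apply: min_seq_le; exact: map_f. Qed.

Let lo_mem F i : F \in C -> i \in F -> exists2 j, j \in F & lo F = b j.
Proof.
move=> FC iF; have : lo F \in K :: _ := min_seq_mem K [seq b i | i <- F].
rewrite inE => /orP[/eqP loK|/mapP[j jF ->]]; last by exists j.
by have := leq_ltn_trans (lo_le iF) (CK FC iF); rewrite loK ltnn.
Qed.

Let up (F : {fset nat}) := blocks_of (lo F) F.

(** The minimum of F lies before the start of every block n in [up F]; so F, and with it [up F], has
    at most [g (min F) <= g (m n)] elements. *)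
Let test_up s : test g s C -> test (g \o m) s [seq up F | F <- C].
Proof.
move=> [sC hC _]; split; first by rewrite size_map.
  move=> _ /mapP[F FC ->] n /blocks_ofP[i iF [loi ->]].
  have [j jF loj] := lo_mem FC iF.
  apply: leq_trans (_ : #|` F| <= _)%N.
    exact: card_imfset_le.
  apply: leq_trans (hC F FC j jF) _; apply: g_mono; apply: ltnW.
  by rewrite -(block_index_lt bm) -loj.
rewrite pairwise_map.
suff sub : {in C &, subrel flt (fun F G => flt (up F) (up G))}.
  exact: sub_in_pairwise sub _ (allss C) pC.
move=> F G FC GC /fltP FG.
apply/fltP => _ _ /blocks_ofP[i iF [_ ->]] /blocks_ofP[j jG [loj ->]].
have [j' j'G lo'] := lo_mem GC jG.
apply: leq_ltn_trans loj; rewrite lo'; apply: (block_index_le bm).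
exact/ltnW/FG.
Qed.

(** Every F is cut after its lowest block. On a single block n the whole chain has gauge at most
    [D], so the lowest blocks contribute [D] times an l_p sum of [a] over distinct indices, hence
    [D * c1]. In a later block n, F has at most [g (min F) <= g (m n)] points, which contribute
    [a n * ee n], and these numbers are summed along the admissible chain of the sets [up F], hence
    [c2]. *)
Lemma core_upper_chain (w a ee : nat -> R) D c1 c2 :
  (forall i, 0 <= w i) -> (forall n, 0 <= a n) -> (forall n, 0 <= ee n) ->
  test g (single e) C ->
  (forall n, nle e g (on_block n w) D) ->
  (forall n (F : {fset nat}), (forall i, i \in F -> b i = n) -> (#|` F| <= g (m n))%N ->
    finite_lp r F w <= ee n) ->
  nle e (fun=> 1%N) a c1 -> nle e (g \o m) (fun n => a n * ee n) c2 ->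
  gauge e C (fun i => a (b i) * w i) <= D * c1 + c2.
Proof.
move=> w0 a0 ee0 hC wD wee ac1 ac2.
have D0 : 0 <= D := nle_ge0 (wD 0%N).
have c10 := nle_ge0 ac1.
have aw0 i : 0 <= a (b i) * w i by rewrite mulr_ge0.
pose vB (F : {fset nat}) i := if (lo F < b i)%N then a (b i) * w i else 0.
have vB0 F i : 0 <= vB F i by rewrite /vB; case: ifP.
have wB0 n i : 0 <= on_block n w i by rewrite /on_block; case: ifP.
pose A F := a (lo F) * finite_lp r F (on_block (lo F) w).
have A0 F : 0 <= A F by rewrite mulr_ge0// finite_lp_ge0.
apply: (@le_trans _ _ (finite_lp p C (fun F : {fset nat} =>
    A F + finite_lp r F (vB F)))).
  apply: (finite_lp_le_in p1) => F FC; rewrite finite_lp_ge0/= /A.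
  have <- := @finite_lpZ R _ r F (a (lo F)) (on_block (lo F) w) r1 (a0 _) (wB0 _).
  have aB0 i : 0 <= a (lo F) * on_block (lo F) w i by rewrite mulr_ge0.
  apply: (le_trans _ (@finite_lpD R _ r F _ _ r1 aB0 (vB0 F))).
  apply: (finite_lp_le_in r1) => i iF; rewrite aw0/= /vB /on_block.
  have := lo_le iF; rewrite leq_eqVlt => /orP[/eqP ->|lob].
    by rewrite eqxx ltnn addr0.
  by rewrite lob (gtn_eqF lob) mulr0 add0r.
have lpB0 (F : {fset nat}) : 0 <= finite_lp r F (vB F) by exact: finite_lp_ge0.
apply: (le_trans (@finite_lpD R _ p C _ _ p1 A0 lpB0)).
apply: lerD; last first.
  apply: le_trans (ac2 _ (test_up hC)); rewrite /gauge finite_lp_map.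
  apply: (finite_lp_le_in p1) => F FC; rewrite finite_lp_ge0/=.
  rewrite finite_lp_leP ?finite_lp_ge0// ?r1// finite_lp_pow ?r1//.
  rewrite (@sum_fibers _ _ _ b (up F)) ?fset_uniq//; last first.
    move=> i iF; rewrite /vB; case: ifP => [lob|_ _]; last first.
      by rewrite powR0// gt_eqF// (lt_le_trans ltr01 r1).
    by move=> /negP[]; apply/blocks_ofP; exists i.
  rewrite big_seq [leRHS]big_seq; apply: ler_sum => n /blocks_ofP[i0 i0F [loi0 nE]].
  rewrite powRM// ?ee0//.
  apply: (@le_trans _ _ (\sum_(i <- F | b i == n) a n `^ r * w i `^ r)).
    apply: ler_sum => i /eqP bi; rewrite /vB; case: ifP => _; first by rewrite bi powRM.
    by rewrite powR0 ?mulr_ge0 ?powR_ge0// gt_eqF// (lt_le_trans ltr01 r1).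
  rewrite -mulr_sumr ler_wpM2l ?powR_ge0//.
  pose Fn := [fset i in F | b i == n]%fset.
  have FnP i : i \in Fn -> b i = n by rewrite !inE => /andP[_ /eqP].
  have Fng : (#|` Fn| <= g (m n))%N.
    have [j jF loj] := lo_mem FC i0F.
    apply: leq_trans (_ : #|` F| <= _)%N.
      by apply: fsubset_leq_card; apply/fsubsetP => i; rewrite !inE => /andP[].
    apply: leq_trans (_ : g j <= _)%N; first by case: hC => _ /(_ F FC j jF).
    by apply: g_mono; apply: ltnW; rewrite -(block_index_lt bm) -loj nE.
  have := wee n Fn FnP Fng; rewrite finite_lp_leP ?r1//; apply: le_trans.
  rewrite le_eqVlt; apply/orP; left; apply/eqP.
  rewrite -big_filter; apply: perm_big; apply: uniq_perm; rewrite ?filter_uniq ?fset_uniq//.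
  by move=> i; rewrite mem_filter /Fn !inE andbC.
have lK F : (lo F < K.+1)%N.
  rewrite /lo ltnS; elim: (X in min_seq K X) => //= x s IH.
  by rewrite geq_min IH orbT.
(* The range includes [K], the value of [lo] at the empty set. *)
pose ns := [seq n <- iota 0 K.+1 | n \in map lo C].
have nsU : uniq ns by rewrite filter_uniq ?iota_uniq.
have c1p : finite_lp p ns a <= c1.
  rewrite -(gauge_singleton_chain e _ a0); apply: ac1; apply: test_singleton_chain.
    by apply: sorted_filter; [exact: ltn_trans|exact: iota_ltn_sorted].
  case: hC => + _ _ => /[apply]; apply: leq_trans.
  rewrite -(size_map lo); apply: uniq_leq_size => // n.
  by rewrite mem_filter => /andP[].
apply: le_trans (ler_wpM2l D0 c1p).
rewrite finite_lp_leP ?p1//; last by rewrite mulr_ge0 ?finite_lp_ge0.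
rewrite [leRHS](_ : _ = \sum_(n <- ns) D `^ p * a n `^ p); last first.
  by rewrite (@powRM _ _ _ _ D0 (finite_lp_ge0 _ _ _)) (finite_lp_pow _ _ p1) mulr_sumr.
rewrite (@sum_fibers _ _ C lo ns)//; last first.
  move=> F FC; rewrite mem_filter negb_and (map_f lo FC) mem_iota add0n.
  by rewrite (lK F).
apply: ler_sum => n _.
apply: (@le_trans _ _ (\sum_(F <- C | lo F == n)
     a n `^ p * finite_lp r F (on_block n w) `^ p)).
  by apply: ler_sum => F /eqP <-; rewrite powRM ?finite_lp_ge0.
rewrite -mulr_sumr mulrC ler_wpM2r ?powR_ge0//.
apply: (@le_trans _ _ (\sum_(F <- C) finite_lp r F (on_block n w) `^ p)).
  rewrite [leLHS]big_mkcond/=; apply: ler_sum => F _.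
  by case: ifP; rewrite ?powR_ge0.
by rewrite -finite_lp_leP ?p1//; exact: wD.
Qed.

End lower_index.

Lemma core_upper (w a ee : nat -> R) D c1 c2 :
  (forall i, 0 <= w i) -> (forall n, 0 <= a n) -> (forall n, 0 <= ee n) ->
  (forall n, nle e g (on_block n w) D) ->
  (forall n (F : {fset nat}), (forall i, i \in F -> b i = n) -> (#|` F| <= g (m n))%N ->
    finite_lp r F w <= ee n) ->
  nle e (fun=> 1%N) a c1 -> nle e (g \o m) (fun n => a n * ee n) c2 ->
  nle e g (fun i => a (b i) * w i) (D * c1 + c2).
Proof.
move=> w0 a0 ee0 wD wee ac1 ac2 C hC; have [K CK] := chain_bound C.
apply: (@core_upper_chain C (b K).+1 _ _ w a ee) => //; last by case: hC.
by move=> F i FC iF; rewrite ltnS (block_index_le bm)// ltnW// (CK F).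
Qed.

(** [core_upper] with [ee n = D]: a subset of block n with at most [g (m n)] points is admissible
    because its points are at least [m n]. The factor 2 counts the lowest blocks and the later
    ones. *)
Lemma peak_upper (w a : nat -> R) D c :
  (forall i, 0 <= w i) -> (forall n, 0 <= a n) ->
  (forall n, nle e g (on_block n w) D) -> nle e (g \o m) a c ->
  nle e g (fun i => a (b i) * w i) (2 * (D * c)).
Proof.
move=> w0 a0 wD ac; have D0 : 0 <= D := nle_ge0 (wD 0%N).
rewrite mulr_natl mulr2n; apply: (core_upper w0 a0 (ee := fun=> D)) => //.
- move=> n F Fn FgM; rewrite (@eq_finite_lp _ _ _ _ _ (on_block n w)); last first.
    by move=> i iF; rewrite /on_block (Fn i iF) eqxx.
  have [F0|/fset0Pn[i0 i0F]] := eqVneq F fset0.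
    by rewrite F0 /finite_lp big_seq_fset0 powR0 ?gt_eqF// invr_gt0 (lt_le_trans ltr01 r1).
  apply: (nle_lp (wD n)) => i iF; apply: leq_trans FgM _; apply: g_mono.
  by rewrite -(Fn i iF); have /andP[] := bm.2 i.
- by apply: nle_capacity ac => n /=; exact: g_gt0.
- by rewrite (_ : (fun n => _) = (fun n => D * a n)); [exact: nleZ|apply/funext=> n; rewrite mulrC].
Qed.

Lemma geometric_sum_le (q : R) K : 0 <= q -> q <= 1 / 2 ->
  \sum_(0 <= i < K) q ^+ i <= 2.
Proof.
move=> q0 q2; suff : \sum_(0 <= i < K) q ^+ i <= 2 * (1 - q ^+ K).
  by move=> /le_trans; apply; rewrite ler_piMr// lerBlDr lerDl exprn_ge0.
elim: K => [|K IH]; first by rewrite big_nil expr0 subrr mulr0.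
rewrite big_nat_recr//= exprS; have := exprn_ge0 K q0.
by move: IH; set x := q ^+ K; nra.
Qed.

(** Outside its lowest block a set F has at most [g (m n) <= m n + 1] points in block n, and
    flatness makes their total at most [4^-n]. This part is summable, so only the l_p sum over the
    lowest blocks is left: the capacity drops to 1. *)
Lemma flat_upper (w a : nat -> R) D c :
  (forall n, (g (m n) <= (m n).+1)%N) ->
  (forall i, 0 <= w i) -> (forall n, 0 <= a n) ->
  (forall n, nle e g (on_block n w) D) ->
  (forall i, w i * (m (b i)).+1%:R <= 4^-1 ^+ (b i)) ->
  nle e (fun=> 1%N) a c ->
  nle e g (fun i => a (b i) * w i) ((D + 2) * c).
Proof.
move=> gm w0 a0 wD wflat ac; have D0 : 0 <= D := nle_ge0 (wD 0%N).
have c0 := nle_ge0 ac.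
have q0 n : 0 <= 4^-1 ^+ n :> R by rewrite exprn_ge0.
rewrite mulrDl; apply: (core_upper w0 a0 q0) => //.
- move=> n F Fn Fg; apply: le_trans (finite_lp_le_sum _ r1 w0) _.
  apply: (@le_trans _ _ (\sum_(i <- F) 4^-1 ^+ n / (m n).+1%:R)).
    rewrite big_seq [leRHS]big_seq; apply: ler_sum => i iF.
    by rewrite ler_pdivlMr// -(Fn i iF).
  rewrite big_const_seq count_predT iter_addr_0 -[X in X <= _]mulr_natr.
  rewrite mulrAC ler_pdivrMr// ler_wpM2l// ler_nat.
  exact: leq_trans Fg (gm n).
move=> C [_ _ pC]; have [K CK] := chain_bound C.
have aq0 n : 0 <= a n * 4^-1 ^+ n by rewrite mulr_ge0.
apply: (le_trans (gauge_le_l1 e pC aq0 CK)).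
apply: (@le_trans _ _ (\sum_(0 <= n < K) c * 4^-1 ^+ n)).
  by apply: ler_sum => n _; rewrite ler_wpM2r//; exact: nle_coord ac.
rewrite -mulr_sumr mulrC ler_wpM2r//; apply: geometric_sum_le => //.
by rewrite div1r lef_pV2 ?posrE// ler_nat.
Qed.

(** A chain of capacity 1 consists of singletons, up to empty sets. Each singleton {n} is replaced
    by a chain on which block n has gauge at least [d], restricted to that block; as the blocks are
    successive, the concatenation is a chain for [g]. *)
Lemma flat_lower (w a : nat -> R) d c :
  (forall i, 0 <= w i) -> (forall n, 0 <= a n) -> 0 < d ->
  (forall n, a n != 0 ->
    exists2 C, test g (single e) C & d <= gauge e C (on_block n w)) ->
  nle e g (fun i => a (b i) * w i) c -> nle e (fun=> 1%N) a (c / d).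
Proof.
move=> w0 a0 d0 wd vc C [sC hC pC]; rewrite ler_pdivlMr// mulrC.
rewrite -(gaugeZ e C (ltW d0) a0).
set v := fun i => a (b i) * w i in vc; have v0 i : 0 <= v i by rewrite mulr_ge0.
(* The invariants of the induction: the new sets only meet blocks indexed by C, which keeps them in
   order, and an empty C gives an empty C', which keeps the number of sets at most 1 when [single e]
   holds. *)
suff [C' [C'b C'0 [sC' gC' pC' le']]] : exists C' : seq {fset nat}, [/\
    forall G i, G \in C' -> i \in G -> exists2 F, F \in C & b i \in F,
    C = [::] -> C' = [::] &
    [/\ (size C <= 1 -> single e -> size C' <= 1)%N,
      forall F, F \in C' -> sch g F,
      pairwise flt C' & \sum_(F <- C) finite_lp r F (fun n => d * a n) `^ p <=
       \sum_(F <- C') finite_lp r F v `^ p]].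
  rewrite finite_lp_leP ?p1 ?(nle_ge0 vc)//.
  apply: le_trans le' _; rewrite -finite_lp_leP ?p1 ?(nle_ge0 vc)//; apply: vc.
  by split=> // s; apply: sC' => //; exact: sC.
elim: C {sC} hC pC => [|F C IH] hC pC.
  exists [::]; split; [by []|by []|split; [by []|by []|by []|]].
  by rewrite [leLHS]big_nil [leRHS]big_nil.
have /andP[/allP FC {}pC] : all (flt F) C && pairwise flt C by exact: pC.
have [|//|C' [C'b C'0 [sC' gC' pC' le']]] := IH.
  by move=> G GC; apply: hC; rewrite inE GC orbT.
suff [CF [CFb sCF gCF pCF leF]] : exists CF : seq {fset nat}, [/\ forall G i, G \in CF -> i \in G -> b i \in F,
    single e -> (size CF <= 1)%N, forall F, F \in CF -> sch g F, pairwise flt CF &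
    finite_lp r F (fun n => d * a n) `^ p <= \sum_(F <- CF) finite_lp r F v `^ p].
  exists (CF ++ C'); split; [|by []|split].
  - move=> G i; rewrite mem_cat => /orP[GCF iG|GC' iG].
      by exists F; rewrite ?mem_head//; exact: CFb GCF iG.
    by have [H HC biH] := C'b G i GC' iG; exists H => //; rewrite inE HC orbT.
  - rewrite ltnS leqn0 => /nilP C0 s.
    by rewrite size_cat C'0// addn0 sCF.
  - by move=> G; rewrite mem_cat => /orP[/gCF|/gC'].
  - rewrite pairwise_cat pCF pC' !andbT; apply/allrelP => G H GC HC; apply/fltP => i j iG jH.
    have biF := CFb G i GC iG; have [F' F'C bjF'] := C'b H j HC jH.
    by apply: (block_index_ltW bm); have /fltP := FC F' F'C; apply.
  - by rewrite big_cons big_cat/= lerD.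
have ad0 n : 0 <= d * a n by rewrite mulr_ge0// ltW.
have p0 : p != 0 by rewrite gt_eqF// (lt_le_trans ltr01 p1).
have r0 : r^-1 != 0 by rewrite invr_eq0 gt_eqF// (lt_le_trans ltr01 r1).
have [->|/fset0Pn[n nF]] := eqVneq F fset0.
  by exists [::]; split=> //; rewrite big_nil /finite_lp big_seq_fset0 !powR0.
have FE : F = [fset n]%fset.
  apply/eqP; rewrite eq_sym eqEfcard fsub1set nF cardfs1.
  by apply: hC nF; exact: mem_head.
rewrite FE (finite_lp_fset1 r1 (ad0 n)).
have [->|an0] := eqVneq (a n) 0.
  by exists [::]; split=> //; rewrite big_nil mulr0 powR0.
have [Cn [sCn gCn pCn] dCn] := wd n an0.
exists [seq [fset i in G | b i == n]%fset | G : {fset nat} <- Cn]; split.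
- by move=> _ i /mapP[G _ ->]; rewrite !inE => /andP[_ /eqP ->].
- by move=> /sCn; rewrite size_map.
- move=> _ /mapP[G GCn ->] i; rewrite !inE => /andP[iG _].
  apply: leq_trans (gCn G GCn i iG).
  by apply: fsubset_leq_card; apply/fsubsetP => j; rewrite !inE => /andP[].
- rewrite pairwise_map; apply: sub_pairwise pCn => G H /fltP GH.
  by apply/fltP => i j; rewrite !inE => /andP[iG _] /andP[jH _]; exact: GH.
set Cn' := map _ _.
have pgt0 : 0 < p := lt_le_trans ltr01 p1.
rewrite -(@finite_lp_pow R _ p Cn' (fun F : {fset nat} => finite_lp r F v) p1).
rewrite (ler_powR_nneg pgt0 (ad0 n) (finite_lp_ge0 _ _ _)).
have onb0 i : 0 <= on_block n w i by rewrite /on_block; case: ifP.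
apply: (@le_trans _ _ (gauge e Cn (fun i => a n * on_block n w i))).
  by rewrite (gaugeZ e Cn (a0 n) onb0) mulrC ler_wpM2l.
suff <- : finite_lp p Cn' (fun F : {fset nat} => finite_lp r F v) =
    gauge e Cn (fun i => a n * on_block n w i) by exact: lexx.
rewrite /Cn' finite_lp_map; apply: eq_finite_lp => G _.
rewrite -[LHS](finite_lp_mask _ _ _ r1); apply: eq_finite_lp => i _.
by rewrite /on_block /v; case: eqP => [->|]; rewrite ?mulr0.
Qed.

(** The map [j] carries an admissible set of blocks to a set of as many coordinates, and it is
    admissible for [g] because [j n] is at least [m n]. Indices with [a n = 0] are dropped, since
    nothing is known about [j] there. *)
Lemma peak_lower (w a : nat -> R) d c (j : nat -> nat) :
  (forall i, 0 <= w i) -> (forall n, 0 <= a n) -> 0 < d ->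
  (forall n, a n != 0 -> b (j n) = n /\ d <= w (j n)) ->
  nle e g (fun i => a (b i) * w i) c -> nle e (g \o m) a (c / d).
Proof.
move=> w0 a0 d0 jP vc C [sC hC pC]; rewrite ler_pdivlMr// mulrC.
rewrite -(gaugeZ e C (ltW d0) a0).
pose G (F : {fset nat}) : {fset nat} := [fset j n | n in F & a n != 0]%fset.
have GP F i : i \in G F -> exists n, [/\ n \in F, a n != 0 & i = j n].
  by move=> /imfsetP[/= n]; rewrite inE => /andP[nF an] ->; exists n.
apply: le_trans (vc (map G C) _); last first.
  split; first by rewrite size_map.
    move=> _ /mapP[F FC ->] _ /GP[n [nF an ->]].
    apply: leq_trans (_ : #|` F| <= _)%N.
      exact: card_imfset_le.
    apply: leq_trans (hC F FC n nF) _; apply: g_mono.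
    by have [bj _] := jP n an; have /andP[+ _] := bm.2 (j n); rewrite bj.
  rewrite pairwise_map; apply: sub_pairwise pC => F H /fltP FH.
  apply/fltP => _ _ /GP[n [nF an ->]] /GP[n' [n'H an' ->]].
  apply: (block_index_ltW bm); have [-> _] := jP n an; have [-> _] := jP n' an'.
  exact: FH.
rewrite {2}/gauge finite_lp_map; apply: (finite_lp_le_in p1) => F _.
rewrite finite_lp_ge0/=.
rewrite (finite_lp_leP _ _ r1 (finite_lp_ge0 _ _ _)) (finite_lp_pow _ _ r1).
have -> : \sum_(i <- G F) (a (b i) * w i) `^ r =
    \sum_(n <- F | a n != 0) (a n * w (j n)) `^ r.
  rewrite big_imfset/=; last first.
    move=> n n' /andP[_ an] /andP[_ an'] /= jn.
    by have [bn _] := jP n an; have [bn' _] := jP n' an'; rewrite -bn -bn' jn.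
  rewrite big_filter big_mkcond [RHS]big_mkcond; apply: eq_bigr => n _.
  by case: ifP => // an; have [-> _] := jP n an.
rewrite [leRHS]big_mkcond/=; apply: ler_sum => n _.
case: ifP => [an|/negbFE/eqP ->]; last first.
  by rewrite mulr0 powR0// gt_eqF// (lt_le_trans ltr01 r1).
have r0 : 0 < r by rewrite (lt_le_trans ltr01 r1).
have [_ dw] := jP n an.
by rewrite ler_powR_nneg ?mulr_ge0 ?(ltW d0)// mulrC ler_wpM2l.
Qed.

End block_estimates.

(** * Domination between types *)

Definition ctype (R : realType) : choiceType :=
  (exponent R + exponent R + exponent R + unit)%type.

Section types.
Context {R : realType}.
Implicit Types (t : ctype R) (h : nat -> nat) (v : nat -> R) (p q r : exponent R).

Definition TB p : ctype R := inl (inl (inl p)).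
Definition Tl q : ctype R := inl (inl (inr q)).
Definition TS r : ctype R := inl (inr r).
Definition Tc : ctype R := inr tt.

Definition exponent_one : exponent R := exist _ 1 (lexx 1).

Definition chain_mixed p : mixed R := @Mixed R (val p) 1 false (lexx 1) (valP p).
Definition set_mixed r : mixed R :=
  @Mixed R (val r) (val r) true (valP r) (lexx (val r)).

Definition mixed_of t : mixed R :=
  match t with
  | inl (inl (inl p)) => chain_mixed p
  | inl (inl (inr q)) => chain_mixed q
  | inl (inr r) => set_mixed r
  | inr _ => set_mixed exponent_one
  end.

Definition full t : bool :=
  match t with
  | inl (inl (inl _)) => true
  | inl (inl (inr _)) => false
  | inl (inr _) => true
  | inr _ => false
  end.

Definition capacity t h : nat -> nat := if full t then h else fun=> 1%N.

(* [h = S] gives the norm of the space; the norm of a combination of blocks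
   that start at m_0 < m_1 < ... is estimated with [h = S \o m]. *)
Definition tle t h v c : Prop := nle (mixed_of t) (capacity t h) v c.

(* The type of normalized blocks whose coordinates tend to zero. *)
Definition flat_type t : ctype R :=
  match t with
  | inl (inl (inl p)) => Tl p
  | inl (inl (inr q)) => Tl q
  | inl (inr _) => Tc
  | inr _ => Tc
  end.

(** The constant is uniform in [h]: the inclusions between the spaces use [h = S], the coefficients
    of block sums use [h = S \o m]. *)
Definition dom t t' : Prop := exists C : R, 0 <= C /\
  forall h v c, (forall n, n < h n)%N -> (forall n, 0 <= v n) ->
  tle t h v c -> tle t' h v (C * c).

Lemma finite_lp_card1 (p q : R) (F : {fset nat}) v : 1 <= p -> 1 <= q ->
  (forall n, 0 <= v n) -> (#|` F| <= 1)%N -> finite_lp p F v = finite_lp q F v.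
Proof.
move=> p1 q1 v0; have [->|/fset0Pn[n nF]] := eqVneq F fset0.
  by rewrite /finite_lp !big_seq_fset0 !powR0// ?invr_eq0 gt_eqF// (lt_le_trans ltr01).
move=> F1; have -> : F = [fset n]%fset.
  by apply/eqP; rewrite eq_sym eqEfcard fsub1set nF cardfs1.
by rewrite !finite_lp_fset1.
Qed.

Lemma finite_lp_seq (q : R) (s : seq nat) v c : 1 <= q -> uniq s ->
  (forall F : {fset nat}, finite_lp q F v <= c) -> finite_lp q s v <= c.
Proof.
move=> q1 us /(_ [fset x in s]%fset); apply: le_trans.
by apply: finite_lp_sub => // i; rewrite inE.
Qed.

Lemma single_capacity1P (e : mixed R) v c : single e -> (forall n, 0 <= v n) ->
  nle e (fun=> 1%N) v c <-> 0 <= c /\ forall n, v n <= c.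
Proof.
move=> se v0; split=> [vc|[c0 vc] C [sC hC _]].
  by split=> [|n]; [exact: nle_ge0 vc|exact: nle_coord vc].
have := sC se; case: C hC {sC} => [|F [|//]] hC _.
  by rewrite /gauge /finite_lp big_nil powR0// invr_eq0 gt_eqF// (lt_le_trans ltr01 (outer_ge1 e)).
rewrite gauge1; have [->|/fset0Pn[n nF]] := eqVneq F fset0.
  by rewrite /finite_lp big_seq_fset0 powR0// invr_eq0 gt_eqF// (lt_le_trans ltr01 (inner_ge1 e)).
have -> : F = [fset n]%fset.
  by apply/eqP; rewrite eq_sym eqEfcard fsub1set nF cardfs1 (hC F (mem_head _ _) n).
by rewrite finite_lp_fset1 ?inner_ge1.
Qed.

Lemma tle_c0P h v c : (forall n, 0 <= v n) ->
  tle Tc h v c <-> 0 <= c /\ forall n, v n <= c.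
Proof. exact: single_capacity1P. Qed.

Lemma tle_SP r h v c : (forall n, 0 <= v n) ->
  tle (TS r) h v c <-> forall F, sch h F -> finite_lp (val r) F v <= c.
Proof.
move=> v0; split=> [vc F hF|vc C [sC hC _]]; first exact: nle_lp vc hF.
have := sC isT; case: C hC {sC} => [|F [|//]] hC _; last first.
  by rewrite gauge1; apply: vc; apply: hC; exact: mem_head.
apply: le_trans (vc fset0 _) => //.
by rewrite /gauge /finite_lp big_nil big_seq_fset0.
Qed.

Lemma tle_ellP q h v c : (forall n, 0 <= v n) ->
  tle (Tl q) h v c <-> forall F : {fset nat}, finite_lp (val q) F v <= c.
Proof.
move=> v0; have q1 : 1 <= val q := valP q; split=> [vc F|vc C [_ hC pC]].
  pose s := sort leq F.
  have us : uniq s by rewrite sort_uniq fset_uniq.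
  have ss : sorted ltn s by rewrite ltn_sorted_uniq_leq us sort_sorted//; exact: leq_total.
  have h1 : test (fun=> 1%N) false (singleton_chain s) by exact: test_singleton_chain.
  have := vc _ h1; rewrite (gauge_singleton_chain (chain_mixed q) _ v0); apply: le_trans.
  by apply: finite_lp_sub => // i; rewrite mem_sort.
apply: le_trans (finite_lp_seq q1 (chain_uniq pC) vc).
rewrite /gauge finite_lp_leP ?finite_lp_ge0//= finite_lp_pow// big_flatten big_map.
rewrite big_seq [leRHS]big_seq; apply: ler_sum => F FC.
have F1 : (#|` F| <= 1)%N.
  have [->|/fset0Pn[n nF]] := eqVneq F fset0; first by rewrite cardfs0.
  exact: hC FC n nF.
by rewrite (finite_lp_card1 (lexx 1) q1 v0 F1) finite_lp_pow.
Qed.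

(** Flat blocks produce norms of capacity 1; this identifies them with norms of a type of the scale,
    whatever [h] is, so that flat and peaked sequences can be compared by [dom]. *)
Lemma flat_typeP t h v c : (forall n, 0 <= v n) ->
  nle (mixed_of t) (fun=> 1%N) v c <-> tle (flat_type t) h v c.
Proof.
move=> v0; case: t => [[[p|q]|r]|[]]; [exact: iff_refl|exact: iff_refl| |exact: iff_refl].
have h1 := @single_capacity1P (mixed_of (TS r)) v c isT v0.
exact: iff_trans h1 (iff_sym (tle_c0P h c v0)).
Qed.

Lemma capacity_gt0 t h n : (forall n, (0 < h n)%N) -> (0 < capacity t h n)%N.
Proof. by rewrite /capacity; case: full. Qed.

Lemma capacity_mono t h : (forall i j, (i <= j)%N -> (h i <= h j)%N) ->
  forall i j, (i <= j)%N -> (capacity t h i <= capacity t h j)%N.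
Proof. by rewrite /capacity; case: full. Qed.

Lemma capacity_comp t h m : capacity t h \o m = capacity t (h \o m).
Proof. by rewrite /capacity; case: full. Qed.

Lemma dom_refl t : dom t t.
Proof. by exists 1; split=> // h v c _ _; rewrite mul1r. Qed.

Lemma dom_trans t1 t2 t3 : dom t1 t2 -> dom t2 t3 -> dom t1 t3.
Proof.
move=> [C [C0 HC]] [D [D0 HD]]; exists (D * C); split; first exact: mulr_ge0.
by move=> h v c hn v0 /(HC _ _ _ hn v0)/(HD _ _ _ hn v0); rewrite mulrA.
Qed.

Lemma dom1 t t' : (forall h v c, (forall n, n < h n)%N -> (forall n, 0 <= v n) ->
  tle t h v c -> tle t' h v c) -> dom t t'.
Proof. by move=> H; exists 1; split=> // h v c; rewrite mul1r; exact: H. Qed.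

Lemma dom_c0 t : dom t Tc.
Proof.
apply: dom1 => h v c hn v0 vc; apply/tle_c0P => //; split; first exact: nle_ge0 vc.
move=> n; apply: (nle_coord _ _ vc) => //.
by apply: capacity_gt0 => i; exact: leq_trans (hn i).
Qed.

Lemma nle_chain_mixed p q h v c : val p <= val q -> (forall n, 0 <= v n) ->
  nle (chain_mixed p) h v c -> nle (chain_mixed q) h v c.
Proof.
move=> pq v0 vc C hC; apply: le_trans (vc C hC).
by apply: finite_lp_exponent => //; [exact: (valP p)|move=> F; exact: finite_lp_ge0].
Qed.

Lemma dom_ell p q : val p <= val q -> dom (Tl p) (Tl q).
Proof. by move=> pq; apply: dom1 => h v c _ v0; exact: nle_chain_mixed. Qed.

Lemma dom_B p q : val p <= val q -> dom (TB p) (TB q).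
Proof. by move=> pq; apply: dom1 => h v c _ v0; exact: nle_chain_mixed. Qed.

Lemma dom_ell1_B p : dom (Tl exponent_one) (TB p).
Proof.
apply: dom1 => h v c _ v0 /(tle_ellP _ _ _ v0) vc C [_ _ pC].
apply: le_trans (finite_lp_seq (lexx 1) (chain_uniq pC) vc).
rewrite finite_lp_one// big_flatten big_map.
apply: le_trans (finite_lp_le_sum _ (valP p) _) _ => [F|]; first exact: finite_lp_ge0.
by apply: ler_sum => F _; rewrite /= finite_lp_one.
Qed.

Lemma dom_B_S1 p : dom (TB p) (TS exponent_one).
Proof.
apply: dom1 => h v c _ v0 vc; apply/tle_SP => // F hF.
exact: nle_lp vc hF.
Qed.

Lemma dom_ell_S q : dom (Tl q) (TS q).
Proof. by apply: dom1 => h v c _ v0 /tle_ellP vc; apply/tle_SP => // F _; exact: vc. Qed.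

Lemma seq_argmin (s : seq nat) v : s != [::] ->
  exists2 i, i \in s & {in s, forall j, v i <= v j}.
Proof.
elim: s => // i s IH _; have [->|/IH[j js jmin]] := eqVneq s [::].
  by exists i; rewrite ?mem_head// => j; rewrite inE => /eqP ->.
have [ij|/ltW ji] := leP (v i) (v j).
  exists i; rewrite ?mem_head// => l; rewrite inE => /orP[/eqP->//|/jmin].
  exact: le_trans.
by exists j; rewrite ?inE ?js ?orbT// => l; rewrite inE => /orP[/eqP->//|/jmin].
Qed.

(** At most [k = K./2] of the elements are below [k]. Among the others, [K - k] are kept; they
    satisfy [h n > n >= k], and [K - k <= k + 1]. *)
Lemma half_schreier h (F : {fset nat}) : (forall n, n < h n)%N ->
  exists G : {fset nat}, [/\ {subset G <= F}, sch h G & (#|` F| <= 2 * #|` G|)%N].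
Proof.
move=> hn; set K := #|` F|; pose k := K./2.
pose s := [seq n <- F | (k <= n)%N].
have us : uniq s by rewrite filter_uniq ?fset_uniq.
have ss : (K - k <= size s)%N.
  have <- : (count (fun n => n < k)%N F + size s = K)%N.
    rewrite size_filter -[RHS]/(size (enum_fset F)) -[RHS](count_predC (fun n => n < k)%N).
    by congr (_ + _)%N; apply: eq_count => n /=; rewrite -leqNgt.
  rewrite leq_subLR leq_add2r -size_filter -[leqRHS](size_iota 0 k).
  apply: uniq_leq_size; first by rewrite filter_uniq ?fset_uniq.
  by move=> n; rewrite mem_filter mem_iota => /andP[].
exists [fset x in take (K - k) s]%fset.
have cG : #|` [fset x in take (K - k) s]%fset| = (K - k)%N.
  by rewrite card_fseq undup_id ?take_uniq// size_takel.
have GP n : n \in [fset x in take (K - k) s]%fset -> (k <= n)%N /\ n \in F.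
  by rewrite inE => /mem_take; rewrite mem_filter => /andP[].
split=> [n /GP[]//|n /GP[kn _]|]; rewrite cG.
  apply: leq_trans (hn n); have := odd_double_half K; rewrite -/k; lia.
by have := odd_double_half K; rewrite -/k; lia.
Qed.

(** Dyadic condensation: the terms from [2 ^ j] to [2 ^ j.+1] add up to at most [x ^ j], where
    [x = 2 ^ (1 - s) < 1]. *)
Lemma powR_sum_bounded (s : R) : 1 < s ->
  exists C : R, forall K, \sum_(0 <= i < K) i.+1%:R `^ (- s) <= C.
Proof.
move=> s1; set x := (2 : R) `^ (1 - s).
have x0 : 0 < x by rewrite powR_gt0.
have x1 : x < 1.
  rewrite lt_neqAle; apply/andP; split.
    by rewrite /x powR_eq1 subr_eq0 (lt_eqF s1) orbF pnatr_eq1 ltrn0.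
  by rewrite /x -[leRHS](powRr0 2); apply: ler_powR; rewrite ?ler1n// subr_le0 ltW.
have dyadic j : \sum_(0 <= i < 2 ^ j) i.+1%:R `^ (- s) <= 1 + \sum_(0 <= l < j) x ^+ l.
  elim: j => [|j IH]; first by rewrite expn0 big_nat1 powR1 big_nil addr0.
  rewrite (@big_cat_nat _ _ _ (2 ^ j))//=; last by rewrite leq_exp2l.
  rewrite big_nat_recr//= addrA lerD//.
  apply: (@le_trans _ _ (\sum_(2 ^ j <= i < 2 ^ j.+1) ((2 ^ j)%:R `^ (- s) : R))).
    rewrite big_nat_cond [leRHS]big_nat_cond; apply: ler_sum => i /andP[/andP[ji _] _].
    rewrite !powRN lef_pV2 ?posrE ?powR_gt0 ?ltr0n ?expn_gt0//.
    by rewrite ler_powR_nneg ?(lt_trans ltr01 s1)// ler_nat; exact: leqW.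
  rewrite sumr_const_nat expnS mul2n -addnn addnK -[X in X <= _]mulr_natl.
  rewrite natrX -powR_mulrn// -powR_mulrn ?powR_ge0//.
  by rewrite -!powRrM -powRD ?pnatr_eq0 ?implybT// mulrBl mul1r mulrC mulNr.
exists (1 + (1 - x)^-1) => K; apply: le_trans (_ : \sum_(0 <= i < 2 ^ K) i.+1%:R `^ (- s) <= _).
  apply: ler_sum_sub; first exact: iota_uniq.
    move=> i; rewrite !mem_index_iota/= => iK; apply: ltn_trans iK _.
    exact: ltn_expl.
  by move=> i; exact: powR_ge0.
apply: le_trans (dyadic K) _; rewrite lerD2l.
elim: K => [|K IH]; first by rewrite big_nil invr_ge0 subr_ge0 ltW.
rewrite big_nat_recl//= expr0.
have -> : (1 - x)^-1 = 1 + x * (1 - x)^-1.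
  by field; rewrite subr_eq0 gt_eqF.
rewrite lerD2l; under eq_bigr do rewrite exprS.
by rewrite -mulr_sumr ler_wpM2l// ltW.
Qed.

(* The first K largest values x_1 >= x_2 >= ... of x satisfy
   x_K <= (2/K)^(1/r) |x|, as half of them sit on a Schreier set. *)
Lemma dom_S_ell r q : val r < val q -> dom (TS r) (Tl q).
Proof.
move=> rq; have r1 : 1 <= val r := valP r; have q1 : 1 <= val q := valP q.
have r0 : 0 < val r := lt_le_trans ltr01 r1; have q0 : 0 < val q := lt_le_trans ltr01 q1.
set s := val q / val r; have s1 : 1 < s by rewrite ltr_pdivlMr// mul1r.
have [D DP] := powR_sum_bounded s1.
have D0 : 0 <= D by have := DP 0%N; rewrite big_nil.
pose C := 2 `^ s * D; have C0 : 0 <= C by rewrite mulr_ge0// powR_ge0.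
exists (C `^ (val q)^-1); split; first exact: powR_ge0.
move=> h v c hn v0 vc; have c0 := nle_ge0 vc.
have vS := (tle_SP _ _ _ v0).1 vc; apply/tle_ellP => // F.
rewrite finite_lp_leP ?mulr_ge0 ?powR_ge0// powRM ?powR_ge0// powRV_powR//.
suff : \sum_(i <- F) v i `^ val q <=
    c `^ val q * 2 `^ s * \sum_(0 <= i < #|` F|) i.+1%:R `^ (- s).
  move=> /le_trans; apply; rewrite (_ : C * _ = c `^ val q * 2 `^ s * D).
    by rewrite ler_wpM2l ?mulr_ge0 ?powR_ge0.
  by rewrite /C mulrC mulrA.
(* Induction on the cardinality by removing the smallest value: among K + 1 elements it is the term
   of rank K + 1, and it is bounded by means of the half of F that is admissible. *)
move: {2}#|` F| (erefl #|` F|) => K; elim: K F => [|K IH] F FK.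
  rewrite FK (cardfs0_eq FK) big_seq_fset0 big_nil mulr0//.
have : (F : seq nat) != [::].
  by apply/eqP => F0; move: FK; rewrite -[#|` F|]/(size (enum_fset F)) F0.
move=> /(seq_argmin v)[i0 i0F imin].
have F'K : #|` (F `\ i0)%fset| = K by apply: succn_inj; rewrite -FK (cardfsD1 i0 F) i0F.
rewrite (big_fsetD1 i0)//= FK big_nat_recr//= mulrDr addrC.
apply: lerD; first by have := IH _ F'K; rewrite F'K.
have [G [GF hG FG]] := half_schreier F hn.
have := vS G hG; rewrite finite_lp_leP//.
have vG : v i0 `^ val r *+ #|` G| <= \sum_(n <- G) v n `^ val r.
  rewrite -[#|` G|]/(size (enum_fset G)) -(count_predT (enum_fset G)).
  rewrite -[leLHS]iter_addr_0 -big_const_seq big_seq [leRHS]big_seq.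
  by apply: ler_sum => n nG; rewrite ler_powR_nneg// imin// GF.
move=> /(le_trans vG) vGc.
have sE x : 0 <= x -> x `^ val q = (x `^ val r) `^ s.
  by move=> x0; rewrite -powRrM /s mulrCA mulfV ?mulr1// gt_eqF.
have K0 : 0 < K.+1%:R :> R by rewrite ltr0n.
have vc' : v i0 `^ val r <= c `^ val r * 2 * K.+1%:R^-1.
  rewrite ler_pdivlMr// !mulr_natr.
  apply: (@le_trans _ _ (v i0 `^ val r *+ (2 * #|` G|))).
    by apply: ler_wpMn2l; rewrite ?powR_ge0// -FK.
  by rewrite mulrnA mulrnAC lerMn2r.
rewrite (sE _ (v0 i0)) (sE _ c0) powRN.
have -> : (K.+1%:R `^ s)^-1 = (K.+1%:R^-1) `^ s :> R.
  by rewrite -[in RHS]powR_inv1 ?ltW// -powRrM mulN1r powRN.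
have Ki0 : 0 <= K.+1%:R^-1 :> R by rewrite invr_ge0 ltW.
rewrite -(powRM s (powR_ge0 c (val r)) (ler0n R 2)) -powRM ?mulr_ge0 ?powR_ge0//.
by rewrite ler_powR_nneg ?mulr_ge0 ?powR_ge0// (lt_trans ltr01 s1).
Qed.

(** From the strongest norm to the weakest: [Tl 1]; the [TB p] by increasing p; [TS 1]; then by
    increasing exponent, [Tl r] before [TS r] and [TS r] before every [Tl q] with q > r; finally
    [Tc]. *)
Lemma dom_total t t' : dom t t' \/ dom t' t.
Proof.
have lS r q : val q <= val r -> dom (Tl q) (TS r).
  by move=> qr; apply: dom_trans (dom_ell qr) (dom_ell_S r).
have BS p r : dom (TB p) (TS r).
  apply: dom_trans (dom_B_S1 p) _.
  have : val exponent_one <= val r := valP r.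
  rewrite le_eqVlt => /orP[/eqP/val_inj <-|r1]; first exact: dom_refl.
  exact: dom_trans (dom_S_ell r1) (dom_ell_S r).
have BlT p q : dom (TB p) (Tl q) \/ dom (Tl q) (TB p).
  have : val exponent_one <= val q := valP q.
  rewrite le_eqVlt => /orP[/eqP/val_inj <-|q1]; first by right; exact: dom_ell1_B.
  by left; apply: dom_trans (BS p exponent_one) (dom_S_ell q1).
have lST q r : dom (Tl q) (TS r) \/ dom (TS r) (Tl q).
  by have [/lS|/dom_S_ell] := leP (val q) (val r); [left|right].
case: t => [[[p|q]|r]|[]]; case: t' => [[[p'|q']|r']|[]];
  try by [left; exact: dom_c0|right; exact: dom_c0].
- by have [/dom_B|/ltW/dom_B] := leP (val p) (val p'); [left|right].
- exact: BlT.
- by left; exact: BS.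
- by rewrite or_comm; exact: BlT.
- by have [/dom_ell|/ltW/dom_ell] := leP (val q) (val q'); [left|right].
- exact: lST.
- by right; exact: BS.
- by rewrite or_comm; exact: lST.
- have [|rr'|/val_inj ->] := ltgtP (val r) (val r').
  + by move=> rr'; left; apply: dom_trans (dom_S_ell rr') (dom_ell_S r').
  + by right; apply: dom_trans (dom_S_ell rr') (dom_ell_S r).
  + by left; exact: dom_refl.
Qed.

End types.

(** * Coordinates and the norms of the spaces *)

Section truncation.
Context {V : nmodType}.
Definition truncate m (x : nat -> V) i := if (i < m)%N then x i else 0.
Definition tail_from m (x : nat -> V) i := if (m <= i)%N then x i else 0.
Definition between m n (x : nat -> V) i := if (m <= i < n)%N then x i else 0.
End truncation.

Section nle_truncation.
Context {R : realType} (e : mixed R).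
Implicit Types (h g : nat -> nat) (v : nat -> R).

Lemma truncate_ge0 m v i : (forall i, 0 <= v i) -> 0 <= truncate m v i <= v i.
Proof. by move=> v0; rewrite /truncate; case: ifP; rewrite ?lexx ?v0. Qed.

Lemma tail_from_ge0 m v i : (forall i, 0 <= v i) -> 0 <= tail_from m v i <= v i.
Proof. by move=> v0; rewrite /tail_from; case: ifP; rewrite ?lexx ?v0. Qed.

(** A chain sees finitely many coordinates only. This is the lower semicontinuity of the norm that
    completeness relies on. *)
Lemma nle_fatou h v c : (forall m, nle e h (truncate m v) c) -> nle e h v c.
Proof.
move=> vc C hC; have [K CK] := chain_bound C.
have <- := @eq_gauge _ e C (truncate K v) v; first exact: vc.
by move=> F i FC iF; rewrite /truncate (CK F i FC iF).
Qed.

Lemma finite_lp_ones (p : R) (s : seq nat) (a : nat -> R) : 1 <= p ->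
  {in s, forall i, a i = 1} -> finite_lp p s a = (size s)%:R `^ p^-1.
Proof.
move=> p1 a1; rewrite /finite_lp; congr (_ `^ _).
rewrite (eq_big_seq (fun=> 1)); last by move=> i /a1 ->; rewrite powR1.
by rewrite big_const_seq count_predT iter_addr_0.
Qed.

Lemma natr_powR_unbounded (q c : R) : 0 < q ->
  exists K : nat, (0 < K)%N /\ c < K%:R `^ q.
Proof.
move=> q0; pose d := Num.max c 1; have d0 : 0 < d by rewrite lt_max ltr01 orbT.
have d1 : 0 <= d `^ q^-1 by exact: powR_ge0.
exists (Num.bound (d `^ q^-1)).
have := archi_boundP d1; set K := Num.bound _ => dK.
have K0 : 0 < K%:R :> R by exact: le_lt_trans dK.
split; first by rewrite -(ltr0n R).
apply: (@le_lt_trans _ _ d); first by rewrite le_max lexx.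
have -> : d = (d `^ q^-1) `^ q by rewrite -powRrM mulVf ?powRr1 ?ltW// gt_eqF.
by rewrite gt0_ltr_powR ?nnegrE// ltW.
Qed.

(** Otherwise there are infinitely many successive blocks of gauge at least [eps]. As chains may
    have any length here, [flat_lower] applied to K of these blocks, with coefficients 1, gives
    [eps * K ^ (1/p) <= c] for every K. *)
Lemma nle_chain_tails g v c : ~~ single e -> (forall i, 0 <= v i) ->
  nle e g v c -> forall eps : R, 0 < eps -> exists m, nle e g (tail_from m v) eps.
Proof.
move=> se v0 vc eps eps0; apply: contrapT => /forallNP noM.
have step m : exists m', (m < m')%N /\ exists2 C, test g (single e) C &
    eps <= gauge e C (between m m' v).
  have /existsNP[C /not_implyP[hC /negP]] := noM m; rewrite -ltNge => /ltW eC.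
  (* The maximum with [m.+1] keeps the starting points strictly increasing. *)
  have [K CK] := chain_bound C; exists (maxn m.+1 K); split; first by rewrite leq_maxl.
  exists C; first exact: hC.
  apply: (le_trans eC); apply: gauge_le_in => F i FC iF; rewrite /tail_from /between.
  rewrite (leq_trans (CK F i FC iF)) ?leq_maxr// andbT.
  by case: ifP => _; rewrite lexx ?v0.
have [f fP] := choice step.
pose m n := iter n f 0%N.
have mS n : (m n < m n.+1)%N by have [] := fP (m n).
have [b bm] := block_index_exists (erefl : m 0%N = 0%N) mS.
have onb n : between (m n) (m n.+1) v =1 on_block (b := b) n v.
  move=> i; rewrite /between /on_block; congr (if _ then _ else _).
  by rewrite -(block_index_lt bm) leqNgt -(block_index_lt bm) -leqNgt ltnS eqn_leq andbC.
have p1 := outer_ge1 e; have pV0 : 0 < (outer e)^-1 by rewrite invr_gt0 (lt_le_trans ltr01 p1).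
have [K [K0 cK]] := natr_powR_unbounded (c / eps) pV0.
pose a n : R := (n < K)%:R.
have a0 n : 0 <= a n by exact: ler0n.
suff : (c / eps) < (c / eps) by rewrite ltxx.
apply: lt_le_trans cK _.
have av : nle e g (fun i => a (b i) * v i) c.
  apply: nle_le vc => i; rewrite mulr_ge0//= ler_piMl// /a.
  by case: (b i < K)%N.
have ac : nle e (fun=> 1%N) a (c / eps).
  apply: (flat_lower bm v0 a0 eps0 _ av) => n _.
  have [_ [C hC eC]] := fP (m n); exists C; first exact: hC.
  by have <- := @eq_gauge _ e C _ _ (fun F i _ _ => onb n i).
have h1 : test (fun=> 1%N) (single e) (singleton_chain (iota 0 K)).
  by apply: test_singleton_chain; [exact: iota_ltn_sorted|rewrite (negbTE se)].
have := ac _ h1; rewrite (gauge_singleton_chain e _ a0) finite_lp_ones ?size_iota//.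
by move=> i; rewrite mem_iota /a => /andP[_ ->].
Qed.

End nle_truncation.

Section concrete_spaces.
Context {R : realType} {k : scalar_kind}.
Implicit Types (t : ctype R) (x y : scalar_seq R k).

Definition absv x : nat -> R := fun n => modulus (x n).

Definition space t : seq_space R k :=
  match t with
  | inl (inl (inl p)) => baernstein_space k p
  | inl (inl (inr q)) => ellp_space k q
  | inl (inr r) => schreier_space k r
  | inr _ => c0_space R k
  end.

Lemma absv_ge0 x i : 0 <= absv x i.
Proof. exact: modulus_ge0. Qed.

Lemma ereal_sup_leP {I : Type} (P : set I) (f : I -> R) c :
  (ereal_sup [set (f i)%:E | i in P] <= c%:E)%E <-> forall i, P i -> f i <= c.
Proof.
split=> [fc i Pi|fc]; last first.
  by apply: ge_ereal_sup => _ [i Pi <-]; rewrite lee_fin; exact: fc.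
by rewrite -lee_fin; apply: le_trans fc; apply: ereal_sup_ubound; exists i.
Qed.

Lemma schreier_chain_test C : schreier_chain C -> test S false C.
Proof.
move=> [C0 hC sC]; split=> // [F /hC[]//|].
rewrite -(@sorted_pairwise_in _ [pred F : {fset nat} | F != fset0])//.
  move=> F G H /fset0Pn[i iF] _ _ /fltP GF /fltP FH.
  by apply/fltP => j l jG lH; apply: ltn_trans (GF j i jG iF) (FH i l iF lH).
by apply/allP => F /hC[].
Qed.

Lemma seq_norm_leP t x c :
  (seq_norm (space t) x <= c%:E)%E <-> tle t S (absv x) c.
Proof.
have v0 := absv_ge0 x; case: t => [[[p|q]|r]|[]] /=.
- rewrite /baernstein_norm.
  apply: iff_trans (ereal_sup_leP _ _ _) _.
  have gE C : gauge (chain_mixed p) C (absv x) =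
      (\sum_(F <- C) (\sum_(n <- (F : {fset nat})) modulus (x n)) `^ val p) `^ (val p)^-1.
    by congr (_ `^ _); apply: eq_bigr => F _; rewrite /= finite_lp_one.
  split=> [xc C [_ hC pC]|xc C hC]; last first.
    by rewrite -gE; apply: xc; exact: schreier_chain_test.
  pose C' := [seq F <- C | F != fset0].
  have gC' : gauge (chain_mixed p) C (absv x) = gauge (chain_mixed p) C' (absv x).
    congr (_ `^ _); rewrite big_filter [RHS]big_mkcond; apply: eq_bigr => F _.
    case: ifP => // /negbFE/eqP ->; rewrite finite_lp_one// big_seq_fset0 powR0//.
    by rewrite gt_eqF// (lt_le_trans ltr01 (valP p)).
  have hC' F : F \in C' -> F != fset0 /\ schreier F.
    by rewrite mem_filter => /andP[F0 FC]; split=> //; exact: hC FC.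
  have sC' : sorted flt C' by apply: pairwise_sorted; exact: pairwise_filter.
  rewrite gC'; have [->|C'0] := eqVneq C' [::]; last by rewrite gE; apply: xc; split.
  rewrite /gauge /finite_lp big_nil powR0; last first.
    by rewrite invr_eq0 gt_eqF// (lt_le_trans ltr01 (valP p)).
  (* When every set of C is empty the claim is [0 <= c], which any Schreier chain provides. *)
  have h1 : schreier_chain [:: [fset 0%N]%fset].
    split=> // F; rewrite inE => /eqP ->; split; last exact: schreier1.
    by apply/fset0Pn; exists 0%N; rewrite inE.
  by apply: le_trans (xc _ h1); exact: powR_ge0.
- rewrite ellp_normE; apply: iff_trans _ (iff_sym (tle_ellP _ _ _ v0)).
  have q1 : 1 <= val q := valP q.
  have q0 : 0 < val q := lt_le_trans ltr01 q1.
  have s0 n : (0 <= (modulus (x n) `^ val q)%:E)%E by rewrite lee_fin powR_ge0.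
  set T := (\sum_(0 <= n <oo) _)%E.
  have T0 : (0 <= T)%E by apply: nneseries_ge0.
  have Tc : 0 <= c -> (T `^ (val q)^-1 <= c%:E)%E <-> (T <= (c `^ val q)%:E)%E.
    move=> c0; split=> h.
      have : (((T `^ (val q)^-1) `^ val q) <= (c%:E `^ val q))%E.
        by apply: gt0_ler_poweR; rewrite ?in_itv/= ?leey ?andbT ?poweR_ge0 ?lee_fin// ltW.
      by rewrite -poweRrM mulVf ?gt_eqF// poweRe1// poweR_EFin.
    have : ((T `^ (val q)^-1) <= ((c `^ val q)%:E `^ (val q)^-1))%E.
      apply: gt0_ler_poweR; rewrite ?in_itv/= ?leey ?andbT ?lee_fin ?powR_ge0//.
      by rewrite invr_ge0 ltW.
    by rewrite poweR_EFin powR_powRV.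
  split=> [xc F|xc].
    have c0 : 0 <= c by rewrite -lee_fin; apply: le_trans xc; exact: poweR_ge0.
    have TcF := (Tc c0).1 xc.
    rewrite finite_lp_leP// -lee_fin; apply: le_trans TcF.
    have [K CK] := chain_bound [:: F].
    apply: le_trans (nneseries_lim_ge K (fun n _ _ => s0 n)).
    rewrite sumEFin lee_fin; apply: ler_sum_sub; [exact: fset_uniq| |].
      by move=> i iF; rewrite mem_index_iota; apply: (CK F); rewrite ?mem_head.
    by move=> i; exact: powR_ge0.
  have c0 : 0 <= c by apply: le_trans (xc fset0); exact: powR_ge0.
  apply: (Tc c0).2; apply: lime_le; first exact: is_cvg_nneseries.
  apply: nearW => K; rewrite sumEFin lee_fin -(finite_lp_leP _ _ q1 c0).
  by apply: finite_lp_seq xc; rewrite ?iota_uniq.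
- rewrite /schreier_norm; apply: iff_trans (ereal_sup_leP _ _ _) _.
  exact: iff_sym (tle_SP _ _ _ v0).
- rewrite /sup_norm; apply: iff_trans (ereal_sup_leP _ _ _) _.
  apply: iff_trans _ (iff_sym (tle_c0P _ _ v0)).
  split=> [xc|[_ xc] n _]; last exact: xc.
  by split=> [|n]; [apply: le_trans (v0 0%N) (xc 0%N I)|exact: xc].
Qed.

Lemma seq_norm_lty t x : (seq_norm (space t) x < +oo)%E <-> exists c, tle t S (absv x) c.
Proof.
split=> [xoo|[c /seq_norm_leP xc]]; last exact: le_lt_trans xc (ltry _).
exists (fine (seq_norm (space t) x)); apply/seq_norm_leP.
by rewrite fineK// ge0_fin_numE// seq_norm_ge0.
Qed.

Lemma finitely_supportedP x : finitely_supported x ->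
  exists m, forall i, (m <= i)%N -> x i = 0.
Proof.
move=> /finite_fsetP[F FE]; have [K CK] := chain_bound [:: F].
exists K => i Ki; apply/eqP; apply/negPn/negP => xi.
have : [set n | x n != 0] i by [].
rewrite FE => /= iF; have := CK F i (mem_head _ _) iF.
by rewrite ltnNge Ki.
Qed.

(** One description for four spaces defined in different ways: finite norm and small tails. The
    tails express the closure of c_00 for S_r and convergence to 0 for c_0; for B_p and l_q they
    follow from finiteness of the norm by [nle_chain_tails]. *)
Lemma seq_carrierP t x : seq_carrier (space t) x <->
  (exists c, tle t S (absv x) c) /\
  forall eps : R, 0 < eps -> exists m, tle t S (tail_from m (absv x)) eps.
Proof.
have v0 := absv_ge0 x.
case: t => [[[p|q]|r]|[]].
- split=> [xoo|[/(seq_norm_lty (TB p))//]].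
  have [c xc] := (seq_norm_lty (TB p) x).1 xoo; split; first by exists c.
  by move=> eps eps0; exact: nle_chain_tails xc eps eps0.
- split=> [xoo|[/(seq_norm_lty (Tl q))//]].
  have [c xc] := (seq_norm_lty (Tl q) x).1 xoo; split; first by exists c.
  by move=> eps eps0; exact: nle_chain_tails xc eps eps0.
- split=> [[xoo xc]|[xc xt]].
    split; first exact/(seq_norm_lty (TS r)).
    move=> eps eps0; have [y /finitely_supportedP[m ym] /ltW] := xc eps eps0.
    move=> /(seq_norm_leP (TS r)) xy; exists m; apply: nle_le xy => i.
    rewrite /tail_from; case: ifP => mi; last by rewrite lexx absv_ge0.
    have -> : absv (x - y) i = absv x i.
      by rewrite /absv (_ : (x - y) i = x i - y i)// ym// subr0.
    by rewrite lexx absv_ge0.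
  split; first exact/(seq_norm_lty (TS r)).
  move=> eps eps0; have eps20 : 0 < eps / 2 by rewrite divr_gt0.
  have [m xm] := xt _ eps20; exists (truncate m x).
    apply: (@sub_finite_set _ _ `I_m); last exact: finite_II.
    by move=> i /=; rewrite /truncate; case: ifP => //; rewrite eqxx.
  apply: (@le_lt_trans _ _ (eps / 2)%:E); last by rewrite lte_fin gtr_pMr ?invf_lt1 ?ltr1n.
  apply/(seq_norm_leP (TS r)); apply: nle_le xm => i; rewrite absv_ge0/=.
  rewrite /absv (_ : (x - truncate m x) i = x i - truncate m x i)//.
  rewrite /truncate /tail_from; case: ltnP => _ /=.
    by rewrite subrr modulus0 lexx.
  by rewrite subr0 lexx.
- split=> [x0|[_ xt]].
    split; first by apply/(seq_norm_lty Tc); exact: c0_norm_lty.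
    move=> eps eps0; have /cvgrPdist_le/(_ eps eps0)[m _ xm] := x0.
    exists m; apply/tle_c0P; first by move=> i; have /andP[] := tail_from_ge0 m i v0.
    split=> [|i]; first exact: ltW.
    rewrite /tail_from; case: ifP => [mi|_]; last by rewrite ltW.
    by have := xm i mi; rewrite /= sub0r normrN ger0_norm ?modulus_ge0.
  apply/cvgrPdist_le => eps eps0; have [m xm] := xt _ eps0.
  exists m => // i /= mi; rewrite sub0r normrN ger0_norm ?modulus_ge0//.
  have T0 j : 0 <= tail_from m (absv x) j by have /andP[] := tail_from_ge0 m j v0.
  have [_ /(_ i)] := (tle_c0P S eps T0).1 xm.
  by rewrite /tail_from mi.
Qed.

End concrete_spaces.

(** * Compact and strictly singular operators *)

Section ultrafilter_limits.
Context {R : realType}.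

Lemma ultra_limit_real {T : Type} (F : set_system T) (f : T -> R) (M : R) :
  UltraFilter F -> F [set z | `|f z| <= M] ->
  exists l : R, forall e : R, 0 < e -> F [set z | `|f z - l| < e].
Proof.
move=> FU FM; have cpt := @segment_compact R (- M) M.
have [] := cpt (f @ F) _.
  have MM : [set z | `|f z| <= M] `<=` f @^-1` `[- M, M].
    by move=> z /=; rewrite ler_norml in_itv.
  exact: filterS MM FM.
move=> l [_ clu]; exists l => e e0.
have [//|FN] := in_ultra_setVsetC [set z | `|f z - l| < e] FU.
have Bl : nbhs l (ball l e) by exact: nbhsx_ballx.
have [_ [[z zN <-] +]] := clu (f @` (~` [set z | `|f z - l| < e])) (ball l e)
  (filterS (@preimage_image _ _ f _) FN) Bl.
by rewrite -ball_normE /= distrC.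
Qed.

Lemma ultra_limit {k} {T : Type} (F : set_system T) (f : T -> scalars R k) (M : R) :
  UltraFilter F -> F [set z | modulus (f z) <= M] ->
  exists l, forall e : R, 0 < e -> F [set z | modulus (f z - l) < e].
Proof.
move=> FU; case: k f => /= f FM; first exact: ultra_limit_real FM.
have ReM (z : R[i]) : `|complex.Re z| <= complex.Re `|z|.
  by have := normc_ge_Re z; rewrite lecE /= => /andP[].
have ImM (z : R[i]) : `|complex.Im z| <= complex.Re `|z|.
  rewrite normc_def /= -sqrtr_sqr ler_wsqrtr// lerDr sqr_ge0//.
have leM (z : R[i]) : complex.Re `|z| <= `|complex.Re z| + `|complex.Im z|.
  rewrite normc_def /= -[leRHS]ger0_norm ?addr_ge0// -sqrtr_sqr ler_wsqrtr//.
  by rewrite sqrrD !real_normK ?num_real// addrAC lerDl mulrn_wge0// mulr_ge0.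
have [a aP] := @ultra_limit_real _ F (fun z => complex.Re (f z)) M FU
  (filterS (fun z => le_trans (ReM (f z))) FM).
have [b bP] := @ultra_limit_real _ F (fun z => complex.Im (f z)) M FU
  (filterS (fun z => le_trans (ImM (f z))) FM).
exists (a +i* b)%C => e e0; have e20 : 0 < e / 2 by rewrite divr_gt0.
apply: filterS (filterI (aP _ e20) (bP _ e20)) => z [/= za zb].
apply: le_lt_trans (leM _) _; rewrite [ltRHS]splitr; apply: ltrD.
  by case: (f z) za.
by case: (f z) zb.
Qed.

Lemma ultra_finite_union {T : Type} {I : eqType} (F : set_system T) (s : seq I)
    (A : I -> set T) : UltraFilter F ->
  F [set z | exists2 i, i \in s & A i z] -> exists2 i, i \in s & F (A i).
Proof.
move=> FU; elim: s => [|i s IH] FA.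
  have /filter_ex[z [j]] := FA; by rewrite in_nil.
have [Fi|FNi] := in_ultra_setVsetC (A i) FU; first by exists i; rewrite ?mem_head.
have [|j js Fj] := IH; last by exists j; rewrite // inE js orbT.
apply: filterS (filterI FA FNi) => z [[j]].
by rewrite inE => /orP[/eqP -> //|js Aj _]; exists j.
Qed.

End ultrafilter_limits.

Section real_norm.
Context {R : realType} {k : scalar_kind}.
Local Notation K := (scalars R k).
Implicit Types E F : normedModType K.

(** Norms take values in the scalar field; this is the same norm with values in R, where real
    inequalities can be used for both kinds of scalars. *)
Definition rnorm {E} (x : E) : R := modulus `|x|.

Lemma rnormE {E} (x : E) : `|x| = of_real k (rnorm x).
Proof. by rewrite -norm_modulus normr_id. Qed.

Lemma rnorm_ge0 {E} (x : E) : 0 <= rnorm x.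
Proof. exact: modulus_ge0. Qed.

Lemma rnormD {E} (x y : E) : rnorm (x + y) <= rnorm x + rnorm y.
Proof. by rewrite -(of_real_le (k := k)) of_realD -!rnormE ler_normD. Qed.

Lemma rnormZ {E} (a : K) (x : E) : rnorm (a *: x) = modulus a * rnorm x.
Proof.
by apply: (@of_real_inj _ k); rewrite of_realM -!rnormE normrZ -norm_modulus.
Qed.

Lemma rnormN {E} (x : E) : rnorm (- x) = rnorm x.
Proof. by rewrite /rnorm normrN. Qed.

Lemma rnormB {E} (x y : E) : rnorm (x - y) <= rnorm x + rnorm y.
Proof. by rewrite -[X in _ <= _ + X]rnormN rnormD. Qed.

Lemma rdistC {E} (x y : E) : rnorm (x - y) = rnorm (y - x).
Proof. by rewrite -rnormN opprB. Qed.

Lemma rdistD {E} (z x y : E) : rnorm (x - y) <= rnorm (x - z) + rnorm (z - y).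
Proof. by apply: le_trans (rnormD _ _); rewrite addrA subrK. Qed.

Lemma rnorm0 {E} : rnorm (0 : E) = 0.
Proof. by rewrite /rnorm normr0 modulus0. Qed.

Lemma rnorm0_eq0 {E} (x : E) : rnorm x = 0 -> x = 0.
Proof. by move=> x0; apply: normr0_eq0; rewrite rnormE x0 of_real0. Qed.

Lemma modulus_of_real (c : R) : 0 <= c -> modulus (of_real k c) = c.
Proof.
move=> c0; apply: (@of_real_inj _ k); rewrite -norm_modulus ger0_norm//.
by rewrite -(@of_real0 R k) of_real_le.
Qed.

Lemma of_real_lt (a b : R) : (of_real k a < of_real k b) = (a < b).
Proof. by rewrite !lt_neqAle of_real_le (inj_eq (@of_real_inj R k)). Qed.

Lemma of_real_modulus (c : K) : 0 <= c -> of_real k (modulus c) = c.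
Proof. by move=> c0; rewrite -norm_modulus ger0_norm. Qed.

Lemma rnorm_sum {E} {I : Type} (s : seq I) (f : I -> E) :
  rnorm (\sum_(i <- s) f i) <= \sum_(i <- s) rnorm (f i).
Proof.
elim: s => [|i s IH]; first by rewrite !big_nil rnorm0.
by rewrite !big_cons; apply: le_trans (rnormD _ _) _; rewrite lerD2l.
Qed.

Lemma nbhs_rnormP {E} (x : E) (A : set E) :
  nbhs x A <-> exists2 e : R, 0 < e & forall y, rnorm (x - y) < e -> A y.
Proof.
split=> [/nbhs_normP[e /= e0 eA]|[e e0 eA]]; last first.
  apply/nbhs_normP; exists (of_real k e); first by rewrite /= -(@of_real0 R k) of_real_lt.
  by move=> y; rewrite /= rnormE of_real_lt => /eA.
exists (modulus e) => [|y ye].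
  by rewrite -(of_real_lt _ _) of_real0 of_real_modulus// ltW.
by apply: eA; rewrite /= rnormE -(of_real_modulus (ltW e0)) of_real_lt.
Qed.

Lemma bounded_opP {E F} (T : {linear E -> F}) : bounded_op T <->
  exists2 M : R, 0 <= M & forall x, rnorm (T x) <= M * rnorm x.
Proof.
split=> [[M TM]|[M M0 TM]]; last first.
  by exists (of_real k M) => x; rewrite !rnormE -of_realM of_real_le.
exists (modulus M) => [|x]; first exact: modulus_ge0.
rewrite -(of_real_le (k := k)) of_realM -rnormE -norm_modulus -rnormE.
have -> : `|M| * `|x| = `|M * `|x| | by rewrite normrM normr_id.
apply: le_trans (TM x) _; rewrite ger0_norm//; apply: le_trans (TM x); exact: normr_ge0.
Qed.

Lemma bounded_op_id {E} : bounded_op (idfun : {linear E -> E}).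
Proof. by apply/bounded_opP; exists 1 => // x; rewrite mul1r. Qed.

Lemma bounded_op_comp {E F G : normedModType K} (S : {linear F -> G}) (T : {linear E -> F}) :
  bounded_op S -> bounded_op T -> bounded_op (S \o T).
Proof.
move=> /bounded_opP[M M0 SM] /bounded_opP[N N0 TN]; apply/bounded_opP.
exists (M * N) => [|x /=]; first exact: mulr_ge0.
by apply: le_trans (SM _) _; rewrite -mulrA ler_wpM2l.
Qed.

Lemma bounded_opB {E F} (S T : {linear E -> F}) :
  bounded_op S -> bounded_op T -> bounded_op (S \- T).
Proof.
move=> /bounded_opP[M M0 SM] /bounded_opP[N N0 TN]; apply/bounded_opP.
exists (M + N) => [|x /=]; first exact: addr_ge0.
by apply: le_trans (rnormB _ _) _; rewrite mulrDl lerD.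
Qed.

Lemma bounded_op0 {E F} : bounded_op (\0 : {linear E -> F}).
Proof. by apply/bounded_opP; exists 0 => // x /=; rewrite rnorm0 mul0r. Qed.

End real_norm.

(** * Completeness, total boundedness and compact operators *)

Section compactness.
Context {R : realType} {k : scalar_kind}.
Local Notation K := (scalars R k).
Implicit Types E F G : normedModType K.

Definition finite_nets {E} (A : set E) : Prop :=
  forall e : R, 0 < e -> exists s : seq E, forall y, A y -> exists2 z, z \in s & rnorm (y - z) < e.

(** Completeness in terms of ultrafilters that contain balls of every radius. It is needed because
    [precompact] means compact closure, which for totally bounded sets requires limits to exist. *)
Definition ultra_complete E : Prop := forall F : set_system E, UltraFilter F ->
  (forall e : R, 0 < e -> exists y, F [set z | rnorm (z - y) < e]) ->
  exists p, forall e : R, 0 < e -> F [set z | rnorm (z - p) < e].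

Lemma separated_sequence {E} (A : set E) : ~ finite_nets A ->
  exists (e : R) (u : nat -> E), [/\ 0 < e, forall n, A (u n) &
    forall m n, (m < n)%N -> e <= rnorm (u n - u m)].
Proof.
move=> /existsNP[e /not_implyP[e0 /forallNP noS]].
have /choice[f fP] (s : seq E) : exists y, A y /\ {in s, forall z, e <= rnorm (y - z)}.
  have /existsNP[y /not_implyP[Ay nos]] := noS s; exists y; split=> // z zs.
  by rewrite leNgt; apply/negP => yz; apply: nos; exists z.
(* [L n] lists the points chosen before stage n, and [f] picks a point of A far from all of them. *)
pose L := fix L n := if n is m.+1 then f (L m) :: L m else [::].
exists e, (fun n => f (L n)); split=> // [n|m n mn]; first by have [] := fP (L n).
have [_] := fP (L n); apply; elim: n mn => // n IH.
by rewrite ltnS leq_eqVlt inE => /orP[/eqP ->|/IH ->]; rewrite ?eqxx ?orbT.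
Qed.

Lemma separated_not_precompact {E} (A : set E) (e : R) (u : nat -> E) : 0 < e ->
  (forall n, A (u n)) -> (forall m n, (m < n)%N -> e <= rnorm (u n - u m)) ->
  ~ precompact A.
Proof.
move=> e0 Au ue; rewrite precompactE => cA.
have uA : (u @ \oo) (closure A) by exists 0%N => // n _; exact/subset_closure/Au.
have [p [_ clu]] := cA (u @ \oo) _ uA; have e20 : 0 < e / 2 by rewrite divr_gt0.
have pB : nbhs p [set y | rnorm (p - y) < e / 2] by apply/nbhs_rnormP; exists (e / 2).
have tail N : exists2 n, (N <= n)%N & rnorm (p - u n) < e / 2.
  have uN : (u @ \oo) (u @` [set n | (N <= n)%N]).
    by exists N => // n Nn; exists n.
  by have [_ [[n Nn <-] pn]] := clu _ _ uN pB; exists n.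
have [m _ pm] := tail 0%N; have [n mn pn] := tail m.+1.
have := ue m n mn; apply/negP; rewrite -ltNge.
apply: le_lt_trans (rdistD p _ _) _; rewrite [ltRHS]splitr.
by apply: ltrD; rewrite // rdistC.
Qed.

Lemma precompact_finite_nets {E} (A : set E) : precompact A -> finite_nets A.
Proof.
move=> cA; apply: contrapT => /separated_sequence[e [u [e0 Au ue]]].
exact: separated_not_precompact e0 Au ue cA.
Qed.

Lemma finite_nets_precompact {E} (A : set E) : ultra_complete E ->
  finite_nets A -> precompact A.
Proof.
move=> cE nA; rewrite precompactE compact_ultra => F FU FA.
have [p pP] : exists p, forall e : R, 0 < e -> F [set z | rnorm (z - p) < e].
  apply: cE => // e e0; have e20 : 0 < e / 2 by rewrite divr_gt0.
  have [s sP] := nA _ e20.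
  have [|y _ Fy] := @ultra_finite_union _ _ F s (fun y => [set z | rnorm (z - y) < e]) FU.
    apply: filterS FA => z /(_ [set y | rnorm (z - y) < e / 2])[|y [Ay zy]].
      by apply/nbhs_rnormP; exists (e / 2).
    have [w ws yw] := sP y Ay; exists w => //=.
    apply: le_lt_trans (rdistD y _ _) _; rewrite [ltRHS]splitr.
    exact: ltrD.
  by exists y.
have Fp : F --> p.
  move=> B /nbhs_rnormP[e e0 eB]; apply: filterS (pP e e0) => z /=.
  by rewrite rdistC => /eB.
exists p; split => // B pB.
have clA : F (closure A) := FA; have FB := Fp _ pB.
have /nbhs_rnormP[e e0 eB] := pB; have e20 : 0 < e / 2 by rewrite divr_gt0.
have FI : F (closure A `&` [set z | rnorm (z - p) < e / 2]).
  by apply: filterI; [exact: clA|exact: pP].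
have [z [zA zp]] := filter_ex FI.
have [|y [Ay zy]] := zA [set y | rnorm (z - y) < e / 2].
  by apply/nbhs_rnormP; exists (e / 2).
exists y; split=> //; apply: eB; apply: le_lt_trans (rdistD z _ _) _.
by rewrite [ltRHS]splitr; apply: ltrD; rewrite // rdistC.
Qed.

Definition op_nets {E F} (T : E -> F) : Prop := forall e : R, 0 < e ->
  exists s : seq F, forall x, rnorm x <= 1 -> exists2 z, z \in s & rnorm (T x - z) < e.

Lemma unit_ball_rnorm {E} (x : E) : (`|x| <= 1) = (rnorm x <= 1).
Proof.
have -> : 1 = of_real k 1 :> K by case: k.
by rewrite rnormE of_real_le.
Qed.

Lemma op_netsE {E F} (T : E -> F) :
  op_nets T <-> finite_nets (T @` [set x | `|x| <= 1]).
Proof.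
split=> nT e e0; have [s sP] := nT e e0; exists s.
  by move=> _ [x x1 <-]; apply: sP; rewrite -unit_ball_rnorm.
by move=> x x1; apply: sP; exists x => //=; rewrite unit_ball_rnorm.
Qed.

Lemma compact_opP {E F} (T : {linear E -> F}) : ultra_complete F ->
  compact_op T <-> bounded_op T /\ op_nets T.
Proof.
move=> cF; split=> -[bT nT]; split=> //.
  exact/op_netsE/precompact_finite_nets.
exact/finite_nets_precompact/op_netsE.
Qed.

Lemma op_nets_compl {E F G} (S : {linear F -> G}) (T : E -> F) :
  bounded_op S -> op_nets T -> op_nets (S \o T).
Proof.
move=> /bounded_opP[M M0 SM] nT e e0.
(* [M] may be 0, so [M + 1] serves as the divisor; the same device recurs below. *)
have M10 : 0 < M + 1 by rewrite ltr_wpDl.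
have [s sP] := nT _ (divr_gt0 e0 M10); exists (map S s) => x /sP[z zs xz].
exists (S z); first exact: map_f.
rewrite /= -linearB; apply: le_lt_trans (SM _) _.
apply: (@le_lt_trans _ _ ((M + 1) * rnorm (T x - z))).
  by rewrite ler_wpM2r ?rnorm_ge0// lerDl.
by rewrite mulrC -ltr_pdivlMr.
Qed.

Lemma op_nets_compr {E F G} (S : {linear F -> G}) (T : {linear E -> F}) :
  op_nets S -> bounded_op T -> op_nets (S \o T).
Proof.
move=> nS /bounded_opP[M M0 TM] e e0.
have M10 : 0 < M + 1 by rewrite ltr_wpDl.
have [s sP] := nS _ (divr_gt0 e0 M10).
pose c : K := of_real k (M + 1).
have c0 : modulus c = M + 1 by rewrite modulus_of_real// ltW.
have cN0 : c != 0 by apply: contra_eq_neq c0 => ->; rewrite modulus0 lt_eqF.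
exists [seq c *: z | z <- s] => x x1.
have [|z zs xz] := sP (c^-1 *: T x).
  rewrite rnormZ modulusV c0 mulrC ler_pdivrMr// mul1r.
  apply: le_trans (TM x) _; apply: (@le_trans _ _ M); last by rewrite lerDl.
  by rewrite ler_piMr.
exists (c *: z); first exact: map_f.
have -> : (S \o T) x - c *: z = c *: (S (c^-1 *: T x) - z).
  by rewrite scalerBr -linearZ_LR scalerA mulfV// scale1r.
by rewrite rnormZ c0 mulrC -ltr_pdivlMr.
Qed.

Lemma op_netsB {E F} (S T : E -> F) : op_nets S -> op_nets T ->
  op_nets (fun x => S x - T x).
Proof.
move=> nS nT e e0; have e20 : 0 < e / 2 by rewrite divr_gt0.
have [s sP] := nS _ e20; have [t tP] := nT _ e20.
exists [seq y - z | y <- s, z <- t] => x x1.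
have [y ys xy] := sP x x1; have [z zt xz] := tP x x1.
exists (y - z); first by apply/allpairsP; exists (y, z).
have -> : S x - T x - (y - z) = (S x - y) - (T x - z).
  by rewrite !opprB [LHS]addrACA [RHS]addrACA; congr (_ + _); exact: addrC.
apply: le_lt_trans (rnormB _ _) _; rewrite [ltRHS]splitr.
exact: ltrD.
Qed.

Lemma op_nets0 {E F} : op_nets (\0 : {linear E -> F}).
Proof. by move=> e e0; exists [:: 0] => x _; exists 0; rewrite ?mem_head//= subrr rnorm0. Qed.

Lemma eq_op_nets {E F} (S T : E -> F) : S =1 T -> op_nets S -> op_nets T.
Proof. by move=> ST nS e /nS[s sP]; exists s => x; rewrite -ST; exact: sP. Qed.

Lemma eq_bounded_op {E F} (S T : {linear E -> F}) : S =1 T -> bounded_op S -> bounded_op T.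
Proof.
by move=> ST /bounded_opP[M M0 SM]; apply/bounded_opP; exists M => // x; rewrite -ST.
Qed.

End compactness.

(** * Infinite-dimensional subspaces and strict singularity *)

Section independence.
Context {R : realType} {k : scalar_kind}.
Local Notation K := (scalars R k).
Implicit Types E F : normedModType K.

Definition independent {E} n (w : 'I_n -> E) : Prop :=
  forall a : 'I_n -> K, \sum_i a i *: w i = 0 -> forall i, a i = 0.

Lemma kernel_vector n m (A : 'M[K]_(n, m)) : (m < n)%N ->
  exists2 u : 'rV[K]_n, u != 0 & u *m A = 0.
Proof.
move=> mn; have /rowV0Pn[u uA u0] : kermx A != 0.
  rewrite -mxrank_eq0 mxrank_ker subn_eq0 -ltnNge.
  exact: leq_ltn_trans (rank_leq_col A) mn.
by exists u => //; apply/eqP; rewrite -/(u *m A == 0); apply/eqP/sub_kermxP.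
Qed.

Lemma rV_neq0 n (u : 'rV[K]_n) : u != 0 -> exists i, u 0 i != 0.
Proof.
by move=> /matrix0Pn[i [j]]; rewrite ord1 => uj; exists j.
Qed.

Lemma independent_infinite {E} (W : {pred E}) :
  (forall n, exists w : 'I_n -> E, (forall i, w i \in W) /\ independent w) ->
  infinite_dimensional W.
Proof.
move=> indep [m [v vP]]; have [w [wW wi]] := indep m.+1.
have /choice[A AP] i := vP (w i) (wW i).
have [u u0 uA] := kernel_vector (\matrix_(i < m.+1, j < m) A i j) (ltnSn m).
have [i /negP] := rV_neq0 u0; apply; apply/eqP; apply: (wi (fun i => u 0 i)).
under eq_bigr => j _ do rewrite AP scaler_sumr.
rewrite exchange_big /= big1// => j _.
under eq_bigr => l _ do rewrite scalerA.
rewrite -scaler_suml; have /rowP/(_ j) := uA; rewrite !mxE.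
by under eq_bigr => l _ do rewrite mxE; move=> ->; rewrite scale0r.
Qed.

Lemma infinite_independent {E} (W : {pred E}) : infinite_dimensional W ->
  forall n, exists w : 'I_n -> E, (forall i, w i \in W) /\ independent w.
Proof.
move=> infW; elim=> [|n [w [wW wi]]].
  by exists (fun=> 0); split=> [[]|a _ []].
have /existsNP[x /not_implyP[xW nox]] : ~ forall x, x \in W ->
    exists a : 'I_n -> K, x = \sum_i a i *: w i.
  by move=> span; apply: infW; exists n, w.
exists (fun i => if unlift ord0 i is Some j then w j else x); split.
  by move=> i; case: unliftP.
move=> a; rewrite big_ord_recl unlift_none => a0.
have aE : \sum_(i < n) a (lift ord0 i) *:
    (if unlift ord0 (lift ord0 i) is Some j then w j else x) =
    \sum_(i < n) a (lift ord0 i) *: w i.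
  by apply: eq_bigr => i _; rewrite liftK.
rewrite {}aE in a0.
have a00 : a ord0 = 0.
  apply/eqP/negPn/negP => a00; apply: nox.
  exists (fun i => - (a ord0)^-1 * a (lift ord0 i)).
  under eq_bigr => i _ do rewrite -scalerA.
  rewrite -scaler_sumr; move: a0 => /(congr1 (fun y => (a ord0)^-1 *: y)).
  rewrite scalerDr scalerA mulVf// scale1r scaler0 scaleNr.
  by move=> /eqP; rewrite addr_eq0 => /eqP.
move: a0; rewrite a00 scale0r add0r => /wi aw i.
by case: (unliftP ord0 i) => [j ->|->].
Qed.

Lemma submod_sum {E} (W : {pred E}) n (a : 'I_n -> K) (w : 'I_n -> E) :
  submod_closed W -> (forall i, w i \in W) -> \sum_i a i *: w i \in W.
Proof.
move=> [W0 WP] wW; elim/big_ind: _ => //.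
  by move=> x y xW yW; rewrite -[x]scale1r; exact: WP.
by move=> i _; rewrite -[_ *: _]addr0; exact: WP.
Qed.

Lemma common_kernel {E} (W : {pred E}) n (f : 'I_n -> E -> K) :
  submod_closed W -> infinite_dimensional W ->
  (forall j a x y, f j (a *: x + y) = a * f j x + f j y) ->
  exists x, [/\ x \in W, x != 0 & forall j, f j x = 0].
Proof.
move=> sW /infinite_independent/(_ n.+1)[w [wW wi]] fL.
have f0 j : f j 0 = 0.
  have := fL j 1 0 0; rewrite scaler0 addr0 mul1r => /eqP.
  by rewrite -subr_eq0 opprD addNKr oppr_eq0 => /eqP.
have fS j (a : 'I_n.+1 -> K) : f j (\sum_i a i *: w i) = \sum_i a i * f j (w i).
  by elim/big_rec2: _ => // i y x _ <-; rewrite fL.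
have [u u0 uA] := kernel_vector (\matrix_(i < n.+1, j < n) f j (w i)) (ltnSn n).
exists (\sum_i u 0 i *: w i); split; first exact: submod_sum.
  apply/eqP => /(wi (fun i => u 0 i)) ui.
  by have [i0] := rV_neq0 u0; rewrite ui eqxx.
move=> j; rewrite fS; have /rowP/(_ j) := uA; rewrite !mxE => uAj.
by rewrite -[RHS]uAj; apply: eq_bigr => i _; rewrite mxE.
Qed.

(** The upper estimate of an isomorphic embedding is automatic for a bounded operator, which leaves
    the lower estimate. *)
Lemma strictly_singularP {E F} (T : {linear E -> F}) :
  strictly_singular T <-> bounded_op T /\
    forall W : {pred E}, submod_closed W -> infinite_dimensional W ->
    ~ exists2 c : R, 0 < c & forall x, x \in W -> c * rnorm x <= rnorm (T x).
Proof.
split=> -[bT ssT]; split=> //.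
  move=> W sW iW [c c0 cT]; apply: ssT; exists W; split=> //.
  have /bounded_opP[M M0 TM] := bT.
  exists (of_real k c), (of_real k M); split.
    by rewrite -(@of_real0 R k) of_real_lt.
  by move=> x xW; rewrite !rnormE -!of_realM !of_real_le cT.
move=> [W [sW iW [c [C [c0 cT]]]]]; apply: (ssT W sW iW); exists (modulus c).
  by rewrite -(of_real_lt (k := k)) of_real0 of_real_modulus// ltW.
move=> x /cT[+ _].
by rewrite !rnormE -(of_real_modulus (ltW c0)) -of_realM of_real_le (of_real_modulus (ltW c0)).
Qed.

Lemma strictly_singular_compl {E F G : normedModType K} (A : {linear F -> G}) (T : {linear E -> F}) :
  bounded_op A -> strictly_singular T -> strictly_singular (A \o T).
Proof.
move=> bA /strictly_singularP[bT ssT]; apply/strictly_singularP.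
split=> [|W sW iW [c c0 cT]]; first exact: bounded_op_comp.
have /bounded_opP[M M0 AM] := bA; have M10 : 0 < M + 1 by rewrite ltr_wpDl.
apply: (ssT W sW iW); exists (c / (M + 1)); first exact: divr_gt0.
move=> x /cT cx; rewrite mulrAC ler_pdivrMr//; apply: le_trans cx _.
apply: le_trans (AM _) _; rewrite mulrC ler_wpM2l ?rnorm_ge0// lerDl//.
Qed.

(** If [T \o B] is bounded below on W, then [B] is injective on W, so the image B(W) is
    infinite-dimensional, and [T] is bounded below on it. *)
Lemma strictly_singular_compr {E F G : normedModType K} (T : {linear F -> G}) (B : {linear E -> F}) :
  strictly_singular T -> bounded_op B -> strictly_singular (T \o B).
Proof.
move=> /strictly_singularP[bT ssT] bB; apply/strictly_singularP.
split=> [|W sW iW [c c0 cT]]; first exact: bounded_op_comp.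
have /bounded_opP[M M0 BM] := bB; have M10 : 0 < M + 1 by rewrite ltr_wpDl.
have /bounded_opP[N N0 TN] := bT.
pose W' : {pred F} := [pred y | `[< exists2 x, x \in W & B x = y >]].
have W'P y : reflect (exists2 x, x \in W & B x = y) (y \in W') by exact: asboolP.
apply: (ssT W').
- split; first by apply/W'P; exists 0; [exact: sW.1|exact: linear0].
  move=> a y z /W'P[x xW <-] /W'P[x' x'W <-]; apply/W'P.
  by exists (a *: x + x'); [exact: sW.2|rewrite linearP].
- apply: independent_infinite => n.
  have [w [wW wi]] := infinite_independent iW n.
  exists (fun i => B (w i)); split=> [i|a].
    by apply/W'P; exists (w i).
  under eq_bigr do rewrite -linearZ; rewrite -linear_sum => aB.
  apply: wi; apply: rnorm0_eq0; apply/eqP; rewrite eq_le rnorm_ge0 andbT.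
  have := cT _ (submod_sum a sW wW); rewrite /= aB linear0 rnorm0.
  by rewrite pmulr_rle0.
exists (c / (M + 1)); first exact: divr_gt0.
move=> _ /W'P[x xW <-]; apply: le_trans (cT x xW).
rewrite -mulrA; apply: ler_wpM2l; [exact: ltW|rewrite ler_pdivrMl//].
by apply: le_trans (BM x) _; rewrite ler_wpM2r ?rnorm_ge0// lerDl.
Qed.

End independence.

(** * Completeness and selection of blocks *)

Section sequence_spaces.
Context {R : realType} {k : scalar_kind}.
Local Notation K := (scalars R k).
Implicit Types t : ctype R.

Lemma modulusN (x : K) : modulus (- x) = modulus x.
Proof. by apply: (@of_real_inj _ k); rewrite -!norm_modulus normrN. Qed.

Definition sspace t : normedModType K := seq_elt (space (k := k) t).

Definition coord {t} (x : sspace t) : scalar_seq R k := val x.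

Lemma coordB {t} (x y : sspace t) i : coord (x - y) i = coord x i - coord y i.
Proof. by []. Qed.

Lemma coordZ {t} a (x : sspace t) i : coord (a *: x) i = a * coord x i.
Proof. by []. Qed.

Lemma coordP {t} a (x y : sspace t) i : coord (a *: x + y) i = a * coord x i + coord y i.
Proof. by []. Qed.

Lemma coord_sum {t} {I : Type} (s : seq I) (a : I -> K) (x : I -> sspace t) i :
  coord (\sum_(j <- s) a j *: x j) i = \sum_(j <- s) a j * coord (x j) i.
Proof.
elim: s => [|j s IH]; first by rewrite !big_nil.
by rewrite !big_cons coordP IH.
Qed.

Lemma coord_inj {t} (x y : sspace t) : coord x =1 coord y -> x = y.
Proof. by move=> xy; apply: val_inj; apply/funext. Qed.

Lemma coord_carrier {t} (x : sspace t) : seq_carrier (space t) (coord x).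
Proof. exact/set_mem/(valP x). Qed.

Definition mk_sspace {t} (x : scalar_seq R k) (Ex : seq_carrier (space t) x) : sspace t :=
  SeqElt (mem_set Ex : x \in seq_pred (space t)).

Lemma rnorm_leP {t} (x : sspace t) c : rnorm x <= c <-> tle t S (absv (coord x)) c.
Proof.
apply: iff_trans (seq_norm_leP t (coord x) c).
have f := seq_norm_fin x.
have n0 : 0 <= fine (seq_norm (space t) (val x)) by rewrite fine_ge0// seq_norm_ge0.
have -> : rnorm x = fine (seq_norm (space t) (val x)) by exact: modulus_of_real.
by rewrite -lee_fin fineK.
Qed.

Lemma tle_rnorm {t} (x : sspace t) : tle t S (absv (coord x)) (rnorm x).
Proof. exact/rnorm_leP. Qed.

Lemma coord_le {t} (x : sspace t) i : modulus (coord x i) <= rnorm x.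
Proof.
by apply: (nle_coord _ _ (tle_rnorm x)); [exact: capacity_gt0|exact: modulus_ge0].
Qed.

Lemma tleD t h (u v w : nat -> R) c d : (forall i, 0 <= u i) -> (forall i, 0 <= v i) ->
  (forall i, 0 <= w i <= u i + v i) -> tle t h u c -> tle t h v d -> tle t h w (c + d).
Proof. by move=> u0 v0 wuv uc vd; apply: nle_le wuv _; exact: nleD. Qed.

Lemma tle_truncate_l1 t h (v : nat -> R) N c : (forall i, 0 <= v i) ->
  (forall i, (i < N)%N -> v i <= c / N.+1%:R) -> 0 <= c -> tle t h (truncate N v) c.
Proof.
move=> v0 vc c0 C [_ _ pC]; have [M CM] := chain_bound C.
have tv0 i : 0 <= truncate N v i by have /andP[] := truncate_ge0 N i v0.
have CM' F i : F \in C -> i \in F -> (i < maxn M N)%N.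
  by move=> FC iF; rewrite leq_max (CM F i FC iF).
apply: (le_trans (gauge_le_l1 _ pC tv0 CM')).
rewrite (@big_cat_nat _ _ _ N)//= ?leq_maxr// [X in _ + X <= _]big_nat_cond.
rewrite [X in _ + X <= _]big1 ?addr0; last first.
  by move=> i /andP[/andP[Ni _] _]; rewrite /truncate ltnNge Ni.
apply: (@le_trans _ _ (\sum_(0 <= i < N) c / N.+1%:R)).
  rewrite big_nat_cond [leRHS]big_nat_cond; apply: ler_sum => i /andP[/andP[_ iN] _].
  by rewrite /truncate iN vc.
rewrite sumr_const_nat subn0 -[leLHS]mulr_natr mulrAC ler_pdivrMr//.
by rewrite ler_wpM2l// ler_nat.
Qed.

Lemma filter_coords {T : Type} (F : set_system T) (A : nat -> set T) N :
  Filter F -> (forall i, F (A i)) -> F [set z | forall i, (i < N)%N -> A i z].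
Proof.
move=> FF FA; elim: N => [|N IH]; first by apply: filterS (@filterT _ F FF) => z _ i.
apply: filterS (filterI (FA N) IH) => z [AN Az] i.
by rewrite ltnS leq_eqVlt => /orP[/eqP -> //|/Az].
Qed.

(** The candidate [l] is the coordinatewise limit along F. If the ball of radius e about y belongs
    to F, then [l] is within [2 * e] of y; this also transfers the finite norm and the small tails
    of y to [l], so [l] belongs to the space. *)
Lemma sspace_ultra_complete t : ultra_complete (sspace t).
Proof.
move=> F FU Fc.
have /choice[l lP] i : exists l, forall e : R, 0 < e -> F [set z : sspace t | modulus (coord z i - l) < e].
  have [y Fy] := Fc 1 ltr01.
  apply: (@ultra_limit _ _ _ F (fun z : sspace t => coord z i) (1 + rnorm y)).
  apply: filterS Fy => z /= zy; apply: le_trans (coord_le z i) _.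
  rewrite -[z in rnorm z](subrK y); apply: le_trans (rnormD _ _) _.
  by rewrite lerD2r ltW.
have near e y : 0 < e -> F [set z | rnorm (z - y) < e] ->
    tle t S (absv (fun i => l i - coord y i)) (2 * e).
  move=> e0 Fy; apply: nle_fatou => N.
  have eN : 0 < e / N.+1%:R by rewrite divr_gt0.
  (* One e pays for the distance from z to y, the other for the first N coordinates of [l - z],
     estimated in l_1. *)
  have FN : F ([set z | forall i, (i < N)%N -> modulus (coord z i - l i) < e / N.+1%:R] `&`
      [set z | rnorm (z - y) < e]).
    apply: filterI => //; apply: filter_coords => i.
    exact: lP.
  have [z [zl zy]] := filter_ex FN.
  rewrite mulr_natl mulr2n.
  apply: (@tleD t S (truncate N (absv (fun i => l i - coord z i))) (absv (coord (z - y)))).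
  - by move=> i; have /andP[] := truncate_ge0 N i (absv_ge0 (fun i => l i - coord z i)).
  - exact: absv_ge0.
  - move=> i; have /andP[-> _]/= := truncate_ge0 N i (absv_ge0 (fun i => l i - coord y i)).
    rewrite /truncate; case: ifP => _; last by rewrite add0r absv_ge0.
    rewrite /absv coordB; apply: le_trans _ (modulusD _ _).
    by rewrite addrA subrK.
  - apply: tle_truncate_l1; [exact: absv_ge0| |exact: ltW] => i iN.
    by apply/ltW; have := zl i iN; rewrite /absv -opprB modulusN.
  - by apply/rnorm_leP; exact: ltW.
have lc : seq_carrier (space t) l.
  apply/seq_carrierP; split.
    have [y Fy] := Fc 1 ltr01; exists (2 * 1 + rnorm y).
    apply: tleD (near 1 y ltr01 Fy) (tle_rnorm y); try exact: absv_ge0.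
    by move=> i; rewrite absv_ge0; apply: le_trans _ (modulusD _ _); rewrite subrK.
  move=> e e0; have e40 : 0 < e / 4 by rewrite divr_gt0.
  have [y Fy] := Fc _ e40.
  have [_ /(_ _ e40)[m ym]] := (seq_carrierP t (coord y)).1 (coord_carrier y).
  exists m; apply: (@nle_weaken _ _ _ _ (2 * (e / 4) + e / 4)); first by lra.
  apply: tleD (near _ y e40 Fy) ym; [exact: absv_ge0| |].
    by move=> i; have /andP[] := tail_from_ge0 m i (absv_ge0 (coord y)).
  move=> i; have /andP[-> _] := tail_from_ge0 m i (absv_ge0 l).
  rewrite /tail_from; case: ifP => _; last by rewrite addr0 absv_ge0.
  by apply: le_trans _ (modulusD _ _); rewrite subrK.
exists (mk_sspace lc) => e e0; have e40 : 0 < e / 4 by rewrite divr_gt0.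
have [y Fy] := Fc _ e40; apply: filterS (Fy) => z /= zy.
have yl : rnorm (mk_sspace lc - y) <= 2 * (e / 4).
  by apply/rnorm_leP; exact: near _ y e40 Fy.
apply: le_lt_trans (rdistD y _ _) _; rewrite (rdistC y); lra.
Qed.

End sequence_spaces.

(** In [P n M l M'], block n starts at [M] and ends at [M'], and [l] is the index chosen for it.
    Since U contains the cofinite sets, [l] can be taken beyond the indices already used, and then
    [M'] beyond [M]. *)
Lemma block_selection (U : set_system nat) (P : nat -> nat -> nat -> nat -> Prop) :
  ProperFilter U -> \oo `<=` U ->
  (forall n M, U [set l | \forall M' \near \oo, P n M l M']) ->
  exists phi m : nat -> nat, [/\ m 0%N = 0%N, forall n, (phi n < phi n.+1)%N,
    forall n, (m n < m n.+1)%N & forall n, P n (m n) (phi n) (m n.+1)].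
Proof.
move=> FU Uoo UP.
have /choice[g gP] (q : nat * (nat * nat)) : exists q' : nat * nat,
    [/\ (q.2.1 <= q'.1)%N, (q.2.2 < q'.2)%N & P q.1 q.2.2 q'.1 q'.2].
  case: q => n [L M] /=.
  have UL : U [set l | (L <= l)%N] by apply: Uoo; exact: nbhs_infty_ge.
  have [l [Ll Pl]] := filter_ex (filterI UL (UP n M)).
  have [M' [MM' PM']] := filter_ex (filterI (nbhs_infty_gt M) Pl).
  by exists (l, M').
(* The state: a lower bound for the next index, and the start of the next block. *)
pose s := fix s n : nat * nat :=
  if n is m.+1 then ((g (m, s m)).1.+1, (g (m, s m)).2) else (0%N, 0%N).
exists (fun n => (g (n, s n)).1), (fun n => (s n).2); split=> // n.
- by have [+ _ _] := gP (n.+1, s n.+1).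
- by have [_ + _] := gP (n, s n).
- by have [_ _] := gP (n, s n).
Qed.

Lemma gauge_zero {R : realType} (e : mixed R) C : gauge e C (fun=> 0) = 0.
Proof.
have z (p : R) : 1 <= p -> 0 `^ p = 0 :> R /\ 0 `^ p^-1 = 0 :> R.
  by move=> p1; rewrite !powR0// ?invr_eq0 gt_eqF// (lt_le_trans ltr01).
have [z1 z2] := z _ (outer_ge1 e); have [z3 z4] := z _ (inner_ge1 e).
rewrite /gauge /finite_lp big1 ?z2// => F _.
by rewrite big1 ?z4 ?z1.
Qed.

Definition off_block {R : realType} a b (v : nat -> R) i := if (a <= i < b)%N then 0 else v i.

Section estimates.
Context {R : realType} {k : scalar_kind}.
Local Notation K := (scalars R k).
Context (t : ctype R) {m b : nat -> nat} (bm : block_index m b).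
Context (x : nat -> sspace (k := k) t) (B eps : R).
Hypothesis eps0 : 0 <= eps.
Hypothesis xB : forall n, rnorm (x n) <= B.
Hypothesis xoff : forall n,
  tle t S (off_block (m n) (m n.+1) (absv (coord (x n)))) (eps * 4^-1 ^+ n).
Context (N : nat) (a : nat -> K).

Let v := truncate N (absv a).
(** The blocks proper, glued together: on block n this is the absolute value of [x n]. What [x n]
    has outside block n goes into the error [E]. *)
Let w i := absv (coord (x (b i))) i.
Let y := \sum_(0 <= n < N) a n *: x n.

Let v0 n : 0 <= v n. Proof. by have /andP[] := truncate_ge0 N n (absv_ge0 a). Qed.
Let w0 i : 0 <= w i. Proof. exact: absv_ge0. Qed.

Let off n := off_block (m n) (m n.+1) (absv (coord (x n))).
Let off0 n i : 0 <= off n i.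
Proof. by rewrite /off /off_block; case: ifP => // _; exact: absv_ge0. Qed.

Let E i := \sum_(0 <= n < N) v n * off n i.

Let E0 i : 0 <= E i. Proof. by apply: sumr_ge0 => n _; rewrite mulr_ge0. Qed.

Let blockE n i : (m n <= i < m n.+1)%N = (b i == n).
Proof. by rewrite -(block_index_lt bm) leqNgt -(block_index_lt bm) -leqNgt ltnS eqn_leq andbC. Qed.

Let main_term i : exists z, modulus z = v (b i) * w i /\ modulus (coord y i - z) <= E i.
Proof.
exists (\sum_(0 <= n < N | b i == n) a n * coord (x n) i); split.
  have [iN|Ni] := ltnP (b i) N.
    rewrite -big_filter (eq_filter (a2 := pred1 (b i))); last by move=> j; rewrite /= eq_sym.
    rewrite filter_pred1_uniq ?iota_uniq ?mem_index_iota//= big_seq1 modulusM.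
    by rewrite /v /truncate iN.
  rewrite big_nat_cond big1 => [|n /andP[/andP[_ nN] /eqP bn]]; last first.
    by move: nN; rewrite -bn ltnNge Ni.
  by rewrite modulus0 /v /truncate ltnNge Ni mul0r.
rewrite /y coord_sum (bigID (fun n => b i == n))/= addrC addrK.
have -> : \sum_(0 <= n < N | b i != n) a n * coord (x n) i =
    \sum_(0 <= n < N) (if b i != n then a n * coord (x n) i else 0) by rewrite -big_mkcond.
rewrite /E big_seq [leRHS]big_seq; elim/big_ind2 : _ => [|z1 z2 z3 z4 h1 h2|n].
- by rewrite modulus0.
- by apply: le_trans (modulusD _ _) _; rewrite lerD.
rewrite mem_index_iota => /= nN; rewrite /off /off_block blockE.
case: eqP => _ /=; first by rewrite modulus0 mulr0.
by rewrite modulusM /v /truncate nN.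
Qed.

(** The off-block parts are bounded by [eps * 4^-n], so the error is at most [2 * eps] times the
    largest coefficient. *)
Let error_term s : 0 <= s -> (forall n, v n <= s) -> tle t S E (2 * eps * s).
Proof.
move=> s0 vs; apply: (@nle_weaken _ _ _ _ (\sum_(0 <= n < N) s * (eps * 4^-1 ^+ n))).
  rewrite -!mulr_sumr mulrC ler_wpM2r// mulrC ler_wpM2r//.
  apply: geometric_sum_le; first by rewrite invr_ge0.
  by rewrite div1r lef_pV2 ?posrE// ler_nat.
have -> : E = fun i => \sum_(0 <= n < N) v n * off n i by [].
elim: (N) => [|N' IH].
  rewrite big_nil => C _; rewrite -[leRHS](gauge_zero (mixed_of t) C).
  by apply: gauge_le_in => F i _ _; rewrite big_nil lexx.
rewrite [X in nle _ _ _ X]big_nat_recr//=; apply: tleD IH _.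
- by move=> i; apply: sumr_ge0 => n _; rewrite mulr_ge0.
- by move=> i; exact: mulr_ge0 (s0) (off0 N' i).
- move=> i; rewrite big_nat_recr//= lerD2l ler_wpM2r ?off0// andbT.
  by apply: addr_ge0; [apply: sumr_ge0 => n _|]; rewrite mulr_ge0.
- by apply: nleZ => //; exact: xoff.
Qed.

Let upper_from_blocks C c s : 0 <= s -> (forall n, v n <= s) ->
  tle t S (fun i => v (b i) * w i) (C * c) -> tle t S (absv (coord y)) (C * c + 2 * eps * s).
Proof.
move=> s0 vs h; apply: tleD h (error_term s0 vs) => // [i|i]; first exact: mulr_ge0.
rewrite absv_ge0; have [z [zE ze]] := main_term i; rewrite -zE.
apply: le_trans (_ : modulus z + modulus (coord y i - z) <= _); last by rewrite lerD2l.
by apply: le_trans _ (modulusD _ _); rewrite addrC subrK.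
Qed.

Let blocks_from_sum c s : 0 <= s -> (forall n, v n <= s) ->
  tle t S (absv (coord y)) c -> tle t S (fun i => v (b i) * w i) (c + 2 * eps * s).
Proof.
move=> s0 vs h; apply: tleD h (error_term s0 vs) => // [i|i]; first exact: absv_ge0.
have [z [zE ze]] := main_term i; rewrite mulr_ge0//= -zE.
apply: le_trans (_ : modulus (coord y i) + modulus (coord y i - z) <= _); last by rewrite lerD2l.
rewrite -[modulus (_ - z)]modulusN; apply: le_trans _ (modulusD _ _).
by rewrite opprB addrC subrK.
Qed.

Let wB n : nle (mixed_of t) (capacity t S) (on_block (b := b) n w) B.
Proof.
apply: nle_weaken (xB n) _; apply: nle_le (tle_rnorm (x n)) => i.
by rewrite /on_block /w; case: eqP => [->|]; rewrite ?lexx absv_ge0.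
Qed.

Let g_mono i j : (i <= j)%N -> (capacity t S i <= capacity t S j)%N.
Proof. exact: capacity_mono. Qed.
Let g_gt0 i : (0 < capacity t S i)%N. Proof. exact: capacity_gt0. Qed.
Let g_le n : (capacity t S (m n) <= (m n).+1)%N.
Proof. by rewrite /capacity; case: full. Qed.

Lemma peak_sum_upper c : tle t (S \o m) v c -> rnorm y <= (2 * B + 2 * eps) * c.
Proof.
move=> vc; apply/rnorm_leP; rewrite mulrDl; apply: upper_from_blocks.
- exact: nle_ge0 vc.
- by move=> n; apply: (nle_coord _ _ vc) => //; exact: capacity_gt0.
- rewrite -mulrA; apply: (peak_upper bm) => //.
  by rewrite capacity_comp.
Qed.

Lemma flat_sum_upper c :
  (forall n i, modulus (coord (x n) i) * (m n).+1%:R <= 4^-1 ^+ n) ->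
  tle (flat_type t) (S \o m) v c -> rnorm y <= (B + 2 + 2 * eps) * c.
Proof.
move=> xf vc; have vc1 := (flat_typeP _ _ _ v0).2 vc.
apply/rnorm_leP; rewrite mulrDl; apply: upper_from_blocks.
- exact: nle_ge0 vc.
- by move=> n; exact: (nle_coord _ _ vc1).
- by apply: (flat_upper bm) => // i; exact: xf.
Qed.

(** The error is absorbed. Let [s] be the largest coefficient and [c2] the bound obtained when the
    error [2 * eps * s] is added to [c]. Coordinates are bounded by the norm, so [s <= c2]; with
    [16 * eps <= d] this gives [c2 <= 2 * c / d + c2 / 4], hence the constant [4 / d]. *)
Let lower_from_blocks tau d c : 0 < d -> 16 * eps <= d -> rnorm y <= c ->
  (forall n, (0 < capacity tau (S \o m) n)%N) ->
  (forall c', tle t S (fun i => v (b i) * w i) c' -> tle tau (S \o m) v (c' / (d / 2))) ->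
  tle tau (S \o m) v (4 / d * c).
Proof.
move=> d0 ed /rnorm_leP yc cap H.
pose s := \big[Order.max/0]_(0 <= n < N) v n.
have vs n : v n <= s.
  rewrite /v /truncate; case: ltnP => nN; last exact: bigmax_ge_id.
  apply: (@bigmax_sup_seq _ _ _ _ 0 n xpredT _ v) => //; first by rewrite mem_index_iota.
  by rewrite /v /truncate nN.
have s0 : 0 <= s := le_trans (v0 0%N) (vs 0%N).
pose c2 := (c + 2 * eps * s) / (d / 2).
have Hc2 : tle tau (S \o m) v c2 := H _ (blocks_from_sum s0 vs yc).
have c0 := nle_ge0 yc.
have sc2 : s <= c2.
  apply: bigmax_le => [|n _]; first exact: nle_ge0 Hc2.
  exact: (nle_coord (cap n) (v0 n) Hc2).
apply: nle_weaken Hc2.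
have c2E : c2 * d = 2 * (c + 2 * eps * s).
  by rewrite /c2; field; rewrite gt_eqF.
rewrite mulrAC ler_pdivlMr// c2E.
have es : 16 * eps * s <= d * s by rewrite ler_wpM2r.
have sd : s * d <= 2 * (c + 2 * eps * s) by rewrite -c2E ler_wpM2r// ltW.
nra.
Qed.

Lemma peak_sum_lower d c : 0 < d -> 16 * eps <= d ->
  (forall n, exists i, d <= modulus (coord (x n) i)) -> rnorm y <= c ->
  tle t (S \o m) v (4 / d * c).
Proof.
move=> d0 ed /choice[j jP] yc; apply: lower_from_blocks => // [n|c' vwc].
  by apply: capacity_gt0.
(* A coordinate of size [d] cannot lie outside block n, where the coordinates are at most [eps],
   which is at most [d / 16]. *)
have bj n : b (j n) = n.
  apply/eqP; rewrite -blockE; apply/negPn/negP => /negbTE nb.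
  have := nle_coord (g_gt0 (j n)) (off0 n (j n)) (xoff n).
  rewrite /off /off_block nb => /(le_trans (jP n)) dle.
  have : eps * 4^-1 ^+ n <= eps.
    by rewrite ler_piMr// exprn_ile1// ?invr_ge0// invf_le1// ler1n.
  by move=> /(le_trans dle); lra.
rewrite /tle -capacity_comp; apply: (peak_lower bm g_mono w0 v0 _ _ vwc (j := j)).
  by rewrite divr_gt0.
move=> n _; split=> //; rewrite /w bj; apply: le_trans _ (jP n); lra.
Qed.

Lemma flat_sum_lower d c : 0 < d -> 16 * eps <= d ->
  (forall n, d < rnorm (x n)) -> rnorm y <= c ->
  tle (flat_type t) (S \o m) v (4 / d * c).
Proof.
move=> d0 ed xd yc; apply: lower_from_blocks => // [n|c' vwc].
  by apply: capacity_gt0.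
apply/flat_typeP => //; have d20 : 0 < d / 2 by rewrite divr_gt0.
apply: (flat_lower bm w0 v0 d20 _ vwc) => n _.
(* The part of [x n] outside block n has norm at most [eps], so more than [d / 2] remains inside. *)
have : ~ nle (mixed_of t) (capacity t S) (on_block (b := b) n w) (d / 2).
  move=> h; have : rnorm (x n) <= d / 2 + eps * 4^-1 ^+ n.
    apply/rnorm_leP; apply: tleD h (xoff n) => [i||i].
    - by rewrite /on_block; case: ifP.
    - exact: off0.
    rewrite absv_ge0 /on_block /w /off_block blockE.
    by case: eqP => [->|]; rewrite ?addr0 ?add0r lexx.
  apply/negP; rewrite -ltNge; apply: le_lt_trans (xd n).
  have : eps * 4^-1 ^+ n <= eps.
    by rewrite ler_piMr// exprn_ile1// ?invr_ge0// invf_le1// ler1n.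
  lra.
move=> /existsNP[C /not_implyP[hC /negP]]; rewrite -ltNge => /ltW dC.
by exists C.
Qed.

End estimates.

(** * Flat and peaked sequences *)

Section classification.
Context {R : realType} {k : scalar_kind}.
Local Notation K := (scalars R k).
Context (U : set_system nat) {UU : UltraFilter U} (Uoo : \oo `<=` U).

Definition null_norm {t} (x : nat -> sspace (k := k) t) : Prop :=
  forall e : R, 0 < e -> U [set n | rnorm (x n) <= e].

Definition null_sup {t} (x : nat -> sspace (k := k) t) : Prop :=
  forall e : R, 0 < e -> U [set n | forall i, modulus (coord (x n) i) <= e].

Definition coord_null {t} (x : nat -> sspace (k := k) t) : Prop :=
  forall i (e : R), 0 < e -> U [set n | modulus (coord (x n) i) <= e].

Definition block_type t (x : nat -> sspace (k := k) t) : ctype R :=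
  if `[< null_sup x >] then flat_type t else t.

(** On finite combinations, [y] is equivalent to the unit vectors of type [tau] with admissibility
    read off the points [m]. The quantifier over [c] replaces a norm on the coefficients. *)
Definition two_sided {E : normedModType K} (tau : ctype R) (m : nat -> nat)
    (y : nat -> E) : Prop :=
  exists C : R, 0 <= C /\ forall N (a : nat -> K) c,
    (tle tau (S \o m) (truncate N (absv a)) c ->
       rnorm (\sum_(0 <= n < N) a n *: y n) <= C * c) /\
    (rnorm (\sum_(0 <= n < N) a n *: y n) <= c ->
       tle tau (S \o m) (truncate N (absv a)) (C * c)).

(** For an ultrafilter, failure to tend to 0 means being bounded below on a set of U, so the
    alternative is settled before any subsequence is chosen. *)
Lemma not_null_norm {t} (x : nat -> sspace (k := k) t) : ~ null_norm x ->
  exists2 d : R, 0 < d & U [set n | d < rnorm (x n)].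
Proof.
move=> /existsNP[d /not_implyP[d0 nU]]; exists d => //.
have [//|] := in_ultra_setVsetC [set n | rnorm (x n) <= d] UU.
by apply: filterS => n /= /negP; rewrite -ltNge.
Qed.

Lemma not_null_sup {t} (x : nat -> sspace (k := k) t) : ~ null_sup x ->
  exists2 d : R, 0 < d & U [set n | exists i, d <= modulus (coord (x n) i)].
Proof.
move=> /existsNP[d /not_implyP[d0 nU]]; exists d => //.
have [//|] := in_ultra_setVsetC [set n | forall i, modulus (coord (x n) i) <= d] UU.
by apply: filterS => n /= /existsNP[i /negP]; rewrite -ltNge => /ltW; exists i.
Qed.

Lemma off_block_small {t} (x : nat -> sspace (k := k) t) M (e : R) : coord_null x -> 0 < e ->
  U [set l | \forall M' \near \oo, tle t S (off_block M M' (absv (coord (x l)))) e].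
Proof.
move=> x0 e0; have e20 : 0 < e / 2 by rewrite divr_gt0.
have eM : 0 < e / 2 / M.+1%:R by rewrite divr_gt0.
apply: filterS (filter_coords M _ (fun i => x0 i _ eM)) => l /= xl.
have [_ /(_ _ e20)[m xm]] := (seq_carrierP t (coord (x l))).1 (coord_carrier (x l)).
exists m => // M' /= mM'; rewrite [e]splitr.
have hd : tle t S (truncate M (absv (coord (x l)))) (e / 2).
  by apply: tle_truncate_l1; [exact: absv_ge0|exact: xl|exact: ltW].
have v0 := absv_ge0 (coord (x l)).
apply: tleD hd xm => i.
- by have /andP[] := truncate_ge0 M i v0.
- by have /andP[] := tail_from_ge0 m i v0.
rewrite /off_block /truncate /tail_from; case: (ltnP i M) => Mi /=.
  by rewrite v0 lerDl; case: ifP; rewrite ?v0 ?lexx.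
case: (ltnP i M') => iM' /=; first by rewrite lexx add0r; case: ifP; rewrite ?v0 ?lexx.
by rewrite (leq_trans mM' iM') v0 add0r lexx.
Qed.

(** Each requirement on the next index has the form: for U-many [l] and then for all large [M'].
    Finitely many of them can be met together, so one [phi] and one [m] serve the whole family. Null
    sequences get summable norms; to the others the flat or the peaked estimates apply, according to
    [null_sup]. *)
Lemma classification {I : finType} (ty : I -> ctype R)
    (x : forall i, nat -> sspace (k := k) (ty i)) (B : R) :
  (forall i n, rnorm (x i n) <= B) -> (forall i, coord_null (x i)) ->
  exists phi m b : nat -> nat, [/\ forall n, (phi n < phi n.+1)%N, block_index m b &
    forall i, [/\ forall n, tle (ty i) S
        (off_block (m n) (m n.+1) (absv (coord (x i (phi n))))) (4^-1 ^+ n),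
      null_norm (x i) -> forall n, rnorm (x i (phi n)) <= 4^-1 ^+ n &
      ~ null_norm (x i) -> two_sided (block_type (x i)) m (fun n => x i (phi n))]].
Proof.
move=> xB x0.
have /choice[d dP] i : exists d : R, [/\ 0 < d,
    ~ null_norm (x i) -> null_sup (x i) -> U [set n | d < rnorm (x i n)] &
    ~ null_sup (x i) -> U [set n | exists c, d <= modulus (coord (x i n) c)]].
  have [ns|ns] := pselect (null_sup (x i)).
    have [nn|nn] := pselect (null_norm (x i)); first by exists 1.
    by have [d d0 Ud] := not_null_norm nn; exists d.
  by have [d d0 Ud] := not_null_sup ns; exists d.
(* [d i / 16] is what the lower estimates can absorb; the minimum with 1 gives the plain bound
   [4^-n] of the statement. *)
pose eps i := Num.min 1 (d i / 16).
have eps0 i : 0 < eps i.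
  by rewrite lt_min ltr01 divr_gt0//; have [] := dP i.
have epsd i : 16 * eps i <= d i.
  have : eps i <= d i / 16 by rewrite ge_min lexx orbT.
  by rewrite ler_pdivlMr// mulrC.
have q0 n : 0 < 4^-1 ^+ n :> R by rewrite exprn_gt0// invr_gt0.
pose cond n M l M' i := [/\ tle (ty i) S (off_block M M' (absv (coord (x i l)))) (eps i * 4^-1 ^+ n),
  null_norm (x i) -> rnorm (x i l) <= 4^-1 ^+ n,
  ~ null_norm (x i) -> null_sup (x i) ->
    (forall c, modulus (coord (x i l) c) * M.+1%:R <= 4^-1 ^+ n) /\ d i < rnorm (x i l) &
  ~ null_sup (x i) -> exists c, d i <= modulus (coord (x i l) c)].
pose P n M l M' := forall i, cond n M l M' i.
have UP n M : U [set l | \forall M' \near \oo, P n M l M'].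
  have H i : U [set l | \forall M' \near \oo, cond n M l M' i].
    have U1 := @off_block_small _ (x i) M (eps i * 4^-1 ^+ n) (x0 i) (mulr_gt0 (eps0 i) (q0 n)).
    have U2 : U [set l | null_norm (x i) -> rnorm (x i l) <= 4^-1 ^+ n].
      have [nn|nn] := pselect (null_norm (x i)); last by apply: filterS filterT => l _ /nn.
      by apply: filterS (nn _ (q0 n)) => l h _.
    have [d0 dn ds] := dP i.
    have U3 : U [set l | ~ null_norm (x i) -> null_sup (x i) ->
        (forall c, modulus (coord (x i l) c) * M.+1%:R <= 4^-1 ^+ n) /\ d i < rnorm (x i l)].
      have [nn|nn] := pselect (null_norm (x i)); first by apply: filterS filterT => l _ /(_ nn).
      have [ns|ns] := pselect (null_sup (x i)); last by apply: filterS filterT => l _ _ /ns.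
      have qM : 0 < 4^-1 ^+ n / M.+1%:R :> R by rewrite divr_gt0.
      apply: filterS (filterI (ns _ qM) (dn nn ns)) => l [h1 h2] _ _; split=> // c.
      by rewrite -ler_pdivlMr.
    have U4 : U [set l | ~ null_sup (x i) -> exists c, d i <= modulus (coord (x i l) c)].
      have [ns|ns] := pselect (null_sup (x i)); first by apply: filterS filterT => l _ /(_ ns).
      by apply: filterS (ds ns) => l h _.
    apply: filterS (filterI (filterI U1 U2) (filterI U3 U4)) => l [[h1 h2] [h3 h4]].
    by apply: filterS h1 => M' h1; split.
  have HU : \forall l \near U, forall i, \forall M' \near \oo, cond n M l M' i.
    exact: filter_forall.
  by apply: filterS HU => l Hl; exact: filter_forall.
have [phi [m [m0 phiS mS PP]]] := block_selection _ Uoo UP.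
have [b bm] := block_index_exists m0 mS.
exists phi, m, b; split=> // i.
have [d0 _ _] := dP i.
have xoff n : tle (ty i) S (off_block (m n) (m n.+1) (absv (coord (x i (phi n))))) (eps i * 4^-1 ^+ n).
  by have [] := PP n i.
have e0 := ltW (eps0 i).
split=> [n|nn n|nn]; first 1 last.
- by have [_ /(_ nn)] := PP n i.
- rewrite /block_type; case: asboolP => ns.
    exists (B + 2 + 2 * eps i + 4 / d i); split.
      have : 0 <= B by apply: le_trans (rnorm_ge0 _) (xB i 0%N).
      have : 0 <= 4 / d i by rewrite divr_ge0// ltW.
      lra.
    have B0 : 0 <= B by apply: le_trans (rnorm_ge0 _) (xB i 0%N).
    have d40 : 0 <= 4 / d i by rewrite divr_ge0// ltW.
    move=> N a c; split=> h.
      have c0 := nle_ge0 h.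
      apply: (@le_trans _ _ ((B + 2 + 2 * eps i) * c)); last by rewrite ler_wpM2r// lerDl.
      apply: (@flat_sum_upper _ _ _ _ _ bm (fun n => x i (phi n)) B (eps i) e0) => //.
      by move=> n c'; have [_ _ /(_ nn ns)[]] := PP n i.
    have c0 : 0 <= c by apply: le_trans h; exact: rnorm_ge0.
    apply: (@nle_weaken _ _ _ _ (4 / d i * c)).
      by rewrite ler_wpM2r// lerDr; lra.
    apply: (@flat_sum_lower _ _ _ _ _ bm (fun n => x i (phi n)) (eps i) e0) => //.
    by move=> n; have [_ _ /(_ nn ns)[]] := PP n i.
  exists (2 * B + 2 * eps i + 4 / d i); split.
    have : 0 <= B by apply: le_trans (rnorm_ge0 _) (xB i 0%N).
    have : 0 <= 4 / d i by rewrite divr_ge0// ltW.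
    lra.
  have B0 : 0 <= B by apply: le_trans (rnorm_ge0 _) (xB i 0%N).
  have d40 : 0 <= 4 / d i by rewrite divr_ge0// ltW.
  move=> N a c; split=> h.
    have c0 := nle_ge0 h.
    apply: (@le_trans _ _ ((2 * B + 2 * eps i) * c)); last by rewrite ler_wpM2r// lerDl.
    exact: (@peak_sum_upper _ _ _ _ _ bm (fun n => x i (phi n)) B (eps i) e0).
  have c0 : 0 <= c by apply: le_trans h; exact: rnorm_ge0.
  apply: (@nle_weaken _ _ _ _ (4 / d i * c)).
    by rewrite ler_wpM2r// lerDr; lra.
  apply: (@peak_sum_lower _ _ _ _ _ bm (fun n => x i (phi n)) (eps i) e0) => //.
  by move=> n; have [_ _ _ /(_ ns)] := PP n i.
apply: nle_weaken (xoff n); apply: ler_piMl; first exact: ltW.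
by rewrite ge_min lexx.
Qed.

End classification.

(** * Compositions of strictly singular operators *)

Lemma ultra_fmap {T V : Type} (f : T -> V) (F : set_system T) :
  UltraFilter F -> UltraFilter (f @ F).
Proof.
move=> FU; split; first exact: fmap_proper_filter.
move=> G GF FG; apply/seteqP; split=> A; last exact: FG.
have [//|FN GA] := in_ultra_setVsetC (f @^-1` A) FU.
have GN : G (~` A) by apply: FG.
by have [z []] := filter_ex (filterI GA GN).
Qed.

Lemma free_ultrafilter : exists2 U : set_system nat, UltraFilter U & \oo `<=` U.
Proof.
by have [U [UU Uoo]] := @ultraFilterLemma nat \oo eventually_filter; exists U.
Qed.

Lemma seq_max {T : eqType} (r : T -> T -> Prop) (s : seq T) :
  (forall x, r x x) -> (forall x y z, r x y -> r y z -> r x z) ->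
  (forall x y, r x y \/ r y x) -> s != [::] ->
  exists2 x, x \in s & {in s, forall y, r x y}.
Proof.
move=> rr rt tot; elim: s => // x s IH _; have [->|/IH[y ys ymax]] := eqVneq s [::].
  by exists x; rewrite ?mem_head// => z; rewrite inE => /eqP ->.
have [xy|yx] := tot x y.
  exists x; rewrite ?mem_head// => z; rewrite inE => /orP[/eqP ->//|/ymax].
  exact: rt.
by exists y; rewrite ?inE ?ys ?orbT// => z; rewrite inE => /orP[/eqP ->|/ymax].
Qed.

Section spans.
Context {R : realType} {k : scalar_kind}.
Local Notation K := (scalars R k).
Implicit Types E F : normedModType K.

Definition linear_span {E} (y : nat -> E) : {pred E} :=
  [pred z | `[< exists N (a : nat -> K), z = \sum_(0 <= n < N) a n *: y n >]].

Lemma linear_spanP {E} (y : nat -> E) z :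
  reflect (exists N (a : nat -> K), z = \sum_(0 <= n < N) a n *: y n) (z \in linear_span y).
Proof. exact: asboolP. Qed.

Lemma sum_extend {E} (y : nat -> E) N N' (a : nat -> K) : (N <= N')%N ->
  \sum_(0 <= n < N) a n *: y n = \sum_(0 <= n < N') truncate N a n *: y n.
Proof.
move=> NN'; rewrite [RHS](@big_cat_nat _ _ _ N)//= [X in _ = _ + X]big_nat_cond.
rewrite [X in _ = _ + X]big1 ?addr0; last first.
  by move=> n /andP[/andP[Nn _] _]; rewrite /truncate ltnNge Nn scale0r.
rewrite big_nat_cond [RHS]big_nat_cond; apply: eq_bigr => n /andP[/andP[_ nN] _].
by rewrite /truncate nN.
Qed.

Lemma linear_span_submod {E} (y : nat -> E) : submod_closed (linear_span y).
Proof.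
split; first by apply/linear_spanP; exists 0%N, (fun=> 0); rewrite big_nil.
move=> c _ _ /linear_spanP[N [a ->]] /linear_spanP[N' [a' ->]]; apply/linear_spanP.
exists (maxn N N'), (fun n => c * truncate N a n + truncate N' a' n).
rewrite (sum_extend _ _ (leq_maxl N N')) (sum_extend _ _ (leq_maxr N N')).
rewrite scaler_sumr -big_split; apply: eq_bigr => n _.
by rewrite scalerDl scalerA.
Qed.

Lemma two_sided_infinite {E} tau (m : nat -> nat) (y : nat -> E) :
  two_sided tau m y -> infinite_dimensional (linear_span y).
Proof.
move=> [C [C0 yC]]; apply: independent_infinite => N.
exists (fun i : 'I_N => y i); split=> [i|a].
  apply/linear_spanP; exists i.+1, (fun n => (n == val i)%:R).
  rewrite big_nat_recr//= eqxx scale1r big_nat_cond big1 ?add0r//.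
  by move=> n /andP[/andP[_ ni] _]; rewrite lt_eqF// scale0r.
pose a' n := if insub n is Some i then a i else 0 : K.
have a'E (i : 'I_N) : a' i = a i by rewrite /a' valK.
move=> ay i; apply: modulus0_eq0; apply/eqP; rewrite eq_le modulus_ge0 andbT.
have : rnorm (\sum_(0 <= n < N) a' n *: y n) <= 0.
  rewrite big_mkord; under eq_bigr do rewrite a'E.
  by rewrite ay rnorm0.
move=> /(yC N a' 0).2; rewrite mulr0 => h.
have v0 : 0 <= truncate N (absv a') i by have /andP[] := truncate_ge0 N i (absv_ge0 a').
have := nle_coord _ v0 h; rewrite /truncate ltn_ord /absv a'E; apply.
exact: capacity_gt0.
Qed.

(** If [tau'] dominated [tau], the norm of a combination of [y] would be controlled by that of its
    image, and [T] would be bounded below on the span. [n <= m n] makes [S \o m] eligible as [h] in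
    [dom]. *)
Lemma two_sided_strictly_singular {E F} (T : {linear E -> F}) tau tau' m (y : nat -> E) :
  (forall n, n <= m n)%N -> strictly_singular T -> two_sided tau m y ->
  two_sided tau' m (fun n => T (y n)) -> ~ dom tau' tau.
Proof.
move=> mn /strictly_singularP[_ ssT] yt [C' [C'0 TyC]] [D [D0 dD]].
have [C [C0 yC]] := yt.
apply: (ssT (linear_span y)); [exact: linear_span_submod|exact: two_sided_infinite yt|].
have CD : 0 < C * (D * C') + 1 by rewrite ltr_wpDl// !mulr_ge0.
exists (C * (D * C') + 1)^-1; first by rewrite invr_gt0.
move=> _ /linear_spanP[N [a ->]]; rewrite ler_pdivrMl//.
have Ts : T (\sum_(0 <= n < N) a n *: y n) = \sum_(0 <= n < N) a n *: T (y n).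
  by rewrite linear_sum; apply: eq_bigr => n _; rewrite linearZ.
have v0 n : 0 <= truncate N (absv a) n by have /andP[] := truncate_ge0 N n (absv_ge0 a).
have mn' n : (n < (S \o m) n)%N by rewrite /= ltnS.
have h1 := (TyC N a _).2 (lexx _).
have h2 := dD _ _ _ mn' v0 h1; have h3 := (yC N a _).1 h2.
apply: le_trans h3 _; rewrite -Ts !mulrA mulrDl mul1r lerDl.
exact: rnorm_ge0.
Qed.

End spans.

(** * Finite sums of the sequence spaces *)

Section decomposition.
Context {R : realType} {k : scalar_kind}.
Local Notation K := (scalars R k).
Context {Y : normedModType K} {I : finType} {ty : I -> ctype R}.
Context (pr : forall i, {linear Y -> sspace (k := k) (ty i)}).

(** An isomorphism of Y with the direct sum of the spaces of types [ty], expressed through its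
    component maps only. *)
Definition decomposition : Prop := [/\ forall i, bounded_op (pr i),
  exists2 C : R, 0 <= C & forall y, rnorm y <= C * \sum_i rnorm (pr i y)
  & forall x : (forall i, sspace (k := k) (ty i)), exists y, forall i, pr i y = x i].

Hypothesis prY : decomposition.

Lemma decomposition_ultra_complete : ultra_complete Y.
Proof.
have [prB [C C0 CY] prS] := prY.
move=> F FU Fc.
have pE i : exists p : sspace (ty i), forall e : R, 0 < e ->
    (pr i @ F) [set z | rnorm (z - p) < e].
  apply: sspace_ultra_complete; first exact: ultra_fmap.
  move=> e e0; have /bounded_opP[M M0 prM] := prB i.
  have M10 : 0 < M + 1 by rewrite ltr_wpDl.
  have [y Fy] := Fc _ (divr_gt0 e0 M10); exists (pr i y).
  suff sub : [set z | rnorm (z - y) < e / (M + 1)] `<=`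
      pr i @^-1` [set z | rnorm (z - pr i y) < e] by exact: filterS sub Fy.
  move=> z /= zy.
  have -> : pr i z - pr i y = pr i (z - y) by rewrite linearB.
  apply: le_lt_trans (prM _) _; apply: (@le_lt_trans _ _ ((M + 1) * rnorm (z - y))).
    by rewrite ler_wpM2r ?rnorm_ge0// lerDl.
  by rewrite mulrC -ltr_pdivlMr.
pose p i := projT1 (cid (pE i)); have pP i := projT2 (cid (pE i)).
have [y yp] := prS p; exists y => e e0.
pose D := C * #|I|%:R + 1; have D0 : 0 < D by rewrite ltr_wpDl// mulr_ge0.
have eD := divr_gt0 e0 D0.
have Fi : \forall z \near F, forall i, rnorm (pr i z - p i) < e / D.
  by apply: filter_forall => i; exact: pP.
apply: filterS Fi => z zp /=; apply: le_lt_trans (CY _) _.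
apply: (@le_lt_trans _ _ (C * \sum_(i : I) (e / D))).
  by apply: ler_wpM2l => //; apply: ler_sum => i _; rewrite linearB yp ltW.
rewrite sumr_const -[(e / D) *+ _]mulr_natl mulrA mulrCA -{2}[e]mulr1 ltr_pM2l//.
by rewrite ltr_pdivrMr// mul1r ltrDl.
Qed.

(** In a finite sum the strongest type decides. A component that is not null is dominated by
    [theta], and a null one adds at most twice the largest coefficient, by summability. The lower
    estimate comes from the component [i0] alone. *)
Lemma decomposition_two_sided (tau : I -> ctype R) theta m (y : nat -> Y) (null : I -> Prop) i0 :
  (forall n, n <= m n)%N ->
  (forall i, null i -> forall n, rnorm (pr i (y n)) <= 4^-1 ^+ n) ->
  (forall i, ~ null i -> two_sided (tau i) m (fun n => pr i (y n))) ->
  ~ null i0 -> theta = tau i0 -> (forall i, ~ null i -> dom theta (tau i)) ->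
  two_sided theta m y.
Proof.
move=> mn nullP twoP ni0 -> thetaM.
have [prB [C C0 CY] _] := prY.
have prsum i N a : pr i (\sum_(0 <= n < N) a n *: y n) = \sum_(0 <= n < N) a n *: pr i (y n).
  by rewrite linear_sum; apply: eq_bigr => n _; rewrite linearZ.
have mn' n : (n < (S \o m) n)%N by rewrite /= ltnS.
have v0 N (a : nat -> K) n : 0 <= truncate N (absv a) n.
  by have /andP[] := truncate_ge0 N n (absv_ge0 a).
have /choice[D DP] i : exists D : R, 0 <= D /\ forall N a c,
    tle (tau i0) (S \o m) (truncate N (absv a)) c ->
    rnorm (pr i (\sum_(0 <= n < N) a n *: y n)) <= D * c.
  have [ni|ni] := pselect (null i).
    exists 2; split=> // N a c h; rewrite prsum.
    apply: le_trans (rnorm_sum _ _) _.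
    have c0 := nle_ge0 h.
    apply: (@le_trans _ _ (\sum_(0 <= n < N) c * 4^-1 ^+ n)).
      rewrite big_nat_cond [leRHS]big_nat_cond; apply: ler_sum => n /andP[/andP[_ nN] _].
      rewrite rnormZ ler_pM ?modulus_ge0 ?rnorm_ge0// ?nullP//.
      have := nle_coord _ (v0 N a n) h; rewrite /truncate nN; apply.
      exact: capacity_gt0.
    rewrite -mulr_sumr mulrC ler_wpM2r//; apply: geometric_sum_le; first by rewrite invr_ge0.
    by rewrite div1r lef_pV2 ?posrE// ler_nat.
  have [D [D0 DP]] := twoP i ni; have [D' [D'0 D'P]] := thetaM i ni.
  exists (D * D'); split; first exact: mulr_ge0.
  move=> N a c h; rewrite prsum -mulrA; apply: (DP N a _).1.
  exact: D'P _ _ _ mn' (v0 N a) h.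
have [D' [D'0 D'P]] := twoP i0 ni0.
have /bounded_opP[M M0 prM] := prB i0.
have D0 i : 0 <= D i by have [] := DP i.
have CD0 : 0 <= C * \sum_i D i by rewrite mulr_ge0// sumr_ge0.
exists (C * (\sum_i D i) + D' * M); split; first by rewrite addr_ge0// mulr_ge0.
move=> N a c; split=> h.
  have c0 := nle_ge0 h; apply: le_trans (CY _) _.
  apply: (@le_trans _ _ (C * (\sum_i D i) * c)); last first.
    by rewrite ler_wpM2r// lerDl mulr_ge0.
  rewrite -mulrA mulr_suml ler_wpM2l//; apply: ler_sum => i _.
  by have [_] := DP i; apply.
have c0 : 0 <= c by apply: le_trans h; exact: rnorm_ge0.
apply: (@nle_weaken _ _ _ _ (D' * (M * c))).
  by rewrite mulrA ler_wpM2r// lerDr.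
apply: (D'P N a _).2; rewrite -prsum; apply: le_trans (prM _) _.
by rewrite ler_wpM2l.
Qed.

End decomposition.

Section compose_theory.
Context {R : realType} {k : scalar_kind}.
Local Notation K := (scalars R k).
Context {E : normedModType K}.
Implicit Types Ts : seq {linear E -> E}.

Definition nth_op Ts i : {linear E -> E} := nth (idfun : {linear E -> E}) Ts i.

Lemma compose_cat Ts Ts' x : compose (Ts ++ Ts') x = compose Ts (compose Ts' x).
Proof. by elim: Ts => //= T Ts ->. Qed.

Lemma bounded_compose Ts : (forall i, (i < size Ts)%N -> bounded_op (nth_op Ts i)) ->
  bounded_op (compose Ts).
Proof.
elim: Ts => [|T Ts IH] bT; first exact: bounded_op_id.
apply: bounded_op_comp; first exact: (bT 0%N).
by apply: IH => i iT; exact: (bT i.+1).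
Qed.

End compose_theory.

Section upper_bound.
Context {R : realType} {k : scalar_kind}.
Local Notation K := (scalars R k).
Context {Y : normedModType K} {I : finType} {ty : I -> ctype R}.
Context (pr : forall i, {linear Y -> sspace (k := k) (ty i)}).
Hypothesis prY : decomposition pr.

(* Differences of a subsequence that converges coordinatewise: no coordinate
   limit has to belong to the space. *)
Lemma null_differences {J : finType} (T : J -> {linear Y -> Y}) (u : nat -> Y) :
  (forall j, bounded_op (T j)) -> (forall n, rnorm (u n) <= 1) ->
  exists2 psi : nat -> nat, forall n, (psi n < psi n.+1)%N &
  forall j i c (e : R), 0 < e -> \forall n \near \oo,
    modulus (coord (pr i (T j (u (psi n.+1) - u (psi n)))) c) <= e.
Proof.
move=> bT u1; have [U UU Uoo] := free_ultrafilter.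
have [prB _ _] := prY.
pose f (q : J * I * nat) n := coord (pr q.1.2 (T q.1.1 (u n))) q.2.
have /choice[l lP] q : exists l, forall e : R, 0 < e -> U [set n | modulus (f q n - l) < e].
  have /bounded_opP[M M0 prM] := bounded_op_comp (prB q.1.2) (bT q.1.1).
  apply: (@ultra_limit _ _ _ U (f q) M).
  apply: filterS filterT => n _ /=; apply: le_trans (coord_le _ _) _.
  apply: le_trans (prM _) _; rewrite -[leRHS]mulr1 ler_wpM2l//.
(* Stage n controls the first n coordinates, up to 1/(n + 1), for all pairs of the finite type
   [J * I]. *)
pose P n (M0 : nat) l' (M' : nat) := forall q : J * I, forall c, (c < n)%N ->
  modulus (f (q, c) l' - l (q, c)) < n.+1%:R^-1.
have [|psi [mm [_ psiS _ psiP]]] := @block_selection U P _ Uoo.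
  move=> n M; have n0 : 0 < n.+1%:R^-1 :> R by rewrite invr_gt0.
  have Uq : \forall l' \near U, forall q : J * I, forall c, (c < n)%N ->
      modulus (f (q, c) l' - l (q, c)) < n.+1%:R^-1.
    apply: filter_forall => q; apply: (@filter_coords _ U) => c.
    exact: lP.
  by apply: filterS Uq => l' h; apply: nearW.
exists psi => // j i c e e0.
have e20 : 0 < e / 2 by rewrite divr_gt0.
have [N0 N0e] : exists N0 : nat, N0.+1%:R^-1 < e / 2.
  exists (Num.truncn (e / 2)^-1).
  by rewrite -[ltRHS]invrK ltf_pV2 ?posrE ?invr_gt0// truncnS_gt.
exists (maxn N0 c.+1) => // n /=; rewrite geq_max => /andP[Nn cn].
have dist n' : (n <= n')%N -> modulus (f (j, i, c) (psi n') - l (j, i, c)) < e / 2.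
  move=> nn'; apply: lt_trans (psiP n' (j, i) c (leq_trans cn nn')) _.
  apply: le_lt_trans N0e; rewrite lef_pV2 ?posrE// ler_nat ltnS.
  exact: leq_trans Nn nn'.
have E : coord (pr i (T j (u (psi n.+1) - u (psi n)))) c =
    f (j, i, c) (psi n.+1) - f (j, i, c) (psi n).
  by rewrite linearB linearB coordB.
have -> : coord (pr i (T j (u (psi n.+1) - u (psi n)))) c =
    (f (j, i, c) (psi n.+1) - l (j, i, c)) - (f (j, i, c) (psi n) - l (j, i, c)).
  by rewrite E opprB addrA subrK.
apply: le_trans (modulusD _ _) _; rewrite modulusN [leRHS]splitr.
by apply: lerD; apply/ltW/dist.
Qed.

Lemma compose_compact (Theta : seq (ctype R)) (Ts : seq {linear Y -> Y}) :
  (forall i, ty i \in Theta /\ flat_type (ty i) \in Theta) ->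
  (forall j, (j < size Ts)%N -> strictly_singular (nth_op Ts j)) ->
  (size Theta <= size Ts)%N -> compact_op (compose Ts).
Proof.
move=> tyT ssT szT; have cY := decomposition_ultra_complete prY.
have bT j : (j < size Ts)%N -> bounded_op (nth_op Ts j) by move=> /ssT[].
apply/compact_opP => //; split; first exact: bounded_compose.
apply: contrapT => /op_netsE/separated_sequence[e [u' [e0 u'P u'e]]].
have /choice[u uP] n : exists x, rnorm x <= 1 /\ compose Ts x = u' n.
  by have [x x1 <-] := u'P n; exists x; split=> //; rewrite -unit_ball_rnorm.
have u1 n : rnorm (u n) <= 1 by have [] := uP n.
(* The operators are applied from the end of the list: the last [st] is the identity and [st 0] is
   the whole composition. *)
pose st (j : 'I_(size Ts).+1) : {linear Y -> Y} := compose (drop j Ts).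
have bdrop j : bounded_op (compose (drop j Ts)).
  apply: bounded_compose => i; rewrite size_drop ltn_subRL => ij.
  by rewrite /nth_op nth_drop; exact: bT.
have bst j : bounded_op (st j) by exact: bdrop.
have [psi psiS psi0] := null_differences bst u1.
pose d n := u (psi n.+1) - u (psi n).
have d2 n : rnorm (d n) <= 2.
  by apply: le_trans (rnormB _ _) _; apply: (le_trans (lerD (u1 _) (u1 _))); lra.
have de n : e <= rnorm (compose Ts (d n)).
  by rewrite linearB; have [_ ->] := uP (psi n.+1); have [_ ->] := uP (psi n); exact: u'e.
have [U UU Uoo] := free_ultrafilter.
have [prB [C C0 CY] prS] := prY.
pose x (q : I * 'I_(size Ts).+1) n : sspace (ty q.1) := pr q.1 (st q.2 (d n)).
have [B xB] : exists B : R, forall q n, rnorm (x q n) <= B.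
  have /choice[M MP] q : exists M : R, 0 <= M /\ forall n, rnorm (x q n) <= M.
    have /bounded_opP[M M0 prM] := bounded_op_comp (prB q.1) (bst q.2).
    exists (M * 2); split; first exact: mulr_ge0.
    by move=> n; apply: le_trans (prM _) _; rewrite ler_wpM2l.
  exists (\sum_q M q) => q n; have [_ /(_ n) h] := MP q; apply: le_trans h _.
  by rewrite (bigD1 q)//= lerDl sumr_ge0// => q' _; have [] := MP q'.
have x0 q : coord_null U (x q).
  by move=> c e' e'0; apply: Uoo; exact: psi0.
have [phi [m [b [phiS bm xP]]]] := classification Uoo xB x0.
have mn n := block_start_ge bm n.
(* If all components of stage j were null, the remaining operators, being bounded, would send the
   sequence to 0, against the separation by [e]. *)
have nonnull j : exists i, ~ null_norm U (x (i, j)).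
  apply: contrapT => /forallNP allnull.
  pose A := compose (take j Ts).
  have /bounded_opP[M M0 AM] : bounded_op A.
    apply: bounded_compose => i; rewrite size_take_min leq_min => /andP[ij iT].
    by rewrite /nth_op nth_take//; exact: bT.
  have AE z : A (st j z) = compose Ts z by rewrite -compose_cat cat_take_drop.
  have small n : e <= M * (C * #|I|%:R) * 4^-1 ^+ n.
    apply: le_trans (de (phi n)) _; rewrite -AE; apply: le_trans (AM _) _.
    rewrite -mulrA ler_wpM2l//; apply: le_trans (CY _) _.
    rewrite -mulrA ler_wpM2l//.
    apply: (@le_trans _ _ (\sum_(i : I) (4^-1 ^+ n : R))).
      apply: ler_sum => i _; have [_ nullP _] := xP (i, j).
      by apply: nullP; apply: contrapT; exact: allnull.
    by rewrite sumr_const mulr_natl.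
  have D0 : 0 <= M * (C * #|I|%:R) by rewrite !mulr_ge0.
  set D := M * _ in small D0.
  have : forall n, n.+1%:R * e <= D.
    move=> n; apply: (@le_trans _ _ (4 ^+ n * e)).
      rewrite ler_wpM2r ?(ltW e0)//; have -> : 4 ^+ n = (4 ^ n)%:R :> R by rewrite natrX.
      by rewrite ler_nat; exact: ltn_expl.
    by rewrite mulrC -ler_pdivlMr ?exprn_gt0// -exprVn.
  move=> /(_ (Num.truncn (D / e))); apply/negP; rewrite -ltNge.
  by rewrite -ltr_pdivrMr// truncnS_gt.
pose tau (i : I) (j : 'I_(size Ts).+1) : ctype R := block_type U (x (i, j)).
have /choice[i0 i0P] j : exists i0, ~ null_norm U (x (i0, j)) /\
    forall i, ~ null_norm U (x (i, j)) -> dom (tau i0 j) (tau i j).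
  have [i1 ni1] := nonnull j.
  pose s := [seq i <- enum I | `[< ~ null_norm U (x (i, j)) >]].
  have sP i : reflect (~ null_norm U (x (i, j))) (i \in s).
    by rewrite mem_filter mem_enum andbT; exact: asboolP.
  have s0 : s != [::] by apply/eqP => s0; have /sP := ni1; rewrite s0.
  have [|||i0 /sP i0s i0m] := @seq_max _ (fun i i' => dom (tau i j) (tau i' j)) s _ _ _ s0.
  - by move=> i; exact: dom_refl.
  - by move=> i i' i''; exact: dom_trans.
  - by move=> i i'; exact: dom_total.
  by exists i0; split=> // i /sP; exact: i0m.
pose theta j := tau (i0 j) j.
have thetaP j : two_sided (theta j) m (fun n => st j (d (phi n))).
  have [ni im] := i0P j.
  apply: (decomposition_two_sided prY (tau := fun i => tau i j)
    (null := fun i => null_norm U (x (i, j))) mn _ _ ni (erefl _) im).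
    by move=> i nn n; have [_ h _] := xP (i, j); exact: h.
  by move=> i nn; have [_ _ h] := xP (i, j); exact: h.
(* Operator j leads from stage j + 1 to stage j. Strict singularity rules out one domination, and
   totality then supplies the other, so the types form a strict chain. *)
have step j (jT : (j < size Ts)%N) :
    ~ dom (theta (inord j)) (theta (inord j.+1)) /\
    dom (theta (inord j.+1)) (theta (inord j)).
  have nd : ~ dom (theta (inord j)) (theta (inord j.+1)).
    apply: (two_sided_strictly_singular mn (ssT j jT) (thetaP (inord j.+1))).
    have := thetaP (inord j); rewrite /st !inordK ?ltnS// ?(ltnW jT)//.
    by rewrite (drop_nth (idfun : {linear Y -> Y}) jT).
  by split=> //; have [|] := dom_total (theta (inord j)) (theta (inord j.+1)).
have desc j l : (j + l <= size Ts)%N -> dom (theta (inord (j + l))) (theta (inord j)).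
  elim: l => [|l IH] jl; first by rewrite addn0; exact: dom_refl.
  rewrite addnS in jl *; apply: dom_trans (IH (ltnW jl)).
  by have [] := step (j + l)%N jl.
have thetaI (j j' : 'I_(size Ts).+1) : (j < j')%N -> theta j <> theta j'.
  move=> jj' E; have jT : (j < size Ts)%N by apply: leq_trans jj' _; rewrite -ltnS.
  have [nd _] := step j jT; apply: nd; rewrite inord_val E.
  have := desc j.+1 (j' - j.+1)%N; rewrite subnKC// inord_val; apply.
  by rewrite -ltnS.
have thetaU : uniq [seq theta j | j <- enum 'I_(size Ts).+1].
  rewrite map_inj_uniq ?enum_uniq// => j j' E; apply/val_inj.
  by have [h|h|//] := ltngtP j j'; [have := thetaI _ _ h E|have := thetaI _ _ h (esym E)].
have thetaT : {subset [seq theta j | j <- enum 'I_(size Ts).+1] <= Theta}.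
  (* The type of a stage is [ty] or [flat_type] of one component. There are [size Ts + 1] stages,
     one more than Theta can accommodate. *)
  move=> _ /mapP[j _ ->]; rewrite /theta /tau /block_type.
  by have [t1 t2] := tyT (i0 j); case: asboolP.
have := uniq_leq_size thetaU thetaT.
by rewrite size_map size_enum_ord ltnNge szT.
Qed.

End upper_bound.

(** * Formal inclusions *)

Section inclusions.
Context {R : realType} {k : scalar_kind}.
Local Notation K := (scalars R k).
Implicit Types (E F : normedModType K) (t : ctype R).

Lemma linear_exists {E F} (f : E -> F) :
  (forall a x y, f (a *: x + y) = a *: f x + f y) ->
  exists T : {linear E -> F}, T =1 f.
Proof.
move=> fL; pose fM := GRing.isLinear.Build K E F *:%R f fL.
by exists (HB.pack f fM : {linear E -> F}).
Qed.

Lemma dom_carrier t t' x : dom t t' ->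
  seq_carrier (space (k := k) t) x -> seq_carrier (space t') x.
Proof.
move=> [C [C0 CP]] /seq_carrierP[[c xc] xt]; apply/seq_carrierP; split.
  by exists (C * c); apply: CP xc => // n; exact: absv_ge0.
move=> e e0; have C10 : 0 < C + 1 by rewrite ltr_wpDl.
have [m xm] := xt _ (divr_gt0 e0 C10); exists m.
have t0 n : 0 <= tail_from m (absv x) n by have /andP[] := tail_from_ge0 m n (absv_ge0 x).
apply: nle_weaken (CP S _ _ ltnSn t0 xm).
by rewrite mulrCA ler_piMr ?(ltW e0)// ler_pdivrMr// mul1r lerDl.
Qed.

Lemma inclusion_exists t t' : dom t t' -> exists J : {linear sspace (k := k) t -> sspace t'},
  bounded_op J /\ forall x, coord (J x) =1 coord x.
Proof.
move=> tt'; pose f (x : sspace (k := k) t) : sspace t' := mk_sspace (dom_carrier tt' (coord_carrier x)).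
have [|J JE] := @linear_exists _ _ f; first by move=> a x y; apply: coord_inj.
exists J; split=> [|x i]; last by rewrite JE.
have [C [C0 CP]] := tt'; apply/bounded_opP; exists C => // x.
rewrite JE; apply/rnorm_leP; apply: CP (tle_rnorm x) => // n; exact: absv_ge0.
Qed.

Lemma normalized_vector {E} (W : {pred E}) x : submod_closed W -> x \in W -> x != 0 ->
  exists2 y, y \in W & exists2 c : K, modulus c = (rnorm x)^-1 & y = c *: x /\ rnorm y = 1.
Proof.
move=> sW xW x0; have nx : 0 < rnorm x.
  rewrite lt_neqAle rnorm_ge0 andbT eq_sym; apply: contra_neq x0; exact: rnorm0_eq0.
have c0 : 0 <= (rnorm x)^-1 by rewrite invr_ge0 ltW.
exists (of_real k (rnorm x)^-1 *: x).
  by rewrite -[_ *: _]addr0; apply: sW.2 => //; exact: sW.1.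
exists (of_real k (rnorm x)^-1); first by rewrite modulus_of_real.
by split=> //; rewrite rnormZ modulus_of_real// mulVf// gt_eqF.
Qed.

Lemma null_sequence t (W : {pred sspace (k := k) t}) : submod_closed W ->
  infinite_dimensional W -> exists w : nat -> sspace (k := k) t, forall n,
    [/\ w n \in W, rnorm (w n) = 1 & forall i, (i < n)%N -> coord (w n) i = 0].
Proof.
move=> sW iW; suff /choice[w wP] : forall n, exists x : sspace (k := k) t,
    [/\ x \in W, rnorm x = 1 & forall i, (i < n)%N -> coord x i = 0] by exists w.
move=> n; have [|x [xW x0 xn]] := @common_kernel _ _ _ W n (fun j x => coord x j) sW iW.
  by move=> j a x y; exact: coordP.
have [y yW [c _ [yE y1]]] := normalized_vector sW xW x0.
exists y; split=> // i ni; rewrite yE coordZ.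
by have := xn (Ordinal ni) => /= ->; rewrite mulr0.
Qed.

Lemma modulus_sum {I : Type} (s : seq I) (f : I -> K) :
  modulus (\sum_(i <- s) f i) <= \sum_(i <- s) modulus (f i).
Proof.
elim: s => [|i s IH]; first by rewrite !big_nil modulus0.
by rewrite !big_cons; apply: le_trans (modulusD _ _) _; rewrite lerD2l.
Qed.

Lemma sum_indicator (i N : nat) : \sum_(0 <= n < N) ((i == n)%:R : R) = (i < N)%:R.
Proof.
elim: N => [|N IH]; first by rewrite big_nil.
rewrite big_nat_recr//= IH ltnS [(i <= N)%N]leq_eqVlt.
by have [->|] := eqVneq i N; rewrite ?ltnn ?add0r//= addr0.
Qed.

Lemma modulus_bool (c : bool) : modulus (c%:R : K) = c%:R :> R.
Proof.
have -> : (c%:R : K) = of_real k c%:R by case: c; case: k.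
by rewrite modulus_of_real// ler0n.
Qed.

Section flat_sequence.
Context (U : set_system nat) {UU : UltraFilter U} (Uoo : \oo `<=` U).

Lemma null_sup_coord_null t (x : nat -> sspace (k := k) t) : null_sup U x -> coord_null U x.
Proof. by move=> xs i e e0; apply: filterS (xs e e0) => n /(_ i). Qed.

Lemma null_norm_bounded_below t (x : nat -> sspace (k := k) t) (d : R) : 0 < d ->
  (forall n, d <= rnorm (x n)) -> ~ null_norm U x.
Proof.
move=> d0 xd /(_ _ (divr_gt0 d0 (ltr0Sn R 1)))/filter_ex[n /= xn].
by have := le_trans (xd n) xn; rewrite leNgt gtr_pMr// invf_lt1// ltr1n.
Qed.

(* Either the coordinates of a normalized coordinatewise null sequence tend to
   zero, or sums of N terms have norms tending to infinity while their
   coordinates stay bounded. *)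
Lemma flat_sequence t r (W : {pred sspace (k := k) t}) : dom t (TS r) ->
  submod_closed W -> infinite_dimensional W ->
  exists w : nat -> sspace (k := k) t,
    [/\ forall n, w n \in W, forall n, rnorm (w n) = 1 & null_sup U w].
Proof.
move=> [D [D0 DP]] sW iW; have [w wP] := null_sequence sW iW.
have w1 n : rnorm (w n) = 1 by have [] := wP n.
have wW n : w n \in W by have [] := wP n.
have [ws|ws] := pselect (null_sup U w); first by exists w.
have w0 : coord_null U w.
  move=> i e e0; apply: Uoo; exists i.+1 => // n /= ni.
  by have [_ _ ->] := wP n; rewrite // modulus0 ltW.
have nn : ~ null_norm U w by apply: (@null_norm_bounded_below _ _ 1) => // n; rewrite w1.
have [phi [m [b [_ bm yP]]]] := @classification _ _ U UU Uoo unit (fun=> t) (fun=> w) 1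
  (fun _ n => eq_ind_r (fun c => c <= 1) (lexx 1) (w1 n)) (fun=> w0).
have [yoff _ /(_ nn)[C [C0 CP]]] := yP tt; rewrite {yP}.
have {}CP N a c : rnorm (\sum_(0 <= n < N) a n *: w (phi n)) <= c ->
    tle t (S \o m) (truncate N (absv a)) (C * c).
  by have [_] := CP N a c; rewrite /block_type; case: asboolP.
(* Sums of N consecutive terms starting at index N, whose index set is admissible. *)
pose y N := \sum_(0 <= n < N + N) ((N <= n)%N%:R : K) *: w (phi n).
have yW N : y N \in W.
  rewrite /y big_mkord; apply: (@submod_sum _ _ _ _ _ (fun n : 'I_(N + N) => (N <= n)%N%:R)) => //.
have ylarge N : N%:R `^ (val r)^-1 <= D * C * rnorm (y N).
  have h := CP (N + N)%N (fun n => (N <= n)%N%:R) _ (lexx _).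
  set v := truncate _ _ in h.
  have v0 n : 0 <= v n by have /andP[] := truncate_ge0 (N + N) n (absv_ge0 (fun n => (N <= n)%N%:R : K)).
  have mn n : (n < (S \o m) n)%N by rewrite /= ltnS (block_start_ge bm).
  have hS := (tle_SP _ _ _ v0).1 (DP _ _ _ mn v0 h) [fset n in iota N N]%fset.
  rewrite -mulrA; apply: le_trans (hS _).
    rewrite -[X in X%:R](size_iota N N) -(@finite_lp_ones _ (val r) (iota N N) v (valP r)).
      by apply: finite_lp_sub; rewrite ?iota_uniq ?(valP r)// => i; rewrite inE.
    move=> i; rewrite mem_iota => /andP[Ni iN].
    by rewrite /v /truncate iN /absv modulus_bool Ni.
  move=> i; rewrite inE mem_iota => /andP[Ni _].
  apply: leq_trans (_ : N <= _)%N.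
    by rewrite card_fseq undup_id ?iota_uniq// size_iota.
  by apply: leq_trans Ni _; apply: leq_trans (block_start_ge bm i) _; exact: leqnSn.
(* At most one term has [i] in its own block, where it contributes at most 1; the off-block values
   of the others add up to at most 2. *)
have ysup N i : modulus (coord (y N) i) <= 3.
  rewrite coord_sum; apply: le_trans (modulus_sum _ _) _.
  apply: (@le_trans _ _ (\sum_(0 <= n < N + N) ((b i == n)%:R + 4^-1 ^+ n))).
    apply: ler_sum => n _; rewrite modulusM modulus_bool.
    apply: (@le_trans _ _ (modulus (coord (w (phi n)) i))).
      by rewrite ler_piMl ?modulus_ge0//; case: (N <= n)%N.
    have [bi|bi] := eqVneq (b i) n.
      by apply: le_trans (coord_le _ _) _; rewrite w1 lerDl exprn_ge0// invr_ge0.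
    rewrite add0r; have off0 : 0 <= off_block (m n) (m n.+1) (absv (coord (w (phi n)))) i.
      by rewrite /off_block; case: ifP => // _; exact: absv_ge0.
    have := nle_coord (capacity_gt0 t i (fun=> ltn0Sn _)) off0 (yoff n).
    rewrite {1}/off_block -(block_index_lt bm) leqNgt -(block_index_lt bm) -leqNgt.
    by rewrite ltnS -eqn_leq eq_sym (negbTE bi).
  rewrite big_split/= sum_indicator.
  have h : \sum_(0 <= n < N + N) 4^-1 ^+ n <= 2 :> R.
    apply: geometric_sum_le; first by rewrite invr_ge0.
    by rewrite div1r lef_pV2 ?posrE// ler_nat.
  by apply: le_trans (lerD (_ : _ <= 1) h) _; [case: (_ < _)%N|lra].
have yN0 N : y N.+1 != 0.
  apply/eqP => y0; have := ylarge N.+1; rewrite y0 rnorm0 mulr0.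
  by rewrite leNgt powR_gt0// ltr0n.
have /choice[w' w'P] N : exists z, [/\ z \in W, rnorm z = 1 &
    forall i, modulus (coord z i) = (rnorm (y N.+1))^-1 * modulus (coord (y N.+1) i)].
  have [z zW [c cE [zE z1]]] := normalized_vector sW (yW N.+1) (yN0 N).
  by exists z; split=> // i; rewrite zE coordZ modulusM cE.
exists w'; split=> [n|n|]; [by have [] := w'P n|by have [] := w'P n|].
move=> e e0; have r0 : 0 < (val r)^-1 by rewrite invr_gt0 (lt_le_trans ltr01 (valP r)).
have [N0 [N00 N0e]] := natr_powR_unbounded (D * C * (3 / e)) r0.
apply: Uoo; exists N0 => // N /= N0N i; have [_ _ ->] := w'P N.
have ny : 0 < rnorm (y N.+1).
  rewrite lt_neqAle rnorm_ge0 andbT eq_sym; apply: contra_neq (yN0 N); exact: rnorm0_eq0.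
rewrite mulrC ler_pdivrMr//; apply: le_trans (ysup _ _) _.
rewrite mulrC -ler_pdivrMr//.
have lt1 : D * C * (3 / e) < D * C * rnorm (y N.+1).
  apply: lt_le_trans N0e _; apply: le_trans (ylarge _).
  by rewrite ge0_ler_powR ?nnegrE ?(ltW r0)// ler_nat leqW.
have DC0 : 0 <= D * C by rewrite mulr_ge0.
rewrite leNgt; apply/negP => h; have := ltW h => /(ler_wpM2l DC0).
by rewrite leNgt lt1.
Qed.

End flat_sequence.

(** The exponent of N in the norm of a sum of N unit vectors, meant for flat types: 1/q for l_q and
    0 for c_0. It tells flat types apart. *)
Definition growth (tau : ctype R) : R := if tau is inl (inl (inr q)) then (val q)^-1 else 0.

Lemma growth_inj t t' : growth (flat_type t) = growth (flat_type t') -> flat_type t = flat_type t'.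
Proof.
have g0 (q : exponent R) : (val q)^-1 != 0.
  by rewrite invr_eq0 gt_eqF// (lt_le_trans ltr01 (valP q)).
have inj (q q' : exponent R) : (val q)^-1 = (val q')^-1 -> Tl q = Tl q'.
  by move=> /invr_inj/val_inj ->.
have abs (q : exponent R) (P : Prop) : (val q)^-1 = 0 -> P.
  by move=> /eqP; rewrite (negbTE (g0 q)).
case: t => [[[p|q]|r]|[]]; case: t' => [[[p'|q']|r']|[]] //=; try exact: inj;
  try exact: abs; by move=> /esym; exact: abs.
Qed.

Lemma ones_growth t h N c : (0 < N)%N ->
  tle (flat_type t) h (truncate N (fun=> 1)) c <-> N%:R `^ growth (flat_type t) <= c.
Proof.
move=> N0; have v0 n : 0 <= truncate N (fun=> 1 : R) n.
  by have /andP[] := truncate_ge0 N n (fun=> ler01 : 0 <= 1 :> R).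
have ell (q : exponent R) : tle (Tl q) h (truncate N (fun=> 1)) c <-> N%:R `^ (val q)^-1 <= c.
  have iE : finite_lp (val q) (iota 0 N) (fun=> 1 : R) = N%:R `^ (val q)^-1.
    by rewrite finite_lp_ones ?size_iota// (valP q).
  apply: iff_trans (tle_ellP _ _ _ v0) _; rewrite -iE; split=> [Fc|Nc F].
    apply: le_trans (Fc [fset i in iota 0 N]%fset).
    rewrite (@eq_finite_lp _ _ _ _ _ (truncate N (fun=> 1))).
      by apply: finite_lp_sub; rewrite ?iota_uniq ?(valP q)// => i; rewrite inE.
    by move=> i; rewrite mem_iota /truncate => /andP[_ ->].
  apply: le_trans Nc; rewrite (finite_lp_mask F (fun i => i < N)%N (fun=> 1) (valP q)).
  apply: finite_lp_sub; rewrite ?fset_uniq ?(valP q)// => i.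
  by rewrite !inE mem_iota => /andP[_].
have cc : tle Tc h (truncate N (fun=> 1)) c <-> N%:R `^ 0 <= c.
  apply: iff_trans (tle_c0P _ _ v0) _; rewrite powRr0; split=> [[_ /(_ 0%N)]|c1].
    by rewrite /truncate N0.
  have c0 : 0 <= c by exact: le_trans c1.
  by split=> // n; rewrite /truncate; case: ifP.
by case: t => [[[p|q]|r]|[]]; [exact: ell|exact: ell|exact: cc|exact: cc].
Qed.

Lemma growth_le t t' h (C : R) :
  (forall N c, tle (flat_type t) h (truncate N (fun=> 1)) c ->
     tle (flat_type t') h (truncate N (fun=> 1)) (C * c)) ->
  growth (flat_type t') <= growth (flat_type t).
Proof.
move=> H; rewrite leNgt; apply/negP => lt.
have d0 : 0 < growth (flat_type t') - growth (flat_type t) by rewrite subr_gt0.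
have [N [N0 NC]] := natr_powR_unbounded C d0.
have := H N _ ((ones_growth t h _ N0).2 (lexx _)) => /(ones_growth t' h _ N0).1.
apply/negP; rewrite -ltNge -ltr_pdivlMr ?powR_gt0 ?ltr0n//.
by rewrite -powRB ?pnatr_eq0 ?gtn_eqF// ?implybT.
Qed.

(** A subspace on which [J] is bounded below would contain a normalized flat sequence [w]. As [J]
    preserves coordinates, [J w] is flat too, and along a common subsequence their sums are
    equivalent to the two flat types. Comparing sums of N terms equates the growth exponents. *)
Lemma inclusion_strictly_singular t t' r (J : {linear sspace (k := k) t -> sspace t'}) :
  dom t (TS r) -> bounded_op J -> (forall x, coord (J x) =1 coord x) ->
  flat_type t <> flat_type t' -> strictly_singular J.
Proof.
move=> tr bJ JE tt'; apply/strictly_singularP; split=> // W sW iW [c c0 cJ].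
have [U UU Uoo] := free_ultrafilter.
have [w [wW w1 ws]] := @flat_sequence U UU Uoo t r W tr sW iW.
have /bounded_opP[M M0 JM] := bJ.
pose ty (i : bool) := if i then t else t'.
pose x (i : bool) : nat -> sspace (k := k) (ty i) :=
  if i as i return nat -> sspace (k := k) (ty i) then w else fun n => J (w n).
have xs i : null_sup U (x i).
  case: i => // e e0; apply: filterS (ws e e0) => n /= h j.
  by rewrite JE; exact: h.
have xB i n : rnorm (x i n) <= 1 + M.
  case: i => /=; first by rewrite w1 lerDl.
  by apply: le_trans (JM _) _; rewrite w1 mulr1 lerDr.
have nn i : ~ null_norm U (x i).
  case: i; first by apply: (@null_norm_bounded_below U UU _ _ 1) => // n /=; rewrite w1.
  apply: (@null_norm_bounded_below U UU _ _ c) => // n /=.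
  by have := cJ _ (wW n); rewrite w1 mulr1.
have [phi [m [b [_ bm xP]]]] := @classification _ _ U UU Uoo _ ty x _ xB
  (fun i => null_sup_coord_null (xs i)).
have xsE i : block_type U (x i) = flat_type (ty i).
  by rewrite /block_type; case: asboolP => // /(_ (xs i)).
have [_ _ /(_ (nn true))[C [C0 CP]]] := xP true.
have [_ _ /(_ (nn false))[C' [C'0 C'P]]] := xP false.
rewrite xsE in CP; rewrite xsE in C'P.
have Jsum N (a : nat -> K) : J (\sum_(0 <= n < N) a n *: w (phi n)) =
    \sum_(0 <= n < N) a n *: J (w (phi n)).
  by rewrite linear_sum; apply: eq_bigr => n _; rewrite linearZ.
have one : absv (fun=> 1 : K) = fun=> 1 :> R by apply/funext => n; exact: (modulus_bool true).
apply: tt'; apply: growth_inj; apply/eqP; rewrite eq_le; apply/andP; split.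
  apply: (@growth_le _ _ (S \o m) (C * (c^-1 * C'))) => N d h.
  have := (C'P N (fun=> 1) d).1; rewrite one => /(_ h); rewrite -Jsum => h1.
  rewrite -!mulrA -one; apply: (CP N _ _).2.
  apply: le_trans (_ : c^-1 * rnorm (J (\sum_(0 <= n < N) (1 : K) *: w (phi n))) <= _).
    rewrite ler_pdivlMl//; apply: cJ; rewrite big_mkord.
    exact: (@submod_sum _ _ _ _ _ (fun=> 1)).
  by rewrite ler_wpM2l// invr_ge0 ltW.
apply: (@growth_le _ _ (S \o m) (C' * (M * C))) => N d h.
have := (CP N (fun=> 1) d).1; rewrite one => /(_ h) h1.
rewrite -!mulrA -one; apply: (C'P N _ _).2; rewrite -Jsum.
by apply: le_trans (JM _) _; rewrite ler_wpM2l.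
Qed.

End inclusions.

(** * A noncompact composition *)

Section strictly_singular_inclusions.
Context {R : realType} {k : scalar_kind}.
Local Notation K := (scalars R k).
Implicit Types (t : ctype R).

Definition ss_inclusion t t' : Prop :=
  exists J : {linear sspace (k := k) t -> sspace (k := k) t'},
    strictly_singular J /\ forall x, coord (J x) =1 coord x.

Lemma ss_inclusion_basic t t' r : dom t (TS r) -> dom t t' ->
  flat_type t <> flat_type t' -> ss_inclusion t t'.
Proof.
move=> tr /(@inclusion_exists _ k)[J [bJ JE]] tt'; exists J; split=> //.
exact: inclusion_strictly_singular tr bJ JE tt'.
Qed.

Lemma ss_inclusion_dom t1 t2 t3 : ss_inclusion t1 t2 -> dom t2 t3 -> ss_inclusion t1 t3.
Proof.
move=> [J [ssJ JE]] /(@inclusion_exists _ k)[J' [bJ' J'E]]; exists (J' \o J); split.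
  exact: strictly_singular_compl.
by move=> x i; rewrite /= J'E JE.
Qed.

Lemma dom_ss_inclusion t1 t2 t3 : dom t1 t2 -> ss_inclusion t2 t3 -> ss_inclusion t1 t3.
Proof.
move=> /(@inclusion_exists _ k)[J' [bJ' J'E]] [J [ssJ JE]]; exists (J \o J'); split.
  exact: strictly_singular_compr.
by move=> x i; rewrite /= JE J'E.
Qed.

Lemma Tl_inj (q q' : exponent R) : Tl q = Tl q' -> val q = val q'.
Proof. by case=> ->. Qed.

Lemma ss_S_ell (r q : exponent R) : val r < val q -> ss_inclusion (TS r) (Tl q).
Proof. by move=> rq; apply: (ss_inclusion_basic (r := r)); [exact: dom_refl|exact: dom_S_ell|]. Qed.

Lemma ss_ell_S (r : exponent R) : ss_inclusion (Tl r) (TS r).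
Proof. by apply: (ss_inclusion_basic (r := r)); [exact: dom_ell_S|exact: dom_ell_S|]. Qed.

Lemma ss_ell1_B (p : exponent R) : 1 < val p -> ss_inclusion (Tl exponent_one) (TB p).
Proof.
move=> p1; apply: (ss_inclusion_basic (r := exponent_one)); first exact: dom_ell_S.
  exact: dom_ell1_B.
by move=> /Tl_inj E; move: p1; rewrite -E ltxx.
Qed.

Lemma ss_B_B (p p' : exponent R) : val p < val p' -> ss_inclusion (TB p) (TB p').
Proof.
move=> pp'; apply: (ss_inclusion_basic (r := exponent_one)); first exact: dom_B_S1.
  exact/dom_B/ltW.
by move=> /Tl_inj E; rewrite E ltxx in pp'.
Qed.

Lemma ss_B_S1 (p : exponent R) : ss_inclusion (TB p) (TS exponent_one).
Proof. by apply: (ss_inclusion_basic (r := exponent_one)); [exact: dom_B_S1|exact: dom_B_S1|]. Qed.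

Lemma dom_S_S (r r' : exponent R) : val r <= val r' -> dom (@TS R r) (TS r').
Proof.
rewrite le_eqVlt => /orP[/eqP/val_inj ->|rr']; first exact: dom_refl.
exact: dom_trans (dom_S_ell rr') (dom_ell_S r').
Qed.

(** [ss_inclusion_basic] asks for distinct flat types. Pairs that share one are handled by a detour:
    S_r into S_r' through l_r', S_r into c_0 through l_q with q > r, B_p into l_p through S_1. *)
Lemma ss_inclusion_total t t' :
  (forall p, t = TB p \/ t' = TB p -> 1 < val p) -> t <> t' ->
  ss_inclusion t t' \/ ss_inclusion t' t.
Proof.
have succ (r : exponent R) : exists q : exponent R, val r < val q.
  have h : 1 <= val r + 1 by rewrite lerDr (le_trans ler01 (valP r)).
  by exists (exist _ (val r + 1) h); rewrite /= ltrDl.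
have BS p r : ss_inclusion (TB p) (TS r).
  exact: ss_inclusion_dom (ss_B_S1 p) (@dom_S_S exponent_one r (valP r)).
have Bl p q : 1 < val p -> ss_inclusion (TB p) (Tl q) \/ ss_inclusion (Tl q) (TB p).
  move=> p1; have : val exponent_one <= val q := valP q.
  rewrite le_eqVlt => /orP[/eqP/val_inj <-|q1]; first by right; exact: ss_ell1_B.
  by left; apply: ss_inclusion_dom (ss_B_S1 p) (dom_S_ell q1).
have Sc r : ss_inclusion (TS r) Tc.
  by have [q rq] := succ r; apply: ss_inclusion_dom (ss_S_ell rq) (dom_c0 _).
have lc q : ss_inclusion (Tl q) Tc.
  by apply: ss_inclusion_dom (ss_ell_S q) (dom_c0 _).
have Bc p : ss_inclusion (TB p) Tc.
  by apply: ss_inclusion_dom (ss_B_S1 p) (dom_c0 _).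
have ll q q' : val q < val q' -> ss_inclusion (Tl q) (Tl q').
  by move=> qq'; apply: ss_inclusion_dom (ss_ell_S q) (dom_S_ell qq').
have SS r r' : val r < val r' -> ss_inclusion (TS r) (TS r').
  by move=> rr'; apply: ss_inclusion_dom (ss_S_ell rr') (dom_ell_S r').
have lS q r : ss_inclusion (Tl q) (TS r) \/ ss_inclusion (TS r) (Tl q).
  have [qr|rq] := leP (val q) (val r); last by right; exact: ss_S_ell.
  by left; apply: dom_ss_inclusion (dom_ell qr) (ss_ell_S r).
case: t => [[[p|q]|r]|[]]; case: t' => [[[p'|q']|r']|[]] tB tt';
  rewrite -/(TB _) -/(Tl _) -/(TS _) -/(@Tc R) in tB tt' *.
- have [pp'|pp'|E] := ltgtP (val p) (val p'); [by left; exact: ss_B_B|by right; exact: ss_B_B|].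
  by case: tt'; rewrite (val_inj E).
- by apply: Bl; apply: tB; left.
- by left; exact: BS.
- by left; exact: Bc.
- by have [|] := Bl p' q (tB p' (or_intror erefl)); [right|left].
- have [pp'|pp'|E] := ltgtP (val q) (val q'); [by left; exact: ll|by right; exact: ll|].
  by case: tt'; rewrite (val_inj E).
- exact: lS.
- by left; exact: lc.
- by right; exact: BS.
- by have [|] := lS q' r; [right|left].
- have [pp'|pp'|E] := ltgtP (val r) (val r'); [by left; exact: SS|by right; exact: SS|].
  by case: tt'; rewrite (val_inj E).
- by left; exact: Sc.
- by right; exact: Bc.
- by right; exact: lc.
- by right; exact: Sc.
- by case: tt'.
Qed.

Definition unit_seq (n i : nat) : K := (i == n)%:R.

Lemma absv_unit n i : absv (unit_seq n) i = (i == n)%:R.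
Proof. exact: modulus_bool. Qed.

Lemma tle_unit t h n : tle t h (absv (unit_seq n)) 1.
Proof.
move=> C [_ _ pC]; have [M CM] := chain_bound C.
have CM' F i : F \in C -> i \in F -> (i < M)%N by exact: CM.
apply: le_trans (gauge_le_l1 _ pC (absv_ge0 _) CM') _.
under eq_bigr do rewrite absv_unit eq_sym.
by rewrite sum_indicator; case: (_ < _)%N.
Qed.

Lemma unit_carrier t n : seq_carrier (space (k := k) t) (unit_seq n).
Proof.
apply/seq_carrierP; split; first by exists 1; exact: tle_unit.
move=> e e0; exists n.+1 => C _; rewrite -[leRHS]add0r -(gauge_zero (mixed_of t) C).
apply: ler_wpDr; first exact: ltW.
apply: gauge_le_in => F i _ _; rewrite /tail_from; case: ifP => ni; last by rewrite lexx.
by rewrite absv_unit gtn_eqF// lexx.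
Qed.

Definition unit_vector t n : sspace (k := k) t := mk_sspace (unit_carrier t n).

Lemma coord_unit t n i : coord (unit_vector t n) i = (i == n)%:R.
Proof. by []. Qed.

Lemma rnorm_unit t n : rnorm (unit_vector t n) <= 1.
Proof. exact/rnorm_leP/tle_unit. Qed.

Lemma rdist_unit t n n' : n != n' -> 1 <= rnorm (unit_vector t n - unit_vector t n').
Proof.
move=> nn'; apply: le_trans (coord_le _ n).
by rewrite coordB !coord_unit eqxx (negbTE nn') subr0 (modulus_bool true).
Qed.

End strictly_singular_inclusions.

Section noncompact_compositions.
Context {R : realType} {k : scalar_kind}.
Local Notation K := (scalars R k).
Context {Y : normedModType K}.

Definition complemented t : Prop :=
  exists (J : {linear sspace (k := k) t -> Y}) (P : {linear Y -> sspace (k := k) t}),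
  [/\ bounded_op J, bounded_op P & forall x, P (J x) = x].

Lemma noncompact_composition (Theta : seq (ctype R)) : (0 < size Theta)%N -> uniq Theta ->
  (forall t, t \in Theta -> complemented t) ->
  (forall p, TB p \in Theta -> 1 < val p) ->
  exists Ts : seq {linear Y -> Y}, [/\ size Ts = (size Theta).-1,
    forall j, (j < size Ts)%N -> strictly_singular (nth_op Ts j)
    & ~ compact_op (compose Ts)].
Proof.
move=> sT uT cT B1.
pose le (t t' : ctype R) := (t == t') || `[< ss_inclusion (k := k) t t' >].
(* Comparability is known inside Theta only, so the relation is made total by declaring it true
   elsewhere. Afterwards only neighbours in the sorted list are compared. *)
pose s := sort (fun t t' => [|| t \notin Theta, t' \notin Theta | le t t']) Theta.
have sE : perm_eq s Theta by rewrite perm_sort.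
have [J [P JP]] : exists (J : forall t, {linear sspace (k := k) t -> Y})
    (P : forall t, {linear Y -> sspace (k := k) t}), forall t, t \in Theta ->
    [/\ bounded_op (J t), bounded_op (P t) & forall x, P t (J t x) = x].
  have H t : exists JP : {linear sspace (k := k) t -> Y} * {linear Y -> sspace (k := k) t},
      t \in Theta -> [/\ bounded_op JP.1, bounded_op JP.2 & forall x, JP.2 (JP.1 x) = x].
    have [/cT[J [P JP]]|_] := boolP (t \in Theta); first by exists (J, P).
    by exists ((\0 : {linear sspace (k := k) t -> Y}), (\0 : {linear Y -> sspace (k := k) t})).
  exists (fun t => (projT1 (cid (H t))).1), (fun t => (projT1 (cid (H t))).2) => t.
  exact: projT2 (cid (H t)).
have ss : sorted (fun t t' => [|| t \notin Theta, t' \notin Theta | le t t']) s.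
  apply: sort_sorted => t t'.
  have [tT|] := boolP (t \in Theta); last by rewrite ?orbT.
  have [t'T|] := boolP (t' \in Theta); last by rewrite ?orbT.
  have [E|/eqP tt'] := eqVneq t t'; first by rewrite /le E eqxx.
  have [|h|h] := @ss_inclusion_total R k t t' _ tt'.
  - by move=> p [E|E]; apply: B1; rewrite -E.
  - by rewrite /= /le; apply/orP; left; apply/orP; right; apply/asboolP.
  - by rewrite /= /le; apply/orP; right; apply/orP; right; apply/asboolP.
have us : uniq s by rewrite sort_uniq.
have sub : {subset s <= Theta} by move=> t; rewrite mem_sort.
have szs : size s = size Theta by rewrite size_sort.
case: s sE ss us sub szs => [|t s] sE ss us sub szs; first by rewrite -szs in sT.
have [Ts [szTs ssTs TsE]] : exists Ts : seq {linear Y -> Y}, [/\ size Ts = size s,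
    forall j, (j < size Ts)%N -> strictly_singular (nth_op Ts j)
    & forall n, compose Ts (J t (unit_vector t n)) =
        J (last t s) (unit_vector (last t s) n)].
  elim: s t {sE szs} ss us sub => [|t' s IH] t ss us sub; first by exists [::].
  have /andP[le1 ss'] := ss; have /andP[tn us'] := us.
  have [|Ts [szTs ssTs TsE]] := IH t' ss' us'; first by move=> x xs; apply: sub; rewrite inE xs orbT.
  have tT : t \in Theta by apply: sub; exact: mem_head.
  have t'T : t' \in Theta by apply: sub; rewrite !inE eqxx orbT.
  move: le1; rewrite tT t'T /= /le => /orP[/eqP E|/asboolP[I0 [ssI IE]]].
    by rewrite E mem_head in tn.
  pose T0 : {linear Y -> Y} := J t' \o (I0 \o P t).
  (* [compose] applies the last operator of the list first, so the passage from [t] to [t'] goes to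
     the end. *)
  exists (rcons Ts T0); split; first by rewrite size_rcons szTs.
    move=> j; rewrite size_rcons ltnS /nth_op nth_rcons leq_eqVlt => /orP[/eqP ->|jT].
      rewrite ltnn eqxx; have [bJ' _ _] := JP t' t'T; have [_ bP _] := JP t tT.
      by apply: strictly_singular_compl => //; exact: strictly_singular_compr.
    by rewrite jT; exact: ssTs.
  move=> n; rewrite -cats1 compose_cat /=.
  have [_ _ ->] := JP t tT.
  rewrite (_ : I0 (unit_vector t n) = unit_vector t' n) ?TsE//.
  by apply: coord_inj => i; rewrite IE.
exists Ts; split=> //; first by rewrite szTs -szs.
move=> [_ cpt].
have tT : t \in Theta by apply: sub; exact: mem_head.
have t'T : last t s \in Theta by apply: sub; exact: mem_last.
have [/bounded_opP[M M0 JM] _ _] := JP t tT.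
have [_ /bounded_opP[N N0 PN] PJ] := JP _ t'T.
have M1 : 0 < M + 1 by rewrite ltr_wpDl.
have N1 : 0 < N + 1 by rewrite ltr_wpDl.
have c0 : 0 <= (M + 1)^-1 by rewrite invr_ge0 ltW.
pose c : K := of_real k (M + 1)^-1.
have e0 : 0 < (M + 1)^-1 * (N + 1)^-1 by rewrite mulr_gt0 ?invr_gt0.
apply: (@separated_not_precompact _ _ _ _ _ (fun n => compose Ts (c *: J t (unit_vector t n))) e0 _ _ cpt).
  move=> n; exists (c *: J t (unit_vector t n)) => //=.
  rewrite unit_ball_rnorm rnormZ modulus_of_real// ler_pdivrMl// mulr1.
  apply: le_trans (JM _) _; apply: (@le_trans _ _ M); last by rewrite lerDl.
  by rewrite ler_piMr// rnorm_unit.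
move=> n n' nn'.
rewrite 2!linearZ_LR -scalerBr rnormZ modulus_of_real// ler_pM2l ?invr_gt0// !TsE.
have := PN (J (last t s) (unit_vector (last t s) n') - J (last t s) (unit_vector (last t s) n)).
rewrite linearB !PJ => h.
rewrite -[leLHS]mul1r ler_pdivrMr//.
have n'n : n' != n by rewrite gtn_eqF.
apply: le_trans (rdist_unit _ n'n) _; apply: le_trans h _.
by rewrite mulrC ler_wpM2l ?rnorm_ge0// lerDl.
Qed.

End noncompact_compositions.

(** * Complemented copies of l_p and c_0 *)

Section power_mean.
Context {R : realType}.

(** The graph of [x ^ r] lies above its tangent at 1: Young's inequality for the exponents r and
    r/(r - 1) with second factor 1. *)
Lemma powR_tangent (r x : R) : 1 <= r -> 0 <= x -> r * x <= x `^ r + (r - 1).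
Proof.
rewrite le_eqVlt => /orP[/eqP <-|r1] x0; first by rewrite powRr1// mul1r subrr addr0.
have r0 : 0 < r by exact: lt_trans r1.
have r10 : 0 < r - 1 by rewrite subr_gt0.
have := @conjugate_powR R x 1 r (r / (r - 1)) x0 ler01 r0 (divr_gt0 r0 r10).
rewrite powR1 mulr1 => /(_ _) h.
have {}h : x <= x `^ r / r + 1 / (r / (r - 1)).
  by apply: h; field; rewrite !gt_eqF.
have := ler_wpM2l (ltW r0) h; rewrite mulrDr.
have -> : r * (x `^ r / r) = x `^ r by field; rewrite gt_eqF.
by have -> : r * (1 / (r / (r - 1))) = r - 1 by field; rewrite !gt_eqF.
Qed.

(** The normalized sum is a functional of norm at most 1 on l_r. [mu] is the r-mean of [v]; adding
    the tangent inequalities at [v i / mu] shows that the arithmetic mean is at most [mu]. *)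
Lemma power_mean {I : eqType} (r : R) (s : seq I) (v : I -> R) : 1 <= r -> (0 < size s)%N ->
  (forall i, 0 <= v i) ->
  (size s)%:R `^ (r^-1 - 1) * \sum_(i <- s) v i <= finite_lp r s v.
Proof.
move=> r1 s0 v0; have r0 : 0 < r by exact: lt_le_trans r1.
set n : R := (size s)%:R; have n0 : 0 < n by rewrite ltr0n.
have nr0 : 0 < n `^ r^-1 by rewrite powR_gt0.
have L0 : 0 <= finite_lp r s v by exact: finite_lp_ge0.
have [LE|LN0] := eqVneq (finite_lp r s v) 0.
  rewrite LE big_seq big1 ?mulr0// => i si.
  by apply/le_anti; rewrite v0 -LE le_finite_lp.
have Lgt0 : 0 < finite_lp r s v by rewrite lt_neqAle eq_sym LN0.
pose mu := finite_lp r s v / n `^ r^-1; have mu0 : 0 < mu by exact: divr_gt0.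
have LE : finite_lp r s v = mu * n `^ r^-1 by rewrite /mu divfK// gt_eqF.
have mur : \sum_(i <- s) v i `^ r = mu `^ r * n.
  rewrite -(finite_lp_pow _ _ r1) LE powRM ?(ltW mu0) ?(ltW nr0)//.
  by rewrite powRV_powR// ltW.
have sumn (c : R) : \sum_(i <- s) c = n * c.
  by rewrite big_const_seq count_predT iter_addr_0 mulr_natl.
have tg : \sum_(i <- s) r * (v i / mu) <= \sum_(i <- s) ((v i / mu) `^ r + (r - 1)).
  by apply: ler_sum => i _; apply: powR_tangent => //; rewrite divr_ge0// ltW.
have sum_le : \sum_(i <- s) v i <= n * mu.
  move: tg; rewrite big_split/= sumn -mulr_sumr -mulr_suml.
  have -> : \sum_(i <- s) (v i / mu) `^ r = n.
    transitivity (\sum_(i <- s) v i `^ r * (mu `^ r)^-1).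
      apply: eq_bigr => i _; rewrite powRM ?invr_ge0 ?(ltW mu0)//.
      by congr (_ * _); rewrite -powR_inv1 ?(ltW mu0)// -powRrM mulN1r powRN.
    by rewrite -mulr_suml mur mulrAC mulfV ?mul1r// gt_eqF// powR_gt0.
  move=> h; have : r * ((\sum_(i <- s) v i) / mu) <= r * n by lra.
  by rewrite ler_pM2l// ler_pdivrMr.
have nE : n `^ (r^-1 - 1) * n = n `^ r^-1.
  rewrite powRB; last by rewrite (gt_eqF n0) implybT.
  by rewrite powRr1 ?(ltW n0)// divfK// gt_eqF.
rewrite LE -nE (_ : mu * _ = n `^ (r^-1 - 1) * (n * mu)).
  by rewrite ler_wpM2l ?powR_ge0.
by rewrite mulrC -mulrA.
Qed.

End power_mean.

Lemma nle_inner {R : realType} (e : mixed R) h u c : (forall i, 0 <= u i) -> 0 <= c ->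
  (forall N, \sum_(0 <= i < N) u i `^ inner e <= c `^ inner e) -> nle e h u c.
Proof.
move=> u0 c0 uc C [_ _ pC]; have [N CN] := chain_bound C.
apply: le_trans (finite_lp_exponent C (inner_ge1 e) (inner_le_outer e) _) _.
  by move=> F; exact: finite_lp_ge0.
rewrite finite_lp_leP ?inner_ge1//; apply: le_trans (uc N).
apply: le_trans (chain_sum_le (v := fun i => u i `^ inner e) pC _ CN).
  by apply: ler_sum => F _; rewrite finite_lp_pow ?inner_ge1.
by move=> i; exact: powR_ge0.
Qed.

Lemma mem_fset_seq (q : seq nat) i : (i \in [fset x in q]%fset) = (i \in q).
Proof. by rewrite inE. Qed.

Lemma of_real1 {R : realType} {k} : of_real k (1 : R) = 1.
Proof. by case: k. Qed.

Section flat_copy.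
Context {R : realType} {k : scalar_kind}.
Local Notation K := (scalars R k).
Context (t : ctype R).
Hypothesis t_full : full t.
Let e := mixed_of t.
Let r := inner e.
Let r1 : 1 <= r. Proof. exact: inner_ge1. Qed.
Let r0 : 0 < r. Proof. exact: lt_le_trans r1. Qed.
Context {m b l : nat -> nat} (bm : block_index m b).
Hypothesis lm : forall n, (m n <= l n)%N /\ (l n + (l n).+1 <= m n.+1)%N.
(** This is the flatness required by [flat_upper] for vectors constantly equal to
    [(l n + 1) ^ (-1/r)] on [A n]. *)
Hypothesis lbig : forall n, 4 ^+ n * (m n).+1%:R <= (l n).+1%:R `^ r^-1.

(** The interval of [l n + 1] points from [l n] on: as large as an admissible set with this minimum
    can be. *)
Let A n := iota (l n) (l n).+1.
Let s n : R := (l n).+1%:R.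
Let w i : R := if i \in A (b i) then s (b i) `^ (- r^-1) else 0.

Let s0 n : 0 < s n. Proof. by rewrite ltr0n. Qed.
Let w0 i : 0 <= w i. Proof. by rewrite /w; case: ifP => // _; exact: powR_ge0. Qed.

Let bA n i : i \in A n -> b i = n.
Proof.
rewrite mem_iota => /andP[li il]; have [ml lm'] := lm n; apply/eqP; rewrite eqn_leq.
rewrite -ltnS (block_index_lt bm) (leq_trans il)//= leqNgt (block_index_lt bm) -leqNgt.
exact: leq_trans ml li.
Qed.

Let capE : capacity t S = S. Proof. by rewrite /capacity t_full. Qed.

(** The block vectors have l_r norm 1, so [flat_upper] applies with D = 1 and yields D + 2 = 3. *)
Lemma flat_copy_upper v c : (forall n, 0 <= v n) -> tle (flat_type t) S v c ->
  tle t S (fun i => v (b i) * w i) (3 * c).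
Proof.
move=> v0 /(flat_typeP t S c v0) vc; rewrite (_ : 3 = 1 + 2 :> R); last by ring.
apply: (flat_upper bm (g := capacity t S) _ _ w0 v0 _ _ vc).
- exact: capacity_mono.
- by move=> n; rewrite capE.
- move=> n; apply: nle_inner => // [i|N]; first by rewrite /on_block; case: ifP.
  rewrite powR1; apply: (@le_trans _ _ (\sum_(i <- A n) (s n)^-1)); last first.
    by rewrite big_const_seq count_predT iter_addr_0 size_iota -mulr_natr mulVf// gt_eqF.
  apply: (@le_trans _ _ (\sum_(0 <= i < N | i \in A n) (s n)^-1)).
    rewrite [leRHS]big_mkcond; apply: ler_sum => i _; rewrite /on_block.
    have z : 0 `^ inner e = 0 :> R by rewrite powR0// gt_eqF.
    case: eqP => [bi|bi]; last by rewrite z; case: ifP => // _; rewrite invr_ge0 ltW.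
    rewrite /w bi; case: ifP => _; last by rewrite z.
    by rewrite -powRrM mulNr mulVf ?gt_eqF// powR_inv1// ltW.
  rewrite -big_filter; apply: ler_sum_sub; first by rewrite filter_uniq ?iota_uniq.
    by move=> i; rewrite mem_filter => /andP[].
  by move=> _; rewrite invr_ge0 ltW.
move=> i; rewrite /w; case: ifP => _; last by rewrite mul0r exprn_ge0// invr_ge0.
rewrite powRN mulrC ler_pdivrMr ?powR_gt0// exprVn -ler_pdivrMl ?invr_gt0 ?exprn_gt0//.
by rewrite invrK; exact: lbig.
Qed.

Definition block_norms (v : nat -> R) n := finite_lp r (A n) v.

(** Dividing [v] by its norm on each [A n] gives blocks [u] that are normed by one admissible set,
    so [flat_lower] applies with d = 1 and the block norms as coefficients. *)
Lemma block_norms_le v c : (forall i, 0 <= v i) -> tle t S v c ->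
  tle (flat_type t) S (block_norms v) c.
Proof.
move=> v0 vc; have rho0 n : 0 <= block_norms v n by exact: finite_lp_ge0.
apply/flat_typeP => //.
pose u i := if (i \in A (b i)) then v i / block_norms v (b i) else 0.
have u0 i : 0 <= u i by rewrite /u; case: ifP => // _; rewrite divr_ge0.
rewrite -[c]divr1; apply: (flat_lower bm u0 rho0 ltr01 (g := capacity t S)).
  move=> n rn; have hA : sch (capacity t S) [fset i in A n]%fset.
    move=> i; rewrite capE mem_fset_seq mem_iota => /andP[li _].
    by rewrite card_fseq undup_id ?iota_uniq// size_iota ltnS.
  exists [:: [fset i in A n]%fset]; first exact: test1.
  rewrite gauge1; apply: (@le_trans _ _ (finite_lp r (A n) (fun i => (block_norms v n)^-1 * v i))).
    rewrite finite_lpZ ?invr_ge0// -/(block_norms v n) mulVf//.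
  apply: (@le_trans _ _ (finite_lp r (A n) (on_block (b := b) n u))).
    apply: finite_lp_le_in => // i iA; rewrite mulr_ge0 ?invr_ge0//=.
    by rewrite /on_block (bA iA) eqxx /u (bA iA) iA mulrC.
  by apply: finite_lp_sub; rewrite ?iota_uniq// => i; rewrite mem_fset_seq.
apply: nle_le vc => i; rewrite mulr_ge0//= /u; case: ifP => iA; last by rewrite mulr0.
have [z|nz] := eqVneq (block_norms v (b i)) 0.
  by rewrite z mul0r.
by rewrite mulrCA mulfV ?mulr1.
Qed.

Lemma block_norms_tail v n : block_norms (tail_from (m n) v) = tail_from n (block_norms v).
Proof.
apply/funext => j; rewrite /tail_from /block_norms; have [nj|jn] := leqP n j.
  apply: eq_finite_lp => i; rewrite mem_iota => /andP[li _].
  by rewrite (leq_trans (block_start_le bm nj)) ?(leq_trans (lm j).1).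
transitivity (finite_lp r (A j) (fun=> 0)).
  apply: eq_finite_lp => i iA; have := bA iA => bi.
  by rewrite leqNgt -(block_index_lt bm) bi jn.
have z x : 0 < x -> 0 `^ x = 0 :> R by move=> x0; rewrite powR0// gt_eqF.
by rewrite /finite_lp big1 ?z ?invr_gt0// => i _; rewrite z.
Qed.

Let embed (x : scalar_seq R k) : scalar_seq R k := fun i => x (b i) * of_real k (w i).

Let absv_embed x : absv (embed x) = fun i => absv x (b i) * w i.
Proof. by apply/funext => i; rewrite /absv modulusM modulus_of_real. Qed.

Let embed_carrier x : seq_carrier (space (flat_type t)) x -> seq_carrier (space t) (embed x).
Proof.
move=> /seq_carrierP[[c xc] xt]; apply/seq_carrierP; rewrite absv_embed; split.
  by exists (3 * c); apply: flat_copy_upper => //; exact: absv_ge0.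
move=> eps eps0; have e30 : 0 < eps / 3 by rewrite divr_gt0.
have [n xn] := xt _ e30; exists (m n).
have t0 j : 0 <= tail_from n (absv x) j by have /andP[] := tail_from_ge0 n j (absv_ge0 x).
have := flat_copy_upper t0 xn.
rewrite (_ : 3 * (eps / 3) = eps); last by field.
apply: nle_le => i; rewrite /tail_from.
rewrite leqNgt -(block_index_lt bm) -leqNgt; case: ifP => _; last by rewrite mul0r lexx.
by rewrite mulr_ge0 ?absv_ge0//= lexx.
Qed.

(** The functionals biorthogonal to the block vectors. By [power_mean] they are bounded by the block
    norms. *)
Let average (y : scalar_seq R k) : scalar_seq R k := fun n =>
  of_real k (s n `^ (r^-1 - 1)) * \sum_(i <- A n) y i.

Let absv_average y n : absv (average y) n <= block_norms (absv y) n.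
Proof.
rewrite /absv modulusM modulus_of_real ?powR_ge0//.
apply: le_trans (_ : s n `^ (r^-1 - 1) * \sum_(i <- A n) absv y i <= _).
  by rewrite ler_wpM2l ?powR_ge0//; exact: modulus_sum.
have := @power_mean R _ r (A n) (absv y) r1; rewrite size_iota; apply=> //.
exact: absv_ge0.
Qed.

Let average_carrier y : seq_carrier (space t) y -> seq_carrier (space (flat_type t)) (average y).
Proof.
move=> /seq_carrierP[[c yc] yt]; apply/seq_carrierP; split.
  exists c; apply: nle_le (block_norms_le (absv_ge0 y) yc) => n.
  by rewrite absv_ge0 absv_average.
move=> eps eps0; have [n yn] := yt _ eps0; exists n.
have t0 j : 0 <= tail_from (m n) (absv y) j by have /andP[] := tail_from_ge0 (m n) j (absv_ge0 y).
have ymn : tle t S (tail_from (m n) (absv y)) eps.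
  apply: nle_le yn => i; rewrite t0 /= /tail_from.
  case: ifP => [mi|_]; first by rewrite (leq_trans (block_start_ge bm n) mi).
  by case: ifP => // _; exact: absv_ge0.
have := block_norms_le t0 ymn; rewrite block_norms_tail.
apply: nle_le => j; rewrite /tail_from; case: ifP => _; last by rewrite lexx.
by rewrite absv_ge0 absv_average.
Qed.

Lemma of_real_sum {I : Type} (q : seq I) (f : I -> R) :
  of_real k (\sum_(i <- q) f i) = \sum_(i <- q) of_real k (f i).
Proof.
elim: q => [|i q IH]; first by rewrite !big_nil of_real0.
by rewrite !big_cons of_realD IH.
Qed.

Lemma flat_copy_complemented : complemented (Y := sspace (k := k) t) (flat_type t).
Proof.
pose J0 (x : sspace (k := k) (flat_type t)) : sspace (k := k) t :=
  mk_sspace (embed_carrier (coord_carrier x)).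
pose P0 (y : sspace (k := k) t) : sspace (k := k) (flat_type t) :=
  mk_sspace (average_carrier (coord_carrier y)).
have [|J JE] := @linear_exists _ _ _ _ J0.
  move=> a x y; apply: coord_inj => i.
  rewrite coordP -[LHS]/((a * coord x (b i) + coord y (b i)) * of_real k (w i)).
  by rewrite mulrDl mulrA.
have [|P PE] := @linear_exists _ _ _ _ P0.
  move=> a x y; apply: coord_inj => n; rewrite coordP.
  rewrite -[LHS]/(of_real k (s n `^ (r^-1 - 1)) * \sum_(i <- A n) (a * coord x i + coord y i)).
  by rewrite big_split/= -mulr_sumr mulrDr mulrCA.
exists J, P; split.
- apply/bounded_opP; exists 3 => // x; rewrite JE; apply/rnorm_leP.
  rewrite -[coord _]/(embed (coord x)) absv_embed.
  by apply: flat_copy_upper; [exact: absv_ge0|exact: tle_rnorm].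
- apply/bounded_opP; exists 1 => // y; rewrite PE mul1r; apply/rnorm_leP.
  apply: nle_le (block_norms_le (absv_ge0 _) (tle_rnorm y)) => n.
  by rewrite absv_ge0; exact: absv_average.
move=> x; rewrite PE JE; apply: coord_inj => n.
rewrite -[LHS]/(of_real k (s n `^ (r^-1 - 1)) * \sum_(i <- A n) (coord x (b i) * of_real k (w i))).
have -> : \sum_(i <- A n) (coord x (b i) * of_real k (w i)) =
    coord x n * of_real k (\sum_(i <- A n) s n `^ (- r^-1)).
  rewrite of_real_sum mulr_sumr; apply: eq_big_seq => i iA.
  by rewrite /w (bA iA) iA.
rewrite mulrCA -of_realM big_const_seq count_predT iter_addr_0 size_iota -mulr_natr.
rewrite mulrA -powRD; last by rewrite (gt_eqF (s0 n)) implybT.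
rewrite addrAC subrr add0r powR_inv1 ?(ltW (s0 n))// mulVf ?gt_eqF//.
by rewrite of_real1 mulr1.
Qed.

End flat_copy.

Lemma complemented_flat_type {R : realType} {k : scalar_kind} (t : ctype R) :
  complemented (Y := sspace (k := k) t) (flat_type t).
Proof.
have id_complemented t' : complemented (Y := sspace (k := k) t') t'.
  exists idfun, idfun; split=> //; exact: bounded_op_id.
have [tf|] := boolP (full t); last first.
  by case: t => [[[p|q]|r]|[]] // _; exact: id_complemented.
set r := inner (mixed_of t).
have r0 : 0 < r^-1 by rewrite invr_gt0 (lt_le_trans ltr01)// inner_ge1.
(* The block from M must contain [A n], whose last point is [l + l], and [l] must be large enough
   for flatness. *)
pose P n M l M' := [/\ (M <= l)%N, (l + l.+1 <= M')%N & 4 ^+ n * M.+1%:R <= l.+1%:R `^ r^-1 :> R].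
have [|phi [m [m0 _ mS PP]]] := @block_selection \oo P _ (@subset_refl _ _).
  move=> n M; have [N [_ NM]] := natr_powR_unbounded (4 ^+ n * M.+1%:R) r0.
  exists (maxn M N) => // l /=; rewrite geq_max => /andP[Ml Nl].
  exists (l + l.+1)%N => // M' /= lM'; split=> //.
  apply: le_trans (ltW NM) _; rewrite ge0_ler_powR ?nnegrE ?(ltW r0)//.
  by rewrite ler_nat leqW.
have [b bm] := block_index_exists m0 mS.
apply: (@flat_copy_complemented _ _ _ tf m b phi bm).
  by move=> n; have [] := PP n.
by move=> n; have [] := PP n.
Qed.

(** * Direct sums *)

Section sums_of_spaces.
Context {R : realType} {k : scalar_kind}.
Local Notation K := (scalars R k).

Lemma rnorm_pair {E F : normedModType K} (z : E * F) :
  rnorm z = Num.max (rnorm z.1) (rnorm z.2).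
Proof.
apply: (@of_real_inj _ k); rewrite -rnormE prod_normE !rnormE.
by rewrite /Order.max of_real_lt; case: ifP.
Qed.

Lemma rnorm_fst {E F : normedModType K} (z : E * F) : rnorm z.1 <= rnorm z.
Proof. by rewrite rnorm_pair le_max lexx. Qed.

Lemma rnorm_snd {E F : normedModType K} (z : E * F) : rnorm z.2 <= rnorm z.
Proof. by rewrite rnorm_pair le_max lexx orbT. Qed.

Lemma rnorm_pair_le {E F : normedModType K} (z : E * F) c :
  rnorm z.1 <= c -> rnorm z.2 <= c -> rnorm z <= c.
Proof. by rewrite rnorm_pair ge_max => -> ->. Qed.

Lemma rnorm_component {J : finType} (E : J -> normedModType K) (x : dsum E) j :
  rnorm (component x j) <= rnorm x.
Proof. by rewrite -(of_real_le (k := k)) -!rnormE; exact: le_dsum_norm. Qed.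

Lemma rnorm_dsum_le {J : finType} (E : J -> normedModType K) (x : dsum E) c : 0 <= c ->
  (forall j, rnorm (component x j) <= c) -> rnorm x <= c.
Proof.
move=> c0 xc; rewrite -(of_real_le (k := k)) -rnormE; apply: dsum_norm_le.
  by rewrite -(@of_real0 R k) of_real_le.
by move=> j; rewrite rnormE of_real_le.
Qed.

Lemma complemented_trans {E : normedModType K} (t t' : ctype R) :
  complemented (Y := E) t -> complemented (Y := sspace (k := k) t) t' -> complemented (Y := E) t'.
Proof.
move=> [J [P [bJ bP PJ]]] [J' [P' [bJ' bP' PJ']]].
exists (J \o J'), (P' \o P); split; [exact: bounded_op_comp|exact: bounded_op_comp|].
by move=> x /=; rewrite PJ PJ'.
Qed.

Lemma decomposition_inj {E : normedModType K} {I : finType} {ty : I -> ctype R}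
    (pr : forall i, {linear E -> sspace (k := k) (ty i)}) (x y : E) :
  decomposition pr -> (forall i, pr i x = pr i y) -> x = y.
Proof.
move=> [_ [C C0 CY] _] xy; apply/eqP; rewrite -subr_eq0; apply/eqP/rnorm0_eq0/eqP.
rewrite eq_le rnorm_ge0 andbT; apply: le_trans (CY _) _.
by rewrite big1 ?mulr0// => i _; rewrite linearB xy subrr rnorm0.
Qed.

Lemma decomposition_complemented {E : normedModType K} {I : finType} {ty : I -> ctype R}
    (pr : forall i, {linear E -> sspace (k := k) (ty i)}) i :
  decomposition pr -> complemented (Y := E) (ty i).
Proof.
move=> prE; have [prB [C C0 CY] prS] := prE.
have /choice[f fP] (x : sspace (k := k) (ty i)) : exists y : E,
    pr i y = x /\ forall j, j != i -> pr j y = 0.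
  have [y yP] := prS (eqtype.dfwith (fun j => 0 : sspace (k := k) (ty j)) x).
  exists y; split; first by rewrite yP dfwith_in.
  by move=> j ji; rewrite yP dfwith_out// eq_sym.
have [|J JE] := @linear_exists _ _ _ _ f.
  move=> a x y; apply: (decomposition_inj prE) => j; rewrite linearP.
  have [->|ji] := eqVneq j i.
    by rewrite (fP (a *: x + y)).1 (fP x).1 (fP y).1.
  by rewrite (fP (a *: x + y)).2// (fP x).2// (fP y).2// scaler0 addr0.
exists J, (pr i); split=> //.
  apply/bounded_opP; exists C => // x; rewrite JE; apply: le_trans (CY _) _.
  rewrite (bigD1 i)//= big1 ?addr0; last first.
    by move=> j ji; rewrite (fP x).2// rnorm0.
  by rewrite (fP x).1.
by move=> x; rewrite JE; have [] := fP x.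
Qed.

Lemma decomposition_sspace (t : ctype R) :
  decomposition (k := k) (ty := fun _ : unit => t) (fun i => idfun : {linear sspace (k := k) t -> sspace (k := k) t}).
Proof.
split=> [i||x]; first exact: bounded_op_id.
  by exists 1 => // y; rewrite mul1r (bigD1 tt)//= lerDl; apply: sumr_ge0 => i _; exact: rnorm_ge0.
by exists (x tt) => -[].
Qed.

Lemma decomposition_dsum {I : finType} (ty : I -> ctype R) :
  exists pr : forall i, {linear dsum (fun i => sspace (k := k) (ty i)) -> sspace (k := k) (ty i)},
    decomposition pr.
Proof.
pose D := dsum (fun i => sspace (k := k) (ty i)).
have [pr pE] : exists pr : forall i, {linear D -> sspace (k := k) (ty i)},
    forall i, pr i =1 (fun x : D => component x i).
  have prE i : exists T : {linear D -> sspace (k := k) (ty i)}, T =1 (fun x : D => component x i).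
    by apply: linear_exists.
  by exists (fun i => projT1 (cid (prE i))) => i; exact: projT2 (cid (prE i)).
exists pr; split=> [i||x].
- by apply/bounded_opP; exists 1 => // y; rewrite pE mul1r rnorm_component.
- exists 1 => // y; rewrite mul1r; apply: rnorm_dsum_le => [|i].
    by apply: sumr_ge0 => i _; exact: rnorm_ge0.
  rewrite (bigD1 i)//= pE lerDl; apply: sumr_ge0 => j _; exact: rnorm_ge0.
by exists (Dsum x) => i; rewrite pE.
Qed.

Definition sum_type {I J : finType} (ty : I -> ctype R) (ty' : J -> ctype R) (i : I + J) : ctype R :=
  match i with inl a => ty a | inr b => ty' b end.

Lemma decomposition_pair {E F : normedModType K} {I J : finType}
    {ty : I -> ctype R} {ty' : J -> ctype R}
    (pr : forall i, {linear E -> sspace (k := k) (ty i)})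
    (pr' : forall j, {linear F -> sspace (k := k) (ty' j)}) :
  decomposition pr -> decomposition pr' ->
  exists pr2 : forall i : I + J, {linear (E * F)%type -> sspace (k := k) (sum_type ty ty' i)},
    decomposition pr2.
Proof.
move=> [prB [C C0 CE] prS] [prB' [C' C0' CF] prS'].
pose f (i : I + J) : (E * F)%type -> sspace (k := k) (sum_type ty ty' i) :=
  match i with inl a => fun z => pr a z.1 | inr b => fun z => pr' b z.2 end.
have [pr2 pE] : exists pr2 : forall i, {linear (E * F)%type -> sspace (k := k) (sum_type ty ty' i)},
    forall i, pr2 i =1 f i.
  have fE i : exists T : {linear (E * F)%type -> sspace (k := k) (sum_type ty ty' i)}, T =1 f i.
    by apply: linear_exists => a x y; case: i => b; rewrite /f -linearP.
  by exists (fun i => projT1 (cid (fE i))) => i; exact: projT2 (cid (fE i)).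
exists pr2; split=> [i||x].
- apply/bounded_opP; case: i (pE i) => b pEi.
    have /bounded_opP[M M0 prM] := prB b; exists M => // z.
    by rewrite pEi /=; apply: le_trans (prM _) _; rewrite ler_wpM2l ?rnorm_fst.
  have /bounded_opP[M M0 prM] := prB' b; exists M => // z.
  by rewrite pEi /=; apply: le_trans (prM _) _; rewrite ler_wpM2l ?rnorm_snd.
- exists (C + C'); first exact: addr_ge0.
  move=> z; under eq_bigr do rewrite pE.
  rewrite big_sumType/=; set A := \sum_(i : I) _; set B := \sum_(j : J) _.
  have A0 : 0 <= A by apply: sumr_ge0 => i _; exact: rnorm_ge0.
  have B0 : 0 <= B by apply: sumr_ge0 => i _; exact: rnorm_ge0.
  have hA : rnorm z.1 <= C * A := CE z.1.
  have hB : rnorm z.2 <= C' * B := CF z.2.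
  by apply: rnorm_pair_le; nra.
have [y yP] := prS (fun a => x (inl a)); have [z zP] := prS' (fun b => x (inr b)).
by exists (y, z) => i; rewrite pE; case: i => b; [exact: yP|exact: zP].
Qed.

(** * Absorption of a summand c_0 *)

Section interleaving.
Local Notation C0 := (sspace (k := k) (@Tc R)).

Lemma c0_carrierE (x : scalar_seq R k) : seq_carrier (space (k := k) Tc) x <->
  forall e : R, 0 < e -> exists m, forall i, (m <= i)%N -> absv x i <= e.
Proof.
split=> [/seq_carrierP[_ xt] e e0|xt].
  have [m xm] := xt e e0; exists m => i mi.
  have t0 j : 0 <= tail_from m (absv x) j by have /andP[] := tail_from_ge0 m j (absv_ge0 x).
  by have [_ /(_ i)] := (tle_c0P S e t0).1 xm; rewrite /tail_from mi.
apply/seq_carrierP; split.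
  have [m xm] := xt 1 ltr01; exists (1 + \sum_(0 <= i < m) absv x i).
  have s0 : 0 <= \sum_(0 <= i < m) absv x i by apply: sumr_ge0 => i _; exact: absv_ge0.
  apply/tle_c0P; [exact: absv_ge0|split=> [|i]; first exact: addr_ge0].
  have [mi|im] := leqP m i; first by apply: le_trans (xm i mi) _; rewrite lerDl.
  apply: (@le_trans _ _ (\sum_(0 <= i < m) absv x i)); last by rewrite lerDr.
  rewrite big_mkord (bigD1 (Ordinal im))//= lerDl; apply: sumr_ge0 => j _.
  exact: absv_ge0.
move=> e e0; have [m xm] := xt e e0; exists m; apply/tle_c0P.
  by move=> j; have /andP[] := tail_from_ge0 m j (absv_ge0 x).
split=> [|i]; first exact: ltW.
by rewrite /tail_from; case: ifP => [/xm//|_]; exact: ltW.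
Qed.

Lemma c0_rnorm_le (x : C0) c : 0 <= c -> (forall i, modulus (coord x i) <= c) -> rnorm x <= c.
Proof. by move=> c0 xc; apply/rnorm_leP/tle_c0P; [exact: absv_ge0|]. Qed.

Definition interleave (x z : scalar_seq R k) : scalar_seq R k :=
  fun i => if odd i then z i./2 else x i./2.

Lemma interleave_carrier (x z : C0) :
  seq_carrier (space (k := k) Tc) (interleave (coord x) (coord z)).
Proof.
apply/c0_carrierE => e e0.
have [m xm] := (c0_carrierE _).1 (coord_carrier x) e e0.
have [n zn] := (c0_carrierE _).1 (coord_carrier z) e e0.
exists (maxn m n).*2 => i; rewrite -geq_half_double => hi; rewrite /absv /interleave.
case: ifP => _; [apply: zn|apply: xm]; apply: leq_trans hi; rewrite ?leq_maxl ?leq_maxr//.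
Qed.

Lemma subsequence_carrier (f : nat -> nat) (x : C0) : (forall i, i <= f i)%N ->
  seq_carrier (space (k := k) Tc) (fun i => coord x (f i)).
Proof.
move=> fi; apply/c0_carrierE => e e0.
have [m xm] := (c0_carrierE _).1 (coord_carrier x) e e0.
by exists m => i mi; apply: xm; exact: leq_trans mi (fi i).
Qed.

Lemma c0_isomorphic_square : exists (mix : {linear (C0 * C0)%type -> C0})
    (ev od : {linear C0 -> C0}), [/\ bounded_op mix, bounded_op ev, bounded_op od &
  [/\ forall z, ev (mix z) = z.1, forall z, od (mix z) = z.2 &
      forall x, mix (ev x, od x) = x]].
Proof.
pose mix0 (z : (C0 * C0)%type) : C0 := mk_sspace (interleave_carrier z.1 z.2).
have ev_le i : (i <= i.*2)%N by rewrite -addnn leq_addr.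
have od_le i : (i <= i.*2.+1)%N by exact: leqW.
pose ev0 (x : C0) : C0 := mk_sspace (subsequence_carrier x ev_le).
pose od0 (x : C0) : C0 := mk_sspace (subsequence_carrier x od_le).
have [|mix mixE] := @linear_exists _ _ _ _ mix0.
  move=> a x y; apply: coord_inj => i; rewrite coordP.
  rewrite -[coord (mix0 _) i]/(if odd i then coord (a *: x + y).2 i./2 else coord (a *: x + y).1 i./2).
  rewrite -[coord (mix0 x) i]/(if odd i then coord x.2 i./2 else coord x.1 i./2).
  rewrite -[coord (mix0 y) i]/(if odd i then coord y.2 i./2 else coord y.1 i./2).
  have -> : (a *: x + y).1 = a *: x.1 + y.1 by [].
  have -> : (a *: x + y).2 = a *: x.2 + y.2 by [].
  by rewrite !coordP; case: (odd i).
have [|ev evE] := @linear_exists _ _ _ _ ev0; first by move=> a x y; apply: coord_inj => i; rewrite coordP; exact: coordP.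
have [|od odE] := @linear_exists _ _ _ _ od0; first by move=> a x y; apply: coord_inj => i; rewrite coordP; exact: coordP.
have mixc z i : coord (mix z) i = if odd i then coord z.2 i./2 else coord z.1 i./2 by rewrite mixE.
have evc x i : coord (ev x) i = coord x i.*2 by rewrite evE.
have odc x i : coord (od x) i = coord x i.*2.+1 by rewrite odE.
exists mix, ev, od; split.
- apply/bounded_opP; exists 1 => // z; rewrite mul1r; apply: c0_rnorm_le; first exact: rnorm_ge0.
  move=> i; rewrite mixc; case: ifP => _; apply: le_trans (coord_le _ _) _.
    exact: rnorm_snd.
  exact: rnorm_fst.
- apply/bounded_opP; exists 1 => // x; rewrite mul1r; apply: c0_rnorm_le; first exact: rnorm_ge0.
  by move=> i; rewrite evc coord_le.
- apply/bounded_opP; exists 1 => // x; rewrite mul1r; apply: c0_rnorm_le; first exact: rnorm_ge0.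
  by move=> i; rewrite odc coord_le.
split=> [z|z|x]; apply: coord_inj => i.
- by rewrite evc mixc odd_double doubleK.
- by rewrite odc mixc /= odd_double /= uphalf_double.
rewrite mixc; case: ifP => oi; rewrite ?evc ?odc -[in RHS](odd_double_half i) oi//.
Qed.

(** E is the sum of the kernel of [P] and a copy of c_0, and c_0 absorbs a second copy of itself:
    [f] keeps the kernel part of [z.1] and replaces [P z.1] by [mix (P z.1, z.2)]. *)
Lemma isomorphic_pair_c0 (E : normedModType K) : complemented (Y := E) (@Tc R) ->
  isomorphic (E * C0)%type E.
Proof.
move=> [J [P [bJ bP PJ]]].
have [mix [ev [od [bmix bev bod [evK odK mixK]]]]] := c0_isomorphic_square.
pose f (z : (E * C0)%type) : E := z.1 + J (mix (P z.1, z.2) - P z.1).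
pose g (y : E) : (E * C0)%type := (y + J (ev (P y) - P y), od (P y)).
have [|T TE] := @linear_exists _ _ _ _ f.
  move=> a x y; rewrite /f.
  have -> : (a *: x + y).1 = a *: x.1 + y.1 by [].
  have -> : (P (a *: x.1 + y.1), (a *: x + y).2) = a *: (P x.1, x.2) + (P y.1, y.2).
    by rewrite linearP.
  have BP (u v u' v' : C0) : a *: u + u' - (a *: v + v') = a *: (u - v) + (u' - v').
    by rewrite scalerBr opprD addrACA.
  have Jl (u v : C0) : J (a *: u + v) = a *: J u + J v by exact: linearP.
  have Pl u v : P (a *: u + v) = a *: P u + P v by exact: linearP.
  have ml u v : mix (a *: u + v) = a *: mix u + mix v by exact: linearP.
  by rewrite ml Pl BP Jl scalerDr addrACA.
have [|S0 SE] := @linear_exists _ _ _ _ g.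
  move=> a x y; rewrite /g.
  have BP (u v u' v' : C0) : a *: u + u' - (a *: v + v') = a *: (u - v) + (u' - v').
    by rewrite scalerBr opprD addrACA.
  have Jl (u v : C0) : J (a *: u + v) = a *: J u + J v by exact: linearP.
  have Pl u v : P (a *: u + v) = a *: P u + P v by exact: linearP.
  have el u v : ev (a *: u + v) = a *: ev u + ev v by exact: linearP.
  have ol u v : od (a *: u + v) = a *: od u + od v by exact: linearP.
  by rewrite Pl el ol BP Jl addrACA -scalerDr.
have PT z : P (T z) = mix (P z.1, z.2) by rewrite TE /f linearD PJ addrC subrK.
have PS y : P (S0 y).1 = ev (P y) by rewrite SE /g linearD PJ addrC subrK.
have /bounded_opP[MJ MJ0 JM] := bJ; have /bounded_opP[MP MP0 PM] := bP.
have /bounded_opP[Mm Mm0 mM] := bmix; have /bounded_opP[Me Me0 eM] := bev.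
have /bounded_opP[Mo Mo0 oM] := bod.
exists T, S0; split.
- apply/bounded_opP; exists (1 + MJ * (Mm * (MP + 1) + MP)).
    by rewrite !addr_ge0 ?mulr_ge0 ?addr_ge0 ?mulr_ge0 ?addr_ge0.
  move=> z; rewrite TE /f; apply: le_trans (rnormD _ _) _; rewrite mulrDl mul1r; apply: lerD.
    exact: rnorm_fst.
  apply: le_trans (JM _) _; rewrite -mulrA ler_wpM2l//; apply: le_trans (rnormB _ _) _.
  rewrite mulrDl; apply: lerD; last first.
    by apply: le_trans (PM _) _; rewrite ler_wpM2l ?rnorm_fst.
  apply: le_trans (mM _) _; rewrite -mulrA ler_wpM2l//; apply: rnorm_pair_le => /=.
    apply: le_trans (PM _) _; rewrite mulrDl mul1r.
    by apply: ler_wpDr; rewrite ?rnorm_ge0// ler_wpM2l ?rnorm_fst.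
  by rewrite mulrDl mul1r; apply: ler_wpDl; rewrite ?rnorm_snd// mulr_ge0 ?rnorm_ge0.
- apply/bounded_opP; exists (1 + MJ * (Me * MP + MP) + Mo * MP).
    by rewrite !addr_ge0 ?mulr_ge0 ?addr_ge0 ?mulr_ge0.
  move=> y; rewrite SE /g mulrDl; apply: rnorm_pair_le => /=.
    apply: ler_wpDr; first by rewrite !mulr_ge0 ?rnorm_ge0.
    apply: le_trans (rnormD _ _) _; rewrite mulrDl mul1r lerD2l.
    apply: le_trans (JM _) _; rewrite -mulrA ler_wpM2l//; apply: le_trans (rnormB _ _) _.
    rewrite mulrDl; apply: lerD => //; apply: le_trans (eM _) _.
    by rewrite -mulrA ler_wpM2l.
  apply: ler_wpDl; first by rewrite mulr_ge0 ?rnorm_ge0 ?addr_ge0 ?mulr_ge0 ?addr_ge0 ?mulr_ge0.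
  by apply: le_trans (oM _) _; rewrite -mulrA ler_wpM2l.
- move=> z; rewrite SE /g PT evK odK TE /f /=.
  rewrite -addrA -linearD addrC.
  have -> : mix (P z.1, z.2) - P z.1 + (P z.1 - mix (P z.1, z.2)) = 0.
    by rewrite addrA subrK subrr.
  by rewrite linear0 add0r -surjective_pairing.
- move=> y; rewrite TE /f PS.
  have -> : (S0 y).2 = od (P y) by rewrite SE.
  rewrite mixK SE /g /= -addrA -linearD.
  have -> : ev (P y) - P y + (P y - ev (P y)) = 0 by rewrite addrA subrK subrr.
  by rewrite linear0 addr0.
Qed.

End interleaving.

End sums_of_spaces.

(** * The quotient ring *)

Section cosets.
Context {R : realType} {k : scalar_kind} {Y : normedModType (scalars R k)}.
Hypothesis Yc : ultra_complete Y.
Implicit Types S T U V W : {linear Y -> Y}.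

Lemma compact_bounded T : compact_op T -> bounded_op T.
Proof. by case. Qed.

Lemma eq_compact_op S T : S =1 T -> compact_op S -> compact_op T.
Proof.
move=> ST /(compact_opP _ Yc)[bS nS]; apply/(compact_opP _ Yc); split.
  exact: eq_bounded_op ST bS.
exact: eq_op_nets ST nS.
Qed.

Lemma compact_opB S T : compact_op S -> compact_op T -> compact_op (S \- T).
Proof.
move=> /(compact_opP _ Yc)[bS nS] /(compact_opP _ Yc)[bT nT]; apply/(compact_opP _ Yc); split.
  exact: bounded_opB.
exact: op_netsB nS nT.
Qed.

Lemma compact_op0 : compact_op (\0 : {linear Y -> Y}).
Proof. by apply/(compact_opP _ Yc); split; [exact: bounded_op0|exact: op_nets0]. Qed.

Lemma compact_op_compl S T : bounded_op S -> compact_op T -> compact_op (S \o T).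
Proof.
move=> bS /(compact_opP _ Yc)[bT nT]; apply/(compact_opP _ Yc); split.
  exact: bounded_op_comp.
exact: op_nets_compl bS nT.
Qed.

Lemma compact_op_compr S T : compact_op S -> bounded_op T -> compact_op (S \o T).
Proof.
move=> /(compact_opP _ Yc)[bS nS] bT; apply/(compact_opP _ Yc); split.
  exact: bounded_op_comp.
exact: op_nets_compr nS bT.
Qed.

Lemma compact_op_refl T : compact_op (T \- T).
Proof. by apply: eq_compact_op compact_op0 => x /=; rewrite subrr. Qed.

Lemma compact_op_sym S T : compact_op (S \- T) -> compact_op (T \- S).
Proof.
by move=> /(compact_opB compact_op0); apply: eq_compact_op => x /=; rewrite sub0r opprB.
Qed.

Lemma compact_op_trans S T U : compact_op (S \- T) -> compact_op (T \- U) -> compact_op (S \- U).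
Proof.
move=> ST /compact_op_sym UT; apply: eq_compact_op (compact_opB ST UT) => x /=.
by rewrite opprB addrA subrK.
Qed.

Lemma bounded_coset S T : bounded_op T -> compact_op (S \- T) -> bounded_op S.
Proof.
move=> bT /compact_op_sym/compact_bounded bTS; apply: eq_bounded_op (bounded_opB bT bTS) => x /=.
by rewrite opprB addrC subrK.
Qed.

Lemma eq_compact_coset S T : compact_op (S \- T) -> compact_coset S = compact_coset T.
Proof.
move=> ST; apply/seteqP; split=> U /= h; first exact: compact_op_trans h ST.
exact: compact_op_trans h (compact_op_sym ST).
Qed.

Lemma compact_coset_eq0 T : compact_coset T = @SK_zero _ Y <-> compact_op T.
Proof.
have T0 : (T \- \0 : {linear Y -> Y}) =1 T by move=> x /=; rewrite subr0.
split=> [TE|cT].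
  have : compact_coset T T by exact: compact_op_refl.
  by rewrite TE => cT; exact: eq_compact_op T0 cT.
by apply: eq_compact_coset; apply: eq_compact_op cT => x; rewrite T0.
Qed.

Lemma SK_mul_coset S T : bounded_op S -> bounded_op T ->
  SK_mul (compact_coset S) (compact_coset T) = compact_coset (S \o T).
Proof.
move=> bS bT; apply/seteqP; split=> W /=.
  move=> [U [V [SU TV WUV]]]; have bV := bounded_coset bT TV.
  apply: compact_op_trans WUV _.
  (* The identity UV - ST = (U - S)V - S(T - V) writes the difference in terms of two compact
     operators. *)
  have h1 := compact_op_compr SU bV.
  have h2 := compact_op_compl bS (compact_op_sym TV).
  apply: eq_compact_op (compact_opB h1 h2) => x /=.
  by rewrite linearB opprB addrA subrK.
by move=> h; exists S, T; split=> //; exact: compact_op_refl.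
Qed.

Lemma product_cosets (T : nat -> {linear Y -> Y}) n : (forall i, bounded_op (T i)) ->
  product (@SK_mul _ Y) (fun i => compact_coset (T i)) n = compact_coset (compose (mkseq T n.+1)).
Proof.
move=> bT; elim: n => [|n IH].
  by apply: eq_compact_coset; apply: eq_compact_op compact_op0 => x; rewrite /= subrr.
have bC m : bounded_op (compose (mkseq T m)).
  apply: bounded_compose => i; rewrite size_mkseq => im.
  by rewrite /nth_op nth_mkseq.
rewrite [product _ _ _]/= IH SK_mul_coset//; apply: eq_compact_coset; apply: eq_compact_op compact_op0 => x.
have -> : mkseq T n.+2 = mkseq T n.+1 ++ [:: T n.+1] by rewrite cats1 mkseqS.
by rewrite /= compose_cat /= subrr.
Qed.

Lemma SK_nilpotent (n : nat) :
  (forall Ts : seq {linear Y -> Y}, (forall j, (j < size Ts)%N -> strictly_singular (nth_op Ts j)) ->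
    size Ts = n.+1 -> compact_op (compose Ts)) ->
  (exists Ts : seq {linear Y -> Y}, [/\ size Ts = n,
    forall j, (j < size Ts)%N -> strictly_singular (nth_op Ts j) & ~ compact_op (compose Ts)]) ->
  SK_nilpotent_of_index Y n.+1.
Proof.
move=> upper [Ts [sTs ssT ncT]]; split.
  split=> // a aC.
  have /choice[T TP] i : exists T : {linear Y -> Y}, strictly_singular T /\ compact_coset T = a i.
    by have [T ssTi TE] := aC i; exists T.
  have -> : a = (fun i => compact_coset (T i)) by apply/funext => i; rewrite (TP i).2.
  rewrite product_cosets; last by move=> i; have [[]] := TP i.
  apply/compact_coset_eq0; apply: upper; last by rewrite size_mkseq.
  by move=> j; rewrite size_mkseq => jn; rewrite /nth_op nth_mkseq//; have [] := TP j.
move=> j [j0 vj]; rewrite ltnNge; apply/negP => jn.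
have n0 : (0 < size Ts)%N by rewrite sTs; exact: leq_trans jn.
(* Beyond the list the first operator is repeated, so that every term is strictly singular; only the
   first j enter the product. *)
pose T i := nth_op Ts (if (i < size Ts)%N then i else 0%N).
have sT i : strictly_singular (T i) by rewrite /T; apply: ssT; case: ifP.
have bT i : bounded_op (T i) by have [] := sT i.
have := vj (fun i => compact_coset (T i)) (fun i => ex_intro2 _ _ (T i) (sT i) erefl).
rewrite product_cosets// => /compact_coset_eq0; rewrite prednK// => cj.
have tE : mkseq T j = take j Ts.
  apply: (@eq_from_nth _ (idfun : {linear Y -> Y})) => [|i].
    by rewrite size_mkseq size_takel// sTs.
  rewrite size_mkseq => ij; rewrite nth_mkseq// nth_take// /T ifT//.
  by rewrite sTs; exact: leq_trans jn.
apply: ncT; apply: eq_compact_op (compact_op_compr cj (_ : bounded_op (compose (drop j Ts)))).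
  by move=> x /=; rewrite tE -compose_cat cat_take_drop.
apply: bounded_compose => i; rewrite size_drop ltn_subRL => ij.
by rewrite /nth_op nth_drop; have [] := ssT _ ij.
Qed.

End cosets.

(** * From the list of types to the index of nilpotency *)

Section conclusion.
Context {R : realType} {kind : scalar_kind}.
Local Notation K := (scalars R kind).

(** One list gives both bounds: it contains every type that a block sequence in Y can have, and each
    of its members is complemented in Y. *)
Lemma strictly_singular_tuples {Y : normedModType K} {I : finType} {ty : I -> ctype R}
    (pr : forall i, {linear Y -> sspace (k := kind) (ty i)}) (Theta : seq (ctype R)) n :
  decomposition pr ->
  (forall i, ty i \in Theta /\ flat_type (ty i) \in Theta) ->
  size Theta = n.+1 -> uniq Theta ->
  (forall t, t \in Theta -> complemented (Y := Y) t) ->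
  (forall p, TB p \in Theta -> 1 < val p) ->
  [/\ forall T : n.+1.-tuple {linear Y -> Y},
        (forall i, strictly_singular (tnth T i)) -> compact_op (compose T),
      exists T : n.-tuple {linear Y -> Y},
        (forall i, strictly_singular (tnth T i)) /\ ~ compact_op (compose T)
    & SK_nilpotent_of_index Y n.+1].
Proof.
move=> prY tyT sT uT cT T1; have Yc := decomposition_ultra_complete prY.
have upper (Ts : seq {linear Y -> Y}) :
    (forall j, (j < size Ts)%N -> strictly_singular (nth_op Ts j)) ->
    size Ts = n.+1 -> compact_op (compose Ts).
  by move=> ssT sTs; apply: (compose_compact prY tyT ssT); rewrite sT sTs.
have [|Ts [sTs ssT ncT]] := noncompact_composition (Y := Y) _ uT cT T1; first by rewrite sT.
rewrite sT /= in sTs.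
split.
- move=> T ssTi; apply: upper; last by rewrite size_tuple.
  move=> j; rewrite size_tuple => jn.
  by have := ssTi (Ordinal jn); rewrite (tnth_nth (idfun : {linear Y -> Y})).
- have sTs' : size Ts == n by apply/eqP.
  exists (Tuple sTs'); split=> // i; rewrite (tnth_nth (idfun : {linear Y -> Y})).
  by apply: ssT; rewrite sTs.
- by apply: SK_nilpotent => //; exists Ts.
Qed.

End conclusion.

Theorem mainTheorem2 (R : realType) (kind : scalar_kind)
    (L M N : {fset exponent R})
    (L_gt1 : forall p : exponent R, p \in L -> 1 < val p)
    (LMN_neq0 : (L `|` M `|` N)%fset != fset0) :
  let X : normedModType (scalars R kind) :=
    (dsum (fun p : L => baernstein kind (val p))
     * dsum (fun q : M => ellp kind (val q))
     * dsum (fun r : N => convexified_schreier kind (val r)))%type in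
  let Y : normedModType (scalars R kind) := (X * c0 R kind)%type in
  (N != fset0 ->
    isomorphic Y X /\
    let k := (#|` L| + #|` (L `|` M)%fset| + #|` N|)%N in
    [/\ forall T : k.+1.-tuple {linear Y -> Y},
          (forall i, strictly_singular (tnth T i)) -> compact_op (compose T),
        exists T : k.-tuple {linear Y -> Y},
          (forall i, strictly_singular (tnth T i)) /\ ~ compact_op (compose T)
      & SK_nilpotent_of_index Y k.+1]) /\
  (N = fset0 ->
    let k := (#|` L| + #|` (L `|` M)%fset|)%N in
    (forall T : k.+1.-tuple {linear Y -> Y},
       (forall i, strictly_singular (tnth T i)) -> compact_op (compose T)) /\
    exists T : k.-tuple {linear Y -> Y},
      (forall i, strictly_singular (tnth T i)) /\ ~ compact_op (compose T)).
Proof.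
move=> X Y.
have [prL dL] := decomposition_dsum (k := kind) (fun p : L => TB (val p)).
have [prM dM] := decomposition_dsum (k := kind) (fun q : M => Tl (val q)).
have [prN dN] := decomposition_dsum (k := kind) (fun r : N => TS (val r)).
have [prLM dLM] := decomposition_pair dL dM.
have [prX dX] := decomposition_pair dLM dN.
have [prY dY] := decomposition_pair dX (decomposition_sspace (k := kind) (@Tc R)).
(* Each q in L u M counts once, although l_q may come both from B_q and from a summand. With c_0 the
   length is k + 1, while there are k steps between neighbours. *)
pose Theta : seq (ctype R) :=
  map (@TB R) L ++ map (@Tl R) (L `|` M)%fset ++ map (@TS R) N ++ [:: @Tc R].
have sT : size Theta = (#|` L| + #|` (L `|` M)%fset| + #|` N|).+1.
  by rewrite !size_cat !size_map /= !addnA addn1.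
have TBi : injective (@TB R) by move=> x y [].
have Tli : injective (@Tl R) by move=> x y [].
have TSi : injective (@TS R) by move=> x y [].
have tbP p : (TB p \in Theta) = (p \in L).
  rewrite /Theta !mem_cat (mem_map TBi) !inE orbF; apply: orb_idr.
  by move=> /orP[/mapP[]|/mapP[]].
have tlP q : (Tl q \in Theta) = (q \in L) || (q \in M).
  rewrite /Theta !mem_cat (mem_map Tli) !inE orbF.
  have -> : (Tl q \in map (@TB R) L) = false by apply/negP => /mapP[].
  have -> : (Tl q \in map (@TS R) N) = false by apply/negP => /mapP[].
  by rewrite orbF.
have tsP r : (TS r \in Theta) = (r \in N).
  rewrite /Theta !mem_cat (mem_map TSi) !inE orbF.
  have -> : (TS r \in map (@TB R) L) = false by apply/negP => /mapP[].
  by have -> : (TS r \in map (@Tl R) (L `|` M)%fset) = false by apply/negP => /mapP[].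
have tcP : @Tc R \in Theta by rewrite !mem_cat mem_head !orbT.
have uT : uniq Theta.
  rewrite !cat_uniq !map_inj_uniq// !fset_uniq/= !has_cat/= !orbF !andbT.
  rewrite !negb_or -!andbA; apply/and5P; split; rewrite ?andbT.
  - by apply/hasPn => _ /mapP[q _ ->]; apply/negP => /mapP[].
  - by apply/hasPn => _ /mapP[q _ ->]; apply/negP => /mapP[].
  - by apply/negP => /mapP[].
  - by apply/hasPn => _ /mapP[q _ ->]; apply/negP => /mapP[].
  apply/andP; split.
  - by apply/negP => /mapP[].
  - by apply/negP => /mapP[].
have compL p : p \in L -> complemented (Y := Y) (TB p).
  by move=> pL; exact: decomposition_complemented (inl (inl (inl [` pL]%fset))) dY.
have cY t : t \in Theta -> complemented (Y := Y) t.
  move: t => [[[p|q]|r]|[]].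
  - by rewrite tbP; exact: compL.
  - rewrite tlP => /orP[qL|qM].
      exact: complemented_trans (compL q qL) (complemented_flat_type (TB q)).
    exact: decomposition_complemented (inl (inl (inr [` qM]%fset))) dY.
  - rewrite tsP => rN.
    exact: decomposition_complemented (inl (inr [` rN]%fset)) dY.
  - by move=> _; exact: decomposition_complemented (inr tt) dY.
have tbL p : TB p \in Theta -> 1 < val p by rewrite tbP; exact: L_gt1.
have [|upper lower nilp] := strictly_singular_tuples dY _ sT uT cY tbL.
  move=> [[[p|q]|r]|[]].
  - by rewrite /= -/(TB (val p)) tbP tlP !(valP p).
  - by rewrite /= -/(Tl (val q)) !tlP (valP q) orbT.
  - by rewrite /= -/(TS (val r)) tsP (valP r).
  - by rewrite /= -/Tc.
(* The bounds hold for Y in both cases alike; N decides whether c_0 is complemented in X through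
   some S_r, which gives the isomorphism. *)
split=> [N0|N0]; last first.
  have cN : #|` N| = 0%N by apply/eqP; rewrite cardfs_eq0 N0.
  by rewrite cN addn0 in upper lower; split; [exact: upper|exact: lower].
split; last by [].
apply: isomorphic_pair_c0; have [r rN] := fset0Pn _ N0.
apply: complemented_trans (decomposition_complemented (inr [` rN]%fset) dX) _.
exact: complemented_flat_type.
Qed.
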